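(* Let $(M,\mathcal D,\mathbf g)$ be a quasi-contact sub-Riemannian structure with normalized one-form $\eta$ and quasi-contact endomorphism $J:\mathcal D\to\mathcal D$. For any fixed volume form $\omega$, the space of complements $\mathbf c$ such that $L^{\mathbf c}=\Delta_\omega$ is either empty or an affine space over $\ker J$.
   Context: A sub-Riemannian structure is a triple $(M,\mathcal D,\mathbf g)$ where $M$ is a smooth connected orientable $n$-manifold, $\mathcal D\subset TM$ is a smooth bracket-generating distribution of constant rank $k<n$, and $\mathbf g$ is a smooth scalar product on $\mathcal D$. A complement $\mathbf c$ is a smooth sub-bundle of $TM$ with $TM=\mathcal D\oplus\mathbf c$. Quasi-contact structures: $n=2d+2$, $k=n-1$, $\mathcal D$ has step $2$ ($\mathcal D+[\mathcal D,\mathcal D]=TM$), and $\mathcal D=\ker\eta$ for a one-form $\eta$ (assumed globally defined). $J:\mathcal D\to\mathcal D$ is defined by $\mathbf g(X,JY)=d\eta(X,Y)$ for $X,Y\in\Gamma(\mathcal D)$, where $d\eta(X,Y)=X(\eta(Y))-Y(\eta(X))-\eta([X,Y])$. The form $\eta$ is normalized (unique up to sign) by $\|J\|^2=\mathrm{Tr}(JJ^* )=1$. Quasi-contact means $\dim\ker J=1$ at every point. Each complement $\mathbf c$ has a unique generator $X_0$ with $\eta(X_0)=1$, so complements correspond to such vector fields, and the difference of two of them is a section of $\mathcal D$. ''Affine space over $\ker J$'' means: if $X_0$ is the normalized generator of one complement with $L^{\mathbf c}=\Delta_\omega$, then the normalized generators of all such complements are exactly $X_0+\xi$ with $\xi\in\Gamma(\ker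 J)$. Macroscopic Laplacian: $\Delta_\omega=\mathrm{div}_\omega\circ\mathrm{grad}$, where $\mathrm{grad}(f)\in\Gamma(\mathcal D)$ is defined by $\mathbf g(\mathrm{grad}(f),X)=df(X)$ for $X\in\Gamma(\mathcal D)$, and $\mathrm{div}_\omega(X)\,\omega=\mathcal L_X\omega$. Microscopic Laplacian: let $H(\lambda)=\frac12\sum_{i=1}^k\langle\lambda,X_i\rangle^2$ on $T^*M$ ($X_1,\dots,X_k$ a local orthonormal frame of $\mathcal D$), $C_q=\{\lambda\in T^*_qM:2H(\lambda)=1\}$, and $\exp_q(t,\lambda)$ the projection to $M$ of the integral curve at time $t$ of the Hamiltonian vector field of $H$ starting at $\lambda$. Put $\mathbf h_q=\mathbf c_q^\perp$, $\mathbf v_q=\mathcal D_q^\perp$ (annihilators), so $C_q=\mathbb S_q^{k-1}\times\mathbf v_q$ with $\mathbb S_q^{k-1}=C_q\cap\mathbf h_q$ the unit sphere of $(\mathbf h_q,2H|_{\mathbf h_q})$. Then $$(L^{\mathbf c}\phi)(q)=\lim_{t\to0^+}\frac{2k}{t^2}\int_{C_q}\big(\phi(\exp_q(t,\lambda))-\phi(q)\big)\mu_q(\lambda),$$ where $\mu_q=\mu_{\mathbb S_q^{k-1}}\times\mu_{\mathbf v_q}$, with $\mu_{\mathbb S_q^{k-1}}$ the uniform probability measure and $\mu_{\mathbf v_q}$ a Borel probability measure on $\mathbf v_q$ for which linear functions are square-integrable and such that $q\mapsto\int_{C_q}f^2\mu_q$ is continuous for each continuous fiberwise linear $f:T^*M\to\mathbb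 R$ (e.g. $\mu_{\mathbf v_q}=\delta_0$). It is a fact that the limit exists, is independent of the choice of such measures, and in any local orthonormal frame $X_1,\dots,X_k$ of $\mathcal D$ completed by a local frame $X_{k+1},\dots,X_n$ of $\mathbf c$, with $[X_i,X_j]=\sum_\ell c_{ij}^\ell X_\ell$, equals $L^{\mathbf c}=\sum_{i=1}^kX_i^2+\sum_{i,j=1}^kc_{ji}^jX_i$. *)

(* Defs.v *)
From HB Require Import structures.
From mathcomp Require Import all_boot all_order all_algebra.
From mathcomp Require Import all_classical all_reals all_analysis.

Set Implicit Arguments.
Unset Strict Implicit.
Unset Printing Implicit Defensive.

Import Order.TTheory GRing.Theory Num.Theory.
Import numFieldNormedType.Exports.

Local Open Scope classical_set_scope.
Local Open Scope ring_scope.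

Section Euclidean.
Context {R : realType} {n : nat}.

Definition basis_vec (a : 'I_n) : 'rV[R]_n := delta_mx 0 a.

Fixpoint iter_partial (s : seq 'I_n) (f : 'rV[R]_n -> R) : 'rV[R]_n -> R :=
  if s is a :: s' then fun x => 'D_(basis_vec a) (iter_partial s' f) x else f.

(* C^infinity on an open set: all iterated partial derivatives exist and are
   Fréchet differentiable there. *)
Definition smooth_eucl (W : set 'rV[R]_n) (f : 'rV[R]_n -> R) : Prop :=
  forall (s : seq 'I_n) x, W x -> differentiable (iter_partial s f) x.

End Euclidean.

Record chart (R : realType) (n : nat) (M : topologicalType) := Chart {
  cdom : set M;
  crng : set 'rV[R]_n;
  cmap : M -> 'rV[R]_n;
  cinv : 'rV[R]_n -> M;
  cdom_open : open cdom;
  crng_open : open crng;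
  cmap_rng : forall q, cdom q -> crng (cmap q);
  cinv_dom : forall y, crng y -> cdom (cinv y);
  cmapK : forall q, cdom q -> cinv (cmap q) = q;
  cinvK : forall y, crng y -> cmap (cinv y) = y;
  cmap_cont : forall q, cdom q -> {for q, continuous cmap};
  cinv_cont : forall y, crng y -> {for y, continuous cinv}
}.

(* [chart_at q] is a choice of a chart of the atlas around [q].  It serves to
   represent the tangent space at [q] as the vector space 'rV_n. *)
Record smooth_manifold (R : realType) (n : nat) := SmoothManifold {
  carrier :> topologicalType;
  atlas : set (chart R n carrier);
  chart_at : carrier -> chart R n carrier;
  manifold_hausdorff : hausdorff_space carrier;
  manifold_second_countable : @second_countable carrier;
  chart_at_atlas : forall q, atlas (chart_at q);
  chart_at_dom : forall q, cdom (chart_at q) q;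
  transition_smooth : forall c c', atlas c -> atlas c' ->
    forall a : 'I_n,
      smooth_eucl (cmap c @` (cdom c `&` cdom c'))
        (fun y => cmap c' (cinv c y) 0 a)
}.

Section Calculus.
Context {R : realType} {n : nat} {M : smooth_manifold R n}.

(* T_qM is 'rV_n and T*_qM is 'cV_n, both read through [chart_at q]: the tangent
   vector v stands for \sum_a v_a d/dx^a, and the covector l for \sum_a l_a dx^a,
   where x^1, ..., x^n are the coordinates of [chart_at q]. *)
Definition vfield := M -> 'rV[R]_n.
Definition oneform := M -> 'cV[R]_n.

Definition pairing (l : 'cV[R]_n) (v : 'rV[R]_n) : R := \sum_a l a 0 * v 0 a.

Definition chart_coord (c : chart R n M) (a : 'I_n) (q : M) : R := cmap c q 0 a.

Definition dact (q : M) (v : 'rV[R]_n) (f : M -> R) : R :=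
  'D_v (f \o cinv (chart_at q)) (cmap (chart_at q) q).

Definition differential (f : M -> R) : oneform :=
  fun q => \col_a dact q (basis_vec a) f.

Definition vact (X : vfield) (f : M -> R) : M -> R := fun q => dact q (X q) f.

Definition smooth_fun (U : set M) (f : M -> R) : Prop :=
  forall c, atlas c -> smooth_eucl (cmap c @` (U `&` cdom c)) (f \o cinv c).

(* The choice of [chart_at] may jump from point to point, so smoothness of a
   vector field is tested on local smooth functions and not on components. *)
Definition smooth_vfield (U : set M) (X : vfield) : Prop :=
  forall V f, open V -> V `<=` U -> smooth_fun V f -> smooth_fun V (vact X f).

Definition form_eval (eta : oneform) (X : vfield) : M -> R :=
  fun q => pairing (eta q) (X q).

Definition smooth_oneform (eta : oneform) : Prop :=
  forall U X, open U -> smooth_vfield U X -> smooth_fun U (form_eval eta X).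

(* [X, Y] f = X (Y f) - Y (X f), applied to the coordinate functions. *)
Definition bracket (X Y : vfield) : vfield :=
  fun q => \row_a (vact X (vact Y (chart_coord (chart_at q) a)) q
                   - vact Y (vact X (chart_coord (chart_at q) a)) q).

Definition ext_d (eta : oneform) (X Y : vfield) : M -> R :=
  fun q => vact X (form_eval eta Y) q - vact Y (form_eval eta X) q
           - form_eval eta (bracket X Y) q.

Definition nform := M -> ('I_n -> 'rV[R]_n) -> R.

Definition subst_arg (Y : 'I_n -> 'rV[R]_n) (i : 'I_n) (v : 'rV[R]_n) :=
  fun j => if j == i then v else Y j.

Definition nform_eval (w : nform) (Y : 'I_n -> vfield) : M -> R :=
  fun q => w q (fun i => Y i q).

Definition volume_form (w : nform) : Prop :=
  [/\ forall q Y i a u v, w q (subst_arg Y i (a *: u + v))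
        = a * w q (subst_arg Y i u) + w q (subst_arg Y i v),
      forall q Y i j, i != j -> Y i = Y j -> w q Y = 0,
      forall q, exists Y, w q Y != 0
    & forall U Y, open U -> (forall i, smooth_vfield U (Y i)) ->
        smooth_fun U (nform_eval w Y)].

Definition orientable : Prop := exists w, volume_form w.

(* (L_X w)(Y_1, .., Y_n) *)
Definition lie_nform (X : vfield) (w : nform) (Y : 'I_n -> vfield) : M -> R :=
  fun q => vact X (nform_eval w Y) q
    - \sum_i w q (subst_arg (fun j => Y j q) i (bracket X (Y i) q)).

Definition is_div (w : nform) (X : vfield) (delta : M -> R) : Prop :=
  forall U Y, open U -> (forall i, smooth_vfield U (Y i)) ->
    forall q, U q -> lie_nform X w Y q = delta q * nform_eval w Y q.

Definition subbundle := M -> {vspace 'rV[R]_n}.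

Definition smooth_subbundle (k : nat) (D : subbundle) : Prop :=
  (forall q, \dim (D q) = k) /\
  forall q, exists U (X : 'I_k -> vfield),
    [/\ open U, U q, forall i, smooth_vfield U (X i)
      & forall p, U p -> D p = <<[seq X i p | i : 'I_k]>>%VS].

Definition section_on (U : set M) (D : subbundle) (X : vfield) : Prop :=
  smooth_vfield U X /\ forall q, U q -> X q \in D q.

Definition is_section (D : subbundle) (X : vfield) := section_on setT D X.

(* iterated brackets of global sections *)
Inductive lie_gen (D : subbundle) : vfield -> Prop :=
| lie_gen_section X : is_section D X -> lie_gen D X
| lie_gen_bracket X Y : lie_gen D X -> lie_gen D Y -> lie_gen D (bracket X Y).

Definition bracket_generating (D : subbundle) : Prop :=
  forall q v, exists m (a : 'I_m -> R) (X : 'I_m -> vfield),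
    (forall i, lie_gen D (X i)) /\ v = \sum_i a i *: X i q.

Definition step_two (D : subbundle) : Prop :=
  forall q v, exists u m (a : 'I_m -> R) (X Y : 'I_m -> vfield),
    [/\ u \in D q, forall i, is_section D (X i) /\ is_section D (Y i)
      & v = u + \sum_i a i *: bracket (X i) (Y i) q].

End Calculus.

Arguments vfield {R n} M.
Arguments oneform {R n} M.
Arguments nform {R n} M.
Arguments subbundle {R n} M.
Arguments orientable {R n} M.

(* [metric q] is only meaningful on [distr q]. *)
Record subriemannian (R : realType) (n : nat) (M : smooth_manifold R n)
    (k : nat) := SubRiemannian {
  distr : subbundle M;
  metric : M -> 'rV[R]_n -> 'rV[R]_n -> R;
  sr_connected : connected [set: M];
  sr_orientable : orientable M;
  sr_rank : (k < n)%N;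
  distr_smooth : smooth_subbundle k distr;
  distr_bracket : bracket_generating distr;
  metric_sym : forall q, {in distr q &, forall u v, metric q u v = metric q v u};
  metric_lin : forall q a, {in distr q & &, forall u v w,
    metric q (a *: u + v) w = a * metric q u w + metric q v w};
  metric_pos : forall q, {in distr q, forall v, v != 0 -> 0 < metric q v v};
  metric_smooth : forall U X Y, open U ->
    section_on U distr X -> section_on U distr Y ->
    smooth_fun U (fun q => metric q (X q) (Y q))
}.

Section SubRiemannian.
Context {R : realType} {n k : nat} {M : smooth_manifold R n}.
Variable S : subriemannian M k.

Local Notation D := (distr S).
Local Notation g := (metric S).

(* since \dim (D q) = k, such a family is a basis of D q *)
Definition orthonormal_basis (q : M) (e : 'I_k -> 'rV[R]_n) : Prop :=
  (forall i, e i \in D q) /\ forall i j, g q (e i) (e j) = (i == j)%:R.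

Definition is_complement (c : subbundle M) : Prop :=
  [/\ smooth_subbundle (n - k) c,
      forall q, (D q + c q)%VS = fullv
    & forall q, (D q :&: c q)%VS = 0%VS].

Definition is_grad (f : M -> R) (G : vfield M) : Prop :=
  is_section D G /\
  forall q v, v \in D q -> g q (G q) v = pairing (differential f q) v.

Definition is_macro_laplacian (w : nform M) (f psi : M -> R) : Prop :=
  exists G, is_grad f G /\ is_div w G psi.

Definition some_onb (q : M) : 'I_k -> 'rV[R]_n :=
  xget (fun=> 0) [set e | orthonormal_basis q e].

(* independent of the orthonormal basis *)
Definition hamiltonian (q : M) (l : 'cV[R]_n) : R :=
  2^-1 * \sum_i pairing l (some_onb q i) ^+ 2.

(* \sum_a p_a dx^a at the point of coordinates y, for the coordinates x^a of the
   chart c: (y, p) are the canonical coordinates on T*M attached to c. *)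
Definition cotangent_chart (c : chart R n M) (y : 'rV[R]_n) (p : 'cV[R]_n) :
    'cV[R]_n :=
  \sum_a p a 0 *: differential (chart_coord c a) (cinv c y).

Definition hamiltonian_chart (c : chart R n M) (y : 'rV[R]_n) (p : 'cV[R]_n) : R :=
  hamiltonian (cinv c y) (cotangent_chart c y p).

(* Hamilton's equations dy/dt = dH/dp, dp/dt = - dH/dy at time s in canonical
   coordinates; they do not depend on the chart. *)
Definition hamilton_at (gamma : R -> M * 'cV[R]_n) (s : R) : Prop :=
  exists (c : chart R n M) (y : R -> 'rV[R]_n) (p : R -> 'cV[R]_n),
    [/\ atlas c,
        \forall r \near s, crng c (y r) /\
          gamma r = (cinv c (y r), cotangent_chart c (y r) (p r)),
        is_derive s 1 y
          (\row_a 'D_(delta_mx a 0) (hamiltonian_chart c (y s)) (p s))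
      & is_derive s 1 p
          (- \col_a 'D_(basis_vec a) (hamiltonian_chart c ^~ (p s)) (y s))].

Definition hamilton_curve (a b : R) (gamma : R -> M * 'cV[R]_n) : Prop :=
  forall s, a < s < b -> hamilton_at gamma s.

(* Takes the default value q when the integral curve is not defined up to time
   t, which does not occur for small t. *)
Definition sr_exp (q : M) (t : R) (l : 'cV[R]_n) : M :=
  xget q [set z | exists a b gamma, [/\ a < 0 < b, a < t < b,
    hamilton_curve a b gamma, gamma 0 = (q, l) & z = (gamma t).1]].

Definition annihilator (V : {vspace 'rV[R]_n}) : set 'cV[R]_n :=
  [set l | forall v, v \in V -> pairing l v = 0].

Definition unit_cylinder (q : M) : set 'cV[R]_n :=
  [set l | 2 * hamiltonian q l = 1].

(* T*_qM with its Borel sigma-algebra *)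
Definition borel_cov := g_sigma_algebraType (@open 'cV[R]_n).

Local Notation prob := (probability borel_cov R).

(* the uniform probability measure on C_q `&` h_q, with h_q the annihilator of
   c_q: the one which is invariant under the linear isometries of (h_q, 2H) *)
Definition uniform_sphere (c : subbundle M) (q : M) (mu : prob) : Prop :=
  mu (unit_cylinder q `&` annihilator (c q)) = 1%E /\
  forall A : 'M[R]_n,
    (forall l, annihilator (c q) l -> annihilator (c q) (A *m l) /\
       hamiltonian q (A *m l) = hamiltonian q l) ->
    forall B : set borel_cov, measurable B ->
      mu [set l | B (A *m l)] = mu B.

Definition vertical_measure (q : M) (mu : prob) : Prop :=
  mu (annihilator (D q)) = 1%E /\
  forall v, (\int[mu]_l ((pairing l v) ^+ 2)%:E < +oo)%E.

(* Integral over C_q = S_q x v_q against mu_q = muS x muV; the pair (h, v)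
   stands for the covector h + v. *)
Definition cylinder_integral (muS muV : prob) (F : 'cV[R]_n -> R) : \bar R :=
  (\int[muS \x muV]_z (F ((z.1 : 'cV[R]_n) + (z.2 : 'cV[R]_n)))%:E)%E.

Definition fiberwise_linear (f : M -> 'cV[R]_n -> R) : Prop :=
  forall q a l m, f q (a *: l + m) = a * f q l + f q m.

Definition continuous_cotangent (f : M -> 'cV[R]_n -> R) : Prop :=
  forall c, atlas c -> forall y p, crng c y ->
    {for (y, p), continuous (fun z : 'rV[R]_n * 'cV[R]_n =>
       f (cinv c z.1) (cotangent_chart c z.1 z.2))}.

Definition admissible_measures (c : subbundle M) (muS muV : M -> prob) : Prop :=
  [/\ forall q, uniform_sphere c q (muS q),
      forall q, vertical_measure q (muV q)
    & forall f, fiberwise_linear f -> continuous_cotangent f ->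
        continuous (fun q =>
          cylinder_integral (muS q) (muV q) (fun l => f q l ^+ 2))].

(* psi = L^c f, for the complement c and the measures used on its fibers *)
Definition is_micro_laplacian (muS muV : M -> prob) (f psi : M -> R) : Prop :=
  forall q,
    (fun t : R => ((2 * k%:R / t ^+ 2)%:E *
       cylinder_integral (muS q) (muV q) (fun l => f (sr_exp q t l) - f q)%R)%E)
    @ 0^'+ --> (psi q)%:E.

Definition laplacians_agree (w : nform M) (muS muV : M -> prob) : Prop :=
  forall f, smooth_fun setT f ->
    exists psi, is_macro_laplacian w f psi /\ is_micro_laplacian muS muV f psi.

Definition is_adjoint (q : M) (T Ts : 'End('rV[R]_n)) : Prop :=
  (Ts @: D q <= D q)%VS /\
  {in D q &, forall u v, g q (Ts u) v = g q u (T v)}.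

Definition has_trace (q : M) (T : 'rV[R]_n -> 'rV[R]_n) (a : R) : Prop :=
  forall e, orthonormal_basis q e -> \sum_i g q (e i) (T (e i)) = a.

(* J q is only meaningful on D q. *)
Definition is_endo (eta : oneform M) (J : M -> 'End('rV[R]_n)) : Prop :=
  (forall q, (J q @: D q <= D q)%VS) /\
  forall U X Y, open U -> section_on U D X -> section_on U D Y ->
    forall q, U q -> g q (X q) (J q (Y q)) = ext_d eta X Y q.

Definition normalized (J : M -> 'End('rV[R]_n)) : Prop :=
  forall q, exists Js, is_adjoint q (J q) Js /\ has_trace q (J q \o Js) 1.

Definition ker_endo (J : M -> 'End('rV[R]_n)) : subbundle M :=
  fun q => (D q :&: lker (J q))%VS.

Definition quasi_contact (eta : oneform M) (J : M -> 'End('rV[R]_n)) : Prop :=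
  [/\ step_two D,
      smooth_oneform eta /\ (forall q v, v \in D q <-> pairing (eta q) v = 0),
      is_endo eta J,
      normalized J
    & forall q, \dim (ker_endo J q) = 1%N].

Definition is_generator (eta : oneform M) (c : subbundle M) (X0 : vfield M) :
    Prop :=
  is_section c X0 /\ forall q, pairing (eta q) (X0 q) = 1.

End SubRiemannian.

Arguments borel_cov R n : clear implicits.

(* Main.v *)
From HB Require Import structures.
Require Import Defs.
From mathcomp Require Import all_boot all_order all_algebra.
From mathcomp Require Import all_classical all_reals all_analysis.
From mathcomp Require Import measurable_realfun ring lra.
Import numFieldNormedType.Exports.

(** Let X_1, ..., X_k be a local orthonormal frame of D, X_0 the normalized
    generator of a complement c, and Z_ij = [X_i, X_j].  The microscopic
    Laplacian of c is, at each point,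

      L f = sum_i X_i X_i f + sum_ij g(X_i, Z_ij - eta(Z_ij) X_0) X_j f

    ([micro_limit], [micro_value]).  Replacing X_0 by X_0 + xi, with xi in D,
    adds - sum_ij eta(Z_ij) g(X_i, xi) X_j f.  Since the X_i are in the kernel of
    eta, eta(Z_ij) = - d eta(X_i, X_j) = - g(X_i, J X_j) = g(X_j, J X_i), and
    this is the derivative of f along - J xi ([laplacian_variation]).

    Suppose that two complements, of generators X_0 and X_1, have the macroscopic
    Laplacian of omega as microscopic Laplacian.  The macroscopic Laplacian of a
    function is unique ([macro_unique]), so J (X_1 - X_0) annihilates every smooth
    function; as there are enough bump functions, it is 0
    ([agree_difference], [tangent_eq0]).  Conversely, adding to X_0 a section xi
    of ker J gives the generator of a complement with the same microscopic
    Laplacian ([agree_shift]).  Finally each complement has a smooth normalized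
    generator ([generator_exists]).

    The formula for L is obtained from the definition as a limit of integrals.
    Along a solution of Hamilton's equations from a covector l of energy 1/2, the
    function f has the expansion f(q) + t A(l) + t^2/2 Q(l), where A is linear and
    Q quadratic in l, with an error bounded by C (1 + |l|)^2 t^3 for t <= t0, where
    C and t0 do not depend on l ([flow_expansion]).  Solutions exist up to a time
    that decreases like 1/|l| ([flow_exists], from the Picard iteration [picard]
    and the homogeneity of the flow).  The covectors for which there is no solution
    up to time t are larger than e0/t, and contribute o(t^2) because the measure
    on the vertical covectors has a second moment ([second_order_limit]).  It
    remains to compute the means of A and Q.  The measure on the unit sphere is
    invariant under the reflections that change the sign of one component or
    exchange two of them, so that its components u_i in the dual frame have mean 0
    and u_i u_j has mean 1/k or 0 according to whether i = j or not
    ([sphere_mean], [sphere_mean_diag], [sphere_mean_offdiag]).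

    The exponential map is not known to depend measurably on l.  The integral is a
    difference of suprema over simple functions, hence monotone on all functions
    ([le_integral_any]), which is enough to squeeze it between the integrals of
    the expansion plus and minus its error. *)

Set Implicit Arguments.
Unset Strict Implicit.
Unset Printing Implicit Defensive.
Import Order.TTheory GRing.Theory Num.Theory.

Local Open Scope classical_set_scope.
Local Open Scope ring_scope.

(** * Smooth functions of several variables *)

Lemma near_nbhs {T : topologicalType} (x : T) (P : set T) :
  (\forall y \near x, P y) -> \forall y \near x, \forall z \near y, P z.
Proof. exact: nbhs_interior. Qed.

Lemma near_forall {T : topologicalType} {I : finType} (x : T) (P : I -> set T) :
  (forall i, \forall y \near x, P i y) -> \forall y \near x, forall i, P i y.
Proof. by move=> H; exact: filter_forall. Qed.

Lemma near_and {T : topologicalType} (x : T) (P Q : set T) :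
  (\forall y \near x, P y) -> (\forall y \near x, Q y) ->
  \forall y \near x, P y /\ Q y.
Proof. by move=> HP HQ; exact: filterI. Qed.

Section NearDifferentiable.
Context {R : realType} {V W : normedModType R}.

Lemma near_eq_differentiable (f g : V -> W) (x : V) :
  {near x, f =1 g} -> differentiable f x -> differentiable g x.
Proof.
move=> fg df.
have fgx : f x = g x by exact: nbhs_singleton fg.
have cdf := diff_continuous df.
have E : g \o shift x = cst (g x) + 'd f x +o_ 0 id.
  have /diff_locally/eqaddoP H := df.
  apply/eqaddoP => e e0; have := H e e0.
  apply: filter_app.
  have : \forall h \near (0 : V), f (h + x) = g (h + x).
    by move: fg; rewrite (near_shift 0 x) subr0.
  apply: filterS => h E1.
  by rewrite !fctE /= E1 fgx.
apply/diff_locallyP; rewrite (diff_unique cdf E); split=> //.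
Qed.

End NearDifferentiable.

Section Partial.
Context {R : realType} {n : nat}.
Implicit Types (f g : 'rV[R]_n -> R).

Local Notation pd a f := (fun y => 'D_(basis_vec a) f y).

Lemma differentiable_rV {V : normedModType R} {m} (phi : V -> 'rV[R]_m) (x : V) :
  (forall b, differentiable (fun y => phi y 0 b) x) -> differentiable phi x.
Proof.
move=> H.
rewrite (_ : phi = \sum_b (fun y => phi y 0 b *: (delta_mx 0 b : 'rV[R]_m))).
  by apply: differentiable_sum => b; apply: differentiableZl.
apply/funext => y; rewrite fct_sumE [LHS]row_sum_delta //.
Qed.

Lemma derive_partials {W : normedModType R} (f : 'rV[R]_n -> W) x v :
  differentiable f x ->
  'D_v f x = \sum_a v 0 a *: 'D_(basis_vec a) f x.
Proof.
move=> df; rewrite deriveE // {1}[v]row_sum_delta linear_sum.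
by apply: eq_bigr => a _; rewrite linearZ /= deriveE.
Qed.

Lemma derive_rV {V : normedModType R} {m} (phi : V -> 'rV[R]_m) (x v : V) (b : 'I_m) :
  differentiable phi x -> ('D_v phi x) 0 b = 'D_v (fun y => phi y 0 b) x.
Proof. by move=> d; rewrite derive_mx ?mxE //; exact: diff_derivable. Qed.

Lemma chain_rule {V : normedModType R} f
    (phi : V -> 'rV[R]_n) (x v : V) :
  differentiable phi x -> differentiable f (phi x) ->
  'D_v (f \o phi) x =
  \sum_b 'D_(basis_vec b) f (phi x) * 'D_v (fun y => phi y 0 b) x.
Proof.
move=> dp df; rewrite deriveE; last exact: differentiable_comp.
rewrite diff_comp //= -deriveE // -deriveE // derive_partials //.
by apply: eq_bigr => b _; rewrite derive_rV // mulrC.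
Qed.

Lemma derive_comp1 {V : normedModType R} (h : R -> R) (f : V -> R) (x v : V) dh :
  is_derive (f x) 1 h dh -> differentiable f x ->
  'D_v (fun y => h (f y)) x = dh * 'D_v f x.
Proof.
move=> [dh1 dhE] df.
have d : differentiable h (f x) by apply/derivable1_diffP.
rewrite [LHS](@deriveE _ _ _ (h \o f)); last exact: differentiable_comp.
have -> : 'd (h \o f) x v = 'd h (f x) ('d f x v *: 1) :> R.
  by rewrite diff_comp //= /GRing.scale /= mulr1.
by rewrite linearZ /= -!deriveE // dhE /GRing.scale /= mulrC.
Qed.

(** C^N in a neighbourhood of a point.  Formulating smoothness on germs makes the
    closure properties below inductions on N without any bookkeeping of
    domains. *)
Fixpoint cont_diff (N : nat) (f : 'rV[R]_n -> R) (x : 'rV[R]_n) : Prop :=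
  (\forall y \near x, differentiable f y) /\
  if N is N'.+1 then forall a, cont_diff N' (pd a f) x else True.

Definition smooth_germ (f : 'rV[R]_n -> R) (x : 'rV[R]_n) : Prop :=
  \forall y \near x, forall N, cont_diff N f y.

Lemma cont_diff_near N f x :
  cont_diff N f x -> \forall y \near x, differentiable f y.
Proof. by case: N => [|N] []. Qed.

Lemma cont_diff_eq N f g x : (\forall y \near x, f y = g y) ->
  cont_diff N f x -> cont_diff N g x.
Proof.
elim: N f g => [|N IH] f g fg [df H]; have fg2 := near_nbhs fg; split=> //.
- by near=> y; apply: (@near_eq_differentiable _ _ _ f); near: y.
- by near=> y; apply: (@near_eq_differentiable _ _ _ f); near: y.
move=> a; apply: IH (H a); near=> y; apply: near_eq_derive.
by near: y.
Unshelve. all: by end_near. Qed.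

Lemma cont_diffW N f x : cont_diff N.+1 f x -> cont_diff N f x.
Proof.
elim: N f => [|N IH] f [df H]; split=> // a.
exact: IH (H a).
Qed.

Lemma cont_diffD N f g x : cont_diff N f x -> cont_diff N g x ->
  cont_diff N (fun y => f y + g y) x.
Proof.
elim: N f g => [|N IH] f g [df Hf] [dg Hg]; split=> //.
- by near=> y; apply: differentiableD; near: y.
- by near=> y; apply: differentiableD; near: y.
move=> a; apply: (cont_diff_eq _ (IH _ _ (Hf a) (Hg a))).
near=> y; rewrite -(@deriveD _ _ _ f g) //; apply: diff_derivable; near: y => //.
Unshelve. all: by end_near. Qed.

Lemma cont_diffM N f g x : cont_diff N f x -> cont_diff N g x ->
  cont_diff N (fun y => f y * g y) x.
Proof.
elim: N f g => [|N IH] f g Cf Cg; move: (Cf) (Cg) => [df Hf] [dg Hg]; split=> //.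
- by near=> y; apply: differentiableM; near: y.
- by near=> y; apply: differentiableM; near: y.
move=> a.
apply: (cont_diff_eq _ (cont_diffD (IH _ _ (cont_diffW Cf) (Hg a))
                                   (IH _ _ (cont_diffW Cg) (Hf a)))).
near=> y; rewrite (@deriveM _ _ f g) //; apply: diff_derivable; near: y => //.
Unshelve. all: by end_near. Qed.

Lemma cont_diff_cst N (c : R) x : cont_diff N (fun=> c) x.
Proof.
elim: N c => [|N IH] c; split=> //.
- by near=> y; exact: differentiable_cst.
- by near=> y; exact: differentiable_cst.
move=> a; apply: (cont_diff_eq _ (IH 0)).
by near=> y; rewrite derive_cst.
Unshelve. all: by end_near. Qed.

Lemma cont_diff_sum N I (s : seq I) (P : pred I) (F : I -> 'rV[R]_n -> R) x :
  (forall i, P i -> cont_diff N (F i) x) ->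
  cont_diff N (fun y => \sum_(i <- s | P i) F i y) x.
Proof.
move=> H.
rewrite (_ : (fun y => _) = \sum_(i <- s | P i) F i); last first.
  by apply/funext => y; rewrite fct_sumE.
elim/big_rec: _ => [|i f Pi Cf]; first exact: cont_diff_cst.
by apply: cont_diffD => //; apply: H.
Qed.

Lemma cont_diff_coord N a x : cont_diff N (fun y => y 0 a) x.
Proof.
have d y : differentiable (fun y : 'rV[R]_n => y 0 a) y.
  exact: differentiable_coord.
case: N => [|N]; split=> //; first by near=> y.
  by near=> y.
move=> b; apply: (cont_diff_eq _ (cont_diff_cst N (basis_vec b 0 a) x)).
near=> y; by rewrite -(@derive_rV _ _ id) ?derive_id //.
Unshelve. all: by end_near. Qed.

(** The induction needs a family h closed under differentiation.  This two-term
    recurrence covers the powers t^(a-k), with v = 0, and the flat functions. *)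
Lemma cont_diff_comp1 N k (I : set R) (h : nat -> R -> R) (u v : nat -> R) f x :
  (forall k, forall t, I t ->
     is_derive t 1 (h k) (u k * h k.+1 t + v k * h k.+2 t)) ->
  (\forall y \near x, I (f y)) ->
  cont_diff N f x -> cont_diff N (fun y => h k (f y)) x.
Proof.
move=> Hh If.
have dh : forall l t, I t -> differentiable (h l) t.
  by move=> l t It; apply/derivable1_diffP; have [] := Hh l t It.
elim: N k => [|N IH] k Cf; move: (Cf) => [df Hf]; split=> //.
- near=> y; apply: (@differentiable_comp _ _ _ _ f (h k)); first by near: y.
  by apply: dh; near: y.
- near=> y; apply: (@differentiable_comp _ _ _ _ f (h k)); first by near: y.
  by apply: dh; near: y.
move=> a.
have C l := IH l (cont_diffW Cf).
apply: (cont_diff_eq _ (cont_diffM (cont_diffD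
  (cont_diffM (cont_diff_cst N (u k) x) (C k.+1))
  (cont_diffM (cont_diff_cst N (v k) x) (C k.+2))) (Hf a))).
near=> y.
have If_y : I (f y) by near: y.
have df_y : differentiable f y by near: y.
by rewrite (derive_comp1 _ (Hh k _ If_y)).
Unshelve. all: by end_near. Qed.

Lemma smooth_germ_eq f g x : (\forall y \near x, f y = g y) ->
  smooth_germ f x -> smooth_germ g x.
Proof.
rewrite /smooth_germ => /near_nbhs fg Cf; near=> y => N.
by apply: (@cont_diff_eq N f); [|move: N]; near: y.
Unshelve. all: by end_near. Qed.

Lemma smooth_germ_near f x : smooth_germ f x -> \forall y \near x, smooth_germ f y.
Proof. by move=> /near_join. Qed.

Lemma smooth_germ_diff f x : smooth_germ f x -> differentiable f x.
Proof. by move=> /nbhs_singleton /(_ 0%N) [/nbhs_singleton]. Qed.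

Lemma smooth_germ_pd f x a : smooth_germ f x -> smooth_germ (pd a f) x.
Proof. by apply: filterS => y H N; have [_] := H N.+1; exact. Qed.

Lemma smooth_germD f g x : smooth_germ f x -> smooth_germ g x ->
  smooth_germ (fun y => f y + g y) x.
Proof. by apply: filterS2 => y Hf Hg N; exact: cont_diffD. Qed.

Lemma smooth_germM f g x : smooth_germ f x -> smooth_germ g x ->
  smooth_germ (fun y => f y * g y) x.
Proof. by apply: filterS2 => y Hf Hg N; exact: cont_diffM. Qed.

Lemma smooth_germ_cst c x : smooth_germ (fun=> c) x.
Proof. by near=> y => N; exact: cont_diff_cst.
Unshelve. all: by end_near. Qed.

Lemma smooth_germN f x : smooth_germ f x -> smooth_germ (fun y => - f y) x.
Proof.
move=> Cf; have := smooth_germM (smooth_germ_cst (-1) x) Cf.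
by apply: smooth_germ_eq; near=> y; rewrite mulN1r.
Unshelve. all: by end_near. Qed.

Lemma smooth_germB f g x : smooth_germ f x -> smooth_germ g x ->
  smooth_germ (fun y => f y - g y) x.
Proof. by move=> Cf Cg; apply: smooth_germD => //; exact: smooth_germN. Qed.

Lemma smooth_germ_sum (I : finType) (P : pred I) (F : I -> 'rV[R]_n -> R) x :
  (forall i, P i -> smooth_germ (F i) x) ->
  smooth_germ (fun y => \sum_(i | P i) F i y) x.
Proof.
move=> H.
rewrite (_ : (fun y => _) = \sum_(i | P i) F i); last first.
  by apply/funext => y; rewrite fct_sumE.
elim/big_rec: _ => [|i f Pi Cf]; first exact: smooth_germ_cst.
by apply: smooth_germD => //; apply: H.
Qed.

Lemma smooth_germ_coord a x : smooth_germ (fun y => y 0 a) x.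
Proof. by near=> y => N; exact: cont_diff_coord.
Unshelve. all: by end_near. Qed.

Lemma smooth_germ_comp1 k (I : set R) (h : nat -> R -> R) (u v : nat -> R) f x :
  (forall k, forall t, I t ->
     is_derive t 1 (h k) (u k * h k.+1 t + v k * h k.+2 t)) ->
  (\forall y \near x, I (f y)) ->
  smooth_germ f x -> smooth_germ (fun y => h k (f y)) x.
Proof.
rewrite /smooth_germ => Hh /near_nbhs If Cf.
by near=> y => N; apply: (@cont_diff_comp1 N k I h u v f y Hh); [|move: N]; near: y.
Unshelve. all: by end_near. Qed.

Lemma smooth_germ_cvg f x : smooth_germ f x -> {for x, continuous f}.
Proof. by move=> /smooth_germ_diff; exact: differentiable_continuous. Qed.

End Partial.

Notation pd a f := (fun y => 'D_(basis_vec a) f y).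

Section Composition.
Context {R : realType} {n m : nat}.

Lemma cont_diff_comp N (f : 'rV[R]_m -> R) (phi : 'rV[R]_n -> 'rV[R]_m) x :
  {for x, continuous phi} ->
  cont_diff N f (phi x) -> (forall b, cont_diff N (fun y => phi y 0 b) x) ->
  cont_diff N (fun y => f (phi y)) x.
Proof.
move=> cphi.
have dphi M : (forall b, cont_diff M (fun y => phi y 0 b) x) ->
    \forall y \near x, differentiable phi y.
  move=> H; have : \forall y \near x, forall b, differentiable (fun y => phi y 0 b) y.
    by apply: near_forall => b; exact: (cont_diff_near (H b)).
  by apply: filterS => y; exact: differentiable_rV.
have dcomp M g : cont_diff M g (phi x) ->
    (forall b, cont_diff M (fun y => phi y 0 b) x) ->
    \forall y \near x, differentiable (fun y => g (phi y)) y.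
  move=> /cont_diff_near/cphi/= Hg Hphi; near=> y.
  by apply: (@differentiable_comp _ _ _ _ phi g); near: y => //; exact: dphi Hphi.
elim: N f => [|N IH] f Cf Cphi; split=> //; first exact: (dcomp 0%N f).
  exact: (dcomp N.+1 f).
move=> a; have [df Hf] := Cf.
apply: (@cont_diff_eq _ _ _ (fun y => \sum_b
   'D_(basis_vec b) f (phi y) * 'D_(basis_vec a) (fun y => phi y 0 b) y)).
  near=> y; rewrite -chain_rule //; near: y; first exact: dphi Cphi.
  exact: (cphi [set z | differentiable f z] df).
apply: cont_diff_sum => b _; apply: cont_diffM.
  by apply: IH (Hf b) _ => c; apply: cont_diffW.
by have [_] := Cphi b; exact.
Unshelve. all: by end_near. Qed.

Lemma smooth_germ_comp (f : 'rV[R]_m -> R) (phi : 'rV[R]_n -> 'rV[R]_m) x :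
  smooth_germ f (phi x) -> (forall b, smooth_germ (fun y => phi y 0 b) x) ->
  smooth_germ (fun y => f (phi y)) x.
Proof.
rewrite {2}/smooth_germ => Cf Cphi.
have Cphi' : \forall y \near x, forall b, smooth_germ (fun y => phi y 0 b) y.
  by apply: near_forall => b; exact: (near_nbhs (Cphi b)).
have cphi : \forall y \near x, {for y, continuous phi}.
  apply: filterS Cphi' => y H; apply: differentiable_continuous.
  by apply: differentiable_rV => b; exact: smooth_germ_diff.
have cphix := nbhs_singleton cphi.
have {}Cf : \forall y \near x, forall N, cont_diff N f (phi y) by exact: (cphix _ Cf).
near=> y => N; apply: cont_diff_comp; first by near: y.
  by move: N; near: y.
move=> b; move: N; suff : smooth_germ (fun y => phi y 0 b) y by move/nbhs_singleton.
by move: b; near: y.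
Unshelve. all: by end_near. Qed.

End Composition.

Section SmoothOnOpen.
Context {R : realType} {n : nat}.
Implicit Types (f : 'rV[R]_n -> R) (W : set 'rV[R]_n).

Lemma iter_partial_rcons s a f :
  iter_partial (rcons s a) f = iter_partial s (pd a f).
Proof. by elim: s => //= b s ->. Qed.

Lemma cont_diff_iter_partial (s : seq 'I_n) f x :
  cont_diff (size s) f x -> differentiable (iter_partial s f) x.
Proof.
elim/last_ind: s f => [|s a IH] f; first by case=> /nbhs_singleton.
by rewrite size_rcons iter_partial_rcons => -[_ /(_ a)]; exact: IH.
Qed.

(** The bridge through which the closure properties of germs apply to
    [smooth_eucl]. *)
Lemma smooth_euclP W f : open W ->
  smooth_eucl W f <-> forall x, W x -> smooth_germ f x.
Proof.
move=> oW; split=> [Sf x Wx|Sf s x Wx]; last first.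
  by apply: cont_diff_iter_partial; have /nbhs_singleton := Sf x Wx; exact.
have : \forall y \near x, W y by exact: open_nbhs_nbhs.
apply: filterS => {x Wx} x Wx N.
have nW : \forall y \near x, W y by exact: open_nbhs_nbhs.
elim: N f Sf => [|N IH] f Sf; split=> //; first by near=> y; apply: (Sf [::]); near: y.
  by near=> y; apply: (Sf [::]); near: y.
by move=> a; apply: IH => s y Wy; rewrite -iter_partial_rcons; exact: Sf.
Unshelve. all: by end_near. Qed.

End SmoothOnOpen.

Section Schwarz.
Context {R : realType} {n : nat}.
Implicit Types (f : 'rV[R]_n -> R).

Lemma is_derive_line {V W : normedModType R} (f : V -> W) (x v : V) (s : R) :
  differentiable f (x + s *: v) ->
  is_derive s 1 (fun r : R => f (x + r *: v)) ('D_v f (x + s *: v)).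
Proof.
move=> df.
have dl : is_diff s (fun r : R => x + r *: v) (0 + *:%R^~ v).
  exact: (is_diffD (is_diff_cst x s) (is_diff_scalel s v)).
have d2 := @is_diff_comp _ _ _ _ _ _ _ _ s dl (differentiableP df).
have dd : differentiable (fun r : R => f (x + r *: v)) s by case: d2.
apply: DeriveDef; first exact/derivable1_diffP.
by rewrite deriveE //; case: d2 => _ ->; rewrite /= fctE add0r scale1r -deriveE.
Qed.

Lemma mvt_line {V : normedModType R} (f : V -> R) (x v : V) (h : R) : 0 < h ->
  (forall s, 0 <= s <= h -> differentiable f (x + s *: v)) ->
  exists2 c, 0 <= c <= h & f (x + h *: v) - f x = h * 'D_v f (x + c *: v).
Proof.
move=> h0 df.
have [||c ch E] := @MVT R (fun r => f (x + r *: v))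
    (fun r => 'D_v f (x + r *: v)) 0 h h0.
- move=> s; rewrite in_itv /= => /andP[s0 sh]; apply: is_derive_line; apply: df.
  by rewrite !ltW.
- apply: derivable_within_continuous => s; rewrite in_itv /= => sh.
  by have [] := is_derive_line (df _ sh).
exists c; first by move: ch; rewrite in_itv /= => /andP[s0 sh]; rewrite !ltW.
by move: E; rewrite scale0r addr0 subr0 mulrC.
Qed.

(** The mean value theorem, applied along v to the increment g of f in the
    direction w, then along w to the derivative of f in the direction v. *)
Lemma second_difference {V : normedModType R} (f : V -> R) (x v w : V) (e h : R) :
  0 < h -> h * (`|v| + `|w|) < e ->
  (forall y, ball x e y -> differentiable f y) ->
  (forall y, ball x e y -> differentiable ('D_v f) y) ->
  exists2 y, ball x e y &
    f (x + h *: v + h *: w) - f (x + h *: v) - f (x + h *: w) + f x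
    = h ^+ 2 * 'D_w ('D_v f) y.
Proof.
move=> h0 he df ddf.
have inb s r : 0 <= s <= h -> 0 <= r <= h -> ball x e (x + s *: v + r *: w).
  move=> /andP[s0 sh] /andP[r0 rh]; rewrite -ball_normE /ball_ /=.
  have -> : x - (x + s *: v + r *: w) = - (s *: v) - r *: w by rewrite -addrA opprD addNKr opprD.
  rewrite (le_lt_trans _ he) // (le_trans (ler_normD _ _)) // !normrN !normrZ.
  by rewrite mulrDr lerD // ler_wpM2r // ger0_norm.
have h0h : 0 <= h <= h by rewrite lexx ltW.
have z0h : 0 <= (0 : R) <= h by rewrite lexx ltW.
pose g y := f (y + h *: w) - f y.
have shiftE u y : differentiable f (y + h *: w) ->
    differentiable (fun y => f (y + h *: w)) y /\
    'D_u (fun y => f (y + h *: w)) y = 'D_u f (y + h *: w).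
  move=> d.
  have ds : is_diff y (fun y => y + h *: w) (id + 0).
    exact: (is_diffD (is_diff_id y) (is_diff_cst _ _)).
  have [d1 E] := @is_diff_comp _ _ _ _ _ _ _ _ y ds (differentiableP d).
  split=> //; rewrite deriveE //; rewrite E /= fctE addr0.
  by rewrite -deriveE.
have dg s : 0 <= s <= h -> differentiable g (x + s *: v).
  move=> sh; apply: differentiableB; first by have [] := shiftE v _ (df _ (inb s h sh h0h)).
  by apply: df; have := inb s 0 sh z0h; rewrite scale0r addr0.
have [c ch E] := mvt_line h0 dg.
have Eg : 'D_v g (x + c *: v) = 'D_v f (x + c *: v + h *: w) - 'D_v f (x + c *: v).
  have dfc : differentiable f (x + c *: v).
    by apply: df; have := inb c 0 ch z0h; rewrite scale0r addr0.
  have [d1 E1] := shiftE v _ (df _ (inb c h ch h0h)).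
  by rewrite -E1 -deriveB //; exact: diff_derivable.
have [r rh E2] := @mvt_line _ ('D_v f) (x + c *: v) w h h0
   (fun s sh => ddf _ (inb c s ch sh)).
exists (x + c *: v + r *: w); first exact: inb.
rewrite expr2 -mulrA -E2 -Eg -E /g; ring.
Qed.

Lemma close_limits (p q p2 q1 A e k : R) : k != 0 -> `|q - q1| < e ->
  `|p - p2| < e -> A = k * q1 -> A = k * p2 -> `|p - q| <= e + e.
Proof.
move=> k0 B1 B2 -> /(mulfI k0) E; have -> : p - q = (p - p2) - (q - q1) by rewrite E; ring.
by rewrite (le_trans (ler_normB _ _)) // lerD // ltW.
Qed.

(** Both mixed partials are limits of the same second difference quotient. *)
Lemma schwarz f x a b : smooth_germ f x -> pd a (pd b f) x = pd b (pd a f) x.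
Proof.
move=> Sf; set v := basis_vec a; set w := basis_vec b.
have Sf' := smooth_germ_near Sf.
have S1 c := smooth_germ_near (smooth_germ_pd c Sf).
have S2 c c' := smooth_germ_near (smooth_germ_pd c (smooth_germ_pd c' Sf)).
apply/eqP; rewrite -subr_eq0 -normr_le0; apply/ler_addgt0Pr => e' e'0; rewrite add0r.
have [e e0 ->] : exists2 e, 0 < e & e' = e + e.
  by exists (e' / 2); [rewrite divr_gt0|rewrite -splitr].
have cl c c' : \forall y \near x, `|pd c (pd c' f) x - pd c (pd c' f) y| < e.
  have := smooth_germ_cvg (nbhs_singleton (S2 c c')).
  by move=> /cvgr_dist_lt; exact.
have : \forall y \near x, [/\ differentiable f y, differentiable ('D_v f) y,
   differentiable ('D_w f) y, `|'D_v ('D_w f) x - 'D_v ('D_w f) y| < e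
   & `|'D_w ('D_v f) x - 'D_w ('D_v f) y| < e].
  have c1 : \forall y \near x, `|'D_v ('D_w f) x - 'D_v ('D_w f) y| < e := cl a b.
  have c2 : \forall y \near x, `|'D_w ('D_v f) x - 'D_w ('D_v f) y| < e := cl b a.
  have Sv : \forall y \near x, differentiable ('D_v f) y.
    by apply: filterS (S1 a) => y; exact: smooth_germ_diff.
  have Sw : \forall y \near x, differentiable ('D_w f) y.
    by apply: filterS (S1 b) => y; exact: smooth_germ_diff.
  have Sf0 : \forall y \near x, differentiable f y.
    by apply: filterS Sf' => y; exact: smooth_germ_diff.
  have F3 := near_and (near_and c1 c2) (near_and Sv Sw).
  apply: filterS (near_and Sf0 F3) => y [H1 [[H4 H5] [H2 H3]]]; exact: And5 H1 H2 H3 H4 H5.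
move=> /nbhs_ballP [d d0 H].
pose h := d / 2 / (1 + `|v| + `|w|).
have p0 : 0 < 1 + `|v| + `|w| by rewrite -addrA ltr_wpDr // addr_ge0.
have h0 : 0 < h by rewrite !divr_gt0.
have hd : h * (`|v| + `|w|) < d.
  rewrite /h mulrAC -mulrA; apply: (@le_lt_trans _ _ (d / 2)).
    rewrite -[leRHS]mulr1 ler_wpM2l //; first by rewrite divr_ge0 // ltW.
    by rewrite ler_pdivrMr // mul1r -addrA lerDr.
  by rewrite ltr_pdivrMr // ltr_pMr // ltr1n.
have hd' : h * (`|w| + `|v|) < d by rewrite [_ + `|v|]addrC.
have [y1 b1 E1] := second_difference h0 hd (fun y b => (let: And5 a _ _ _ _ := H y b in a))
  (fun y b => (let: And5 _ a _ _ _ := H y b in a)).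
have [y2 b2 E2] := second_difference h0 hd' (fun y b => (let: And5 a _ _ _ _ := H y b in a))
  (fun y b => (let: And5 _ _ a _ _ := H y b in a)).
have [_ _ _ _ B1] := H _ b1; have [_ _ _ B2 _] := H _ b2.
move: E2; rewrite [x + h *: w + h *: v]addrAC [_ - f (x + h *: w) - _]addrAC.
by apply: close_limits B1 B2 E1; rewrite expf_neq0 // gt_eqF.
Qed.

End Schwarz.

Section OneVariable.
Context {R : realType}.

Lemma is_derive_comp1 (h f : R -> R) (x dh df : R) :
  is_derive (f x) 1 h dh -> is_derive x 1 f df ->
  is_derive x 1 (fun y => h (f y)) (dh * df).
Proof.
move=> Hh [df1 dfE].
have d : differentiable f x by apply/derivable1_diffP.
have dh1 : differentiable h (f x) by apply/derivable1_diffP; case: Hh.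
apply: DeriveDef; last by rewrite (@derive_comp1 _ R h f x 1 dh Hh d) dfE.
by apply/derivable1_diffP; exact: (@differentiable_comp _ _ _ _ f h).
Qed.

(** The functions t^(-m) exp(-1/t), extended by 0 to the nonpositive numbers:
    their span is closed under differentiation. *)
Definition flat (m : nat) (t : R) : R :=
  if 0 < t then t `^ (- m%:R) * expR (- t `^ (-1)) else 0.

(** Since exp u >= u, exp (1/t) >= ((m+1) t)^-(m+1).  The point is that all the
    functions [flat m] are differentiable at 0. *)
Lemma flat_bound m t : `|flat m t| <= m.+1%:R ^+ m.+1 * `|t|.
Proof.
rewrite /flat; case: ifPn => [t0|]; last by rewrite normr0 mulr_ge0 ?exprn_ge0.
rewrite ger0_norm ?mulr_ge0 ?expR_ge0 ?powR_ge0 // (ger0_norm (ltW t0)).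
rewrite (powR_inv1 (ltW t0)) (powR_invn _ (ltW t0)).
have s0 : 0 < m.+1%:R * t by rewrite mulr_gt0.
have : (m.+1%:R * t) ^- m.+1 <= expR (t^-1).
  have -> : t^-1 = m.+1%:R * (m.+1%:R * t)^-1.
    by rewrite invfM mulrA mulfV ?mul1r ?pnatr_eq0.
  rewrite expRM_natl -exprVn lerXn2r ?nnegrE ?expR_ge0 ?invr_ge0 ?ltW //.
  by rewrite (lt_le_trans _ (expR_ge1Dx _)) // ltrDr.
rewrite expRN -lef_pV2 ?posrE ?expR_gt0 ?invr_gt0 ?exprn_gt0 // invrK => H.
have : t ^- m * (expR t^-1)^-1 <= t ^- m * (m.+1%:R * t) ^+ m.+1.
  by rewrite ler_wpM2l // invr_ge0 exprn_ge0 // ltW.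
move=> /le_trans; apply; rewrite exprMn [t ^+ m.+1]exprS mulrCA.
by rewrite ler_wpM2l ?exprn_ge0 // mulrCA mulVf ?mulr1 // expf_neq0 // gt_eqF.
Qed.

Lemma is_derive_flat m (t : R) :
  is_derive t 1 (flat m) (- m%:R * flat m.+1 t + 1 * flat m.+2 t).
Proof.
have [t0|t0|->] := ltgtP t 0.
- apply: (@near_eq_is_derive _ _ _ (cst 0)).
    near=> s; rewrite /flat ifF //; apply/negbTE; rewrite -leNgt ltW //; near: s.
    exact: lt_nbhsl.
  by rewrite /flat !ltNge (ltW t0) /= !mulr0 addr0; exact: is_derive_cst.
- apply: (@near_eq_is_derive R R R
    (fun s : R => s `^ (- m%:R) * expR (- s `^ (-1))) (flat m) t 1).
    by near=> s; rewrite /flat ifT //; near: s; exact: lt_nbhsr.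
  have d1 := @is_derive1_powR R (- m%:R) t t0.
  have d2 := is_deriveN (@is_derive1_powR R (-1) t t0).
  have d3 := @is_derive_comp1 expR (fun s => - s `^ (-1)) t _ _ (is_derive_expR _) d2.
  apply: (is_derive_eq (is_deriveM d1 d3)).
  have P r s : t `^ (r + s) = t `^ r * t `^ s by rewrite powRD // (gt_eqF t0) implybT.
  rewrite /flat t0 /GRing.scale /=.
  have -> : t `^ (- m.+1%:R) = t `^ (- m%:R) * t `^ (-1) by rewrite -P -natr1 opprD.
  have -> : t `^ (- m.+2%:R) = t `^ (- m%:R) * (t `^ (-1) * t `^ (-1)).
    by rewrite -!P -!natr1 !opprD addrA.
  rewrite !P /=; ring.
rewrite {2 3}/flat ltxx !mulr0 addr0.
have L : (fun h => h^-1 *: ((flat m \o shift 0) (h *: 1) - flat m 0)) @ 0^' --> (0 : R).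
  apply/cvgrPdist_le => e e0.
  have C0 : 0 < m.+2%:R ^+ m.+2 + 1 :> R by rewrite ltr_wpDl // exprn_ge0.
  have : \forall h \near (0 : R)^', `|h| < e / (m.+2%:R ^+ m.+2 + 1).
    by apply: dnbhs0_lt; rewrite divr_gt0.
  apply: filterS => h; rewrite ltr_pdivlMr // => he.
  have -> : h^-1 *: ((flat m \o shift 0) (h *: 1) - flat m 0) = flat m.+1 h.
    rewrite /= addr0 {2}/flat ltxx subr0 /flat /GRing.scale /= mulr1.
    case: ifPn => h0; last by rewrite mulr0.
    by rewrite mulrA !powR_invn ?ltW // exprS invfM.
  rewrite sub0r normrN (le_trans (flat_bound _ _)) // (le_trans _ (ltW he)) //.
  by rewrite mulrC ler_wpM2l // lerDl.
apply: DeriveDef; first by apply/cvg_ex; exists 0.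
exact: cvg_lim L.
Unshelve. all: by end_near. Qed.

End OneVariable.

Section Bump.
Context {R : realType} {n : nat}.

Lemma smooth_germ_flat (f : 'rV[R]_n -> R) x : smooth_germ f x ->
  smooth_germ (fun y => flat 0 (f y)) x.
Proof.
apply: (@smooth_germ_comp1 _ _ 0%N setT flat (fun m => - m%:R) (fun=> 1)).
  by move=> k t _; exact: is_derive_flat.
by near=> y.
Unshelve. all: by end_near. Qed.

Lemma smooth_germ_powR (f : 'rV[R]_n -> R) (a : R) x : 0 < f x -> smooth_germ f x ->
  smooth_germ (fun y => f y `^ a) x.
Proof.
move=> f0 Sf.
have := @smooth_germ_comp1 _ _ 0%N [set t : R | 0 < t] (fun m t => t `^ (a - m%:R))
  (fun m => a - m%:R) (fun=> 0) f x.
rewrite subr0; apply=> //.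
  move=> k t t0; apply: (is_derive_eq (is_derive1_powR (a - k%:R) t0)).
  by rewrite mul0r addr0 -addrA -opprD natr1.
have := smooth_germ_cvg Sf; apply; exact: lt_nbhsr.
Qed.

(** The inverse is f * (f^2)^(-1), which reduces it to powers of a positive
    function. *)
Lemma smooth_germV (f : 'rV[R]_n -> R) x : f x != 0 -> smooth_germ f x ->
  smooth_germ (fun y => (f y)^-1) x.
Proof.
move=> f0 Sf.
have f2 : 0 < f x ^+ 2 by rewrite exprn_even_gt0.
have Sf2 : smooth_germ (fun y => f y ^+ 2) x by exact: smooth_germM.
have : smooth_germ (fun y => f y * (f y ^+ 2) `^ (-1)) x.
  by apply: smooth_germM => //; exact: smooth_germ_powR.
apply: smooth_germ_eq; near=> y; rewrite powR_inv1 ?sqr_ge0 // expr2 invfM mulrA.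
rewrite mulfV ?mul1r //; near: y.
have O := open_nbhs_nbhs (conj (@open_neq R 0) f0); exact: (smooth_germ_cvg Sf O).
Unshelve. all: by end_near. Qed.

(** Multiplied by an affine function, this bump yields compactly supported
    functions with any prescribed differential at the centre. *)
Definition bump_ball (y0 : 'rV[R]_n) (r : R) (y : 'rV[R]_n) : R :=
  flat 0 (r ^+ 2 - \sum_a (y 0 a - y0 0 a) ^+ 2).

Lemma smooth_bump_ball y0 r x : smooth_germ (bump_ball y0 r) x.
Proof.
apply: smooth_germ_flat; apply: smooth_germB; first exact: smooth_germ_cst.
apply: smooth_germ_sum => a _.
have S : smooth_germ (fun y : 'rV[R]_n => y 0 a - y0 0 a) x.
  apply: smooth_germB; [exact: smooth_germ_coord|exact: smooth_germ_cst].
exact: smooth_germM.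
Qed.

Lemma bump_ball_center y0 r : 0 < r -> 0 < bump_ball y0 r y0.
Proof.
move=> r0; rewrite /bump_ball /flat big1 => [|a _]; last by rewrite subrr expr0n.
by rewrite subr0 exprn_gt0 // mulr_gt0 ?powR_gt0 ?exprn_gt0 ?expR_gt0.
Qed.

(** The norm is the sup norm, which is at most the Euclidean norm by which the
    bump is defined. *)
Lemma bump_ball_support y0 r y : 0 < r -> r <= `|y - y0| -> bump_ball y0 r y = 0.
Proof.
move=> r0 H; rewrite /bump_ball /flat ifF //; apply/negbTE; rewrite -leNgt subr_le0.
have [a ra] : exists a, r <= `|y 0 a - y0 0 a|.
  apply: contrapT => /forallNP N; move: H; apply/negP; rewrite -ltNge.
  rewrite [ltLHS]/Num.Def.normr /= mx_normrE (bigmax_lt _ r0) // => -[i a] _ /=.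
  rewrite (ord1 i) !mxE ltNge; apply/negP; exact: N.
rewrite (bigD1 a) //= -[leLHS]addr0 lerD //; last by rewrite sumr_ge0 // => b _; rewrite sqr_ge0.
by rewrite -[leRHS]real_normK ?num_real // lerXn2r ?nnegrE // ltW.
Qed.

End Bump.

(** * Functions and vector fields on a manifold *)

Section Charts.
Context {R : realType} {n : nat} {M : smooth_manifold R n}.
Implicit Types (c : chart R n M) (p q : M) (f g : M -> R).

Lemma near_cinv c p (P : set M) : cdom c p -> (\forall q \near p, P q) ->
  \forall y \near cmap c p, P (cinv c y).
Proof.
move=> cp HP; have := cinv_cont (cmap_rng cp).
by rewrite /prop_for /continuous_at cmapK //; apply.
Qed.

Lemma near_cmap c p (Q : set 'rV[R]_n) : cdom c p ->
  (\forall y \near cmap c p, Q y) -> \forall q \near p, Q (cmap c q).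
Proof. by move=> cp HQ; exact: (cmap_cont cp HQ). Qed.

Lemma near_cdom c p : cdom c p -> \forall q \near p, cdom c q.
Proof. by move=> cp; apply: open_nbhs_nbhs; split=> //; exact: cdom_open. Qed.

Lemma near_crng c p : cdom c p -> \forall y \near cmap c p, crng c y.
Proof.
move=> cp; apply: open_nbhs_nbhs; split; first exact: crng_open.
exact: cmap_rng.
Qed.

(** Closedness in M, and not only in the chart, is where M being Hausdorff
    enters. *)
Lemma closed_chart_ball c (y0 : 'rV[R]_n) (r : R) : 0 < r ->
  (forall y, `|y - y0| <= r -> crng c y) ->
  closed (cinv c @` [set y | `|y - y0| <= r]).
Proof.
move=> r0 rc; apply: (compact_closed (@manifold_hausdorff _ _ M)).
apply: continuous_compact.
  by apply: continuous_in_subspaceT => y; rewrite inE => /rc; exact: cinv_cont.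
have E : [set y | `|y - y0| <= r] = closed_ball y0 r.
  by rewrite closed_ballE //; apply/seteqP; split=> y /=; rewrite /closed_ball_ /= distrC.
apply: bounded_closed_compact; last by rewrite E; exact: closed_ball_closed.
exists (`|y0| + r); split=> [|N HN y /= yr]; first exact: num_real.
rewrite (le_trans _ (ltW HN)) // -(subrK y0 y) addrC (le_trans (ler_normD _ _)) //.
by rewrite lerD2l.
Qed.

Lemma open_chart_image c (U : set M) : open U -> open (cmap c @` (U `&` cdom c)).
Proof.
move=> oU; rewrite openE => _ [q [Uq cq] <-].
have nU : \forall q' \near q, U q' by exact: open_nbhs_nbhs.
apply: filterS (near_and (near_cinv cq nU) (near_crng cq)) => y [Uy cy].
exists (cinv c y); last exact: cinvK.
by split=> //; exact: cinv_dom.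
Qed.

Lemma smooth_transition c c' p a : atlas c -> atlas c' -> cdom c p -> cdom c' p ->
  smooth_germ (fun y => cmap c' (cinv c y) 0 a) (cmap c p).
Proof.
move=> ac ac' cp cp'.
have /smooth_euclP H := transition_smooth ac ac' a.
apply: H; last by exists p.
rewrite setIC; apply: open_chart_image; exact: cdom_open.
Qed.

Lemma change_chart c c' p f : atlas c -> atlas c' -> cdom c p -> cdom c' p ->
  smooth_germ (f \o cinv c) (cmap c p) -> smooth_germ (f \o cinv c') (cmap c' p).
Proof.
move=> ac ac' cp cp' Sf.
have S : smooth_germ (fun y => (f \o cinv c) (cmap c (cinv c' y))) (cmap c' p).
  apply: smooth_germ_comp; first by rewrite cmapK.
  by move=> b; exact: smooth_transition.
apply: smooth_germ_eq S; apply: filterS (near_cinv cp' (near_cdom cp)) => y cy /=.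
by rewrite cmapK.
Qed.

Definition smooth_at f p : Prop :=
  smooth_germ (f \o cinv (chart_at p)) (cmap (chart_at p) p).

Lemma smooth_atP c p f : atlas c -> cdom c p ->
  smooth_at f p <-> smooth_germ (f \o cinv c) (cmap c p).
Proof.
move=> ac cp; have aq := chart_at_atlas p; have dq := chart_at_dom p.
by split; apply: change_chart.
Qed.

Lemma smooth_at_near f p : smooth_at f p -> \forall q \near p, smooth_at f q.
Proof.
have aq := chart_at_atlas p; have dq := chart_at_dom p.
move=> /smooth_germ_near /(near_cmap dq) H.
by apply: filterS (near_and H (near_cdom dq)) => q [Sq cq]; exact: (smooth_atP f aq cq).2 Sq.
Qed.

Lemma smooth_funP (U : set M) f : open U ->
  smooth_fun U f <-> forall p, U p -> smooth_at f p.
Proof.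
move=> oU; split=> [Sf p Up|Sf c ac].
  have /smooth_euclP H := Sf _ (chart_at_atlas p); apply: H.
    exact: open_chart_image.
  by exists p => //; split=> //; exact: chart_at_dom.
apply/smooth_euclP; first exact: open_chart_image.
by move=> _ [q [Uq cq] <-]; apply/smooth_atP => //; exact: Sf.
Qed.

Lemma smooth_at_eq f g p : (\forall q \near p, f q = g q) ->
  smooth_at f p -> smooth_at g p.
Proof.
by move=> fg; apply: smooth_germ_eq; exact: (near_cinv (chart_at_dom p) fg).
Qed.

Lemma smooth_atD f g p : smooth_at f p -> smooth_at g p ->
  smooth_at (fun q => f q + g q) p.
Proof. exact: smooth_germD. Qed.

Lemma smooth_atM f g p : smooth_at f p -> smooth_at g p ->
  smooth_at (fun q => f q * g q) p.
Proof. exact: smooth_germM. Qed.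

Lemma smooth_atB f g p : smooth_at f p -> smooth_at g p ->
  smooth_at (fun q => f q - g q) p.
Proof. exact: smooth_germB. Qed.

Lemma smooth_at_cst (r : R) p : smooth_at (fun=> r) p.
Proof. exact: smooth_germ_cst. Qed.

Lemma smooth_at_sum (I : finType) (P : pred I) (F : I -> M -> R) p :
  (forall i, P i -> smooth_at (F i) p) -> smooth_at (fun q => \sum_(i | P i) F i q) p.
Proof. by move=> H; apply: smooth_germ_sum => i Pi; exact: H. Qed.

Lemma smooth_atV f p : f p != 0 -> smooth_at f p -> smooth_at (fun q => (f q)^-1) p.
Proof. by move=> f0; apply: smooth_germV; rewrite /= cmapK //; exact: chart_at_dom. Qed.

Lemma smooth_at_powR f (a : R) p : 0 < f p -> smooth_at f p ->
  smooth_at (fun q => f q `^ a) p.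
Proof. by move=> f0; apply: smooth_germ_powR; rewrite /= cmapK //; exact: chart_at_dom. Qed.

Lemma smooth_at_cvg f p : smooth_at f p -> {for p, continuous f}.
Proof.
have dq := chart_at_dom p.
move=> /smooth_germ_cvg cf; rewrite /prop_for /continuous_at.
have E : \forall q \near p, f (cinv (chart_at p) (cmap (chart_at p) q)) = f q.
  by apply: filterS (near_cdom dq) => q cq; rewrite cmapK.
have H : f (cinv (chart_at p) (cmap (chart_at p) q)) @[q --> p] --> f p.
  rewrite -[X in _ --> f X](cmapK dq).
  exact: (@continuous_comp _ _ _ (cmap (chart_at p)) _ p (cmap_cont dq) cf).
exact: cvg_trans (near_eq_cvg E) H.
Qed.

Lemma smooth_at_pull c p (h : 'rV[R]_n -> R) : atlas c -> cdom c p ->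
  smooth_germ h (cmap c p) -> smooth_at (fun q => h (cmap c q)) p.
Proof.
move=> ac cp Sh; apply/(smooth_atP _ ac cp).
by apply: smooth_germ_eq Sh; apply: filterS (near_crng cp) => y cy /=; rewrite cinvK.
Qed.

Lemma smooth_at_coord c p a : atlas c -> cdom c p -> smooth_at (chart_coord c a) p.
Proof. by move=> ac cp; exact: (@smooth_at_pull c p (fun y => y 0 a) ac cp (smooth_germ_coord a _)). Qed.

Lemma diff_transition c c' p : atlas c -> atlas c' -> cdom c p -> cdom c' p ->
  differentiable (fun y => cmap c' (cinv c y)) (cmap c p).
Proof.
move=> ac ac' cp cp'; apply: differentiable_rV => b.
by apply: smooth_germ_diff; exact: smooth_transition.
Qed.

(** The chain rule, in a form that frees the calculus from the chart in which
    the tangent space is read. *)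
Lemma dact_chart c p v f : atlas c -> cdom c p -> smooth_at f p ->
  dact p v f = \sum_b dact p v (chart_coord c b) * pd b (f \o cinv c) (cmap c p).
Proof.
move=> ac cp Sf; have aq := chart_at_atlas p; have dq := chart_at_dom p.
have Sc : smooth_germ (f \o cinv c) (cmap c p) by exact/smooth_atP.
have := @chain_rule _ _ _ (f \o cinv c) (fun y => cmap c (cinv (chart_at p) y))
  (cmap (chart_at p) p) v.
rewrite cmapK // => H; under eq_bigr do rewrite mulrC; rewrite /dact.
rewrite -H; last 2 first.
- exact: diff_transition.
- exact: smooth_germ_diff.
apply: near_eq_derive; apply: filterS (near_cinv dq (near_cdom cp)) => y cy /=.
by rewrite cmapK.
Qed.

Lemma dact_eq p v f g : (\forall q \near p, f q = g q) -> dact p v f = dact p v g.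
Proof. by move=> fg; apply: near_eq_derive; exact: (near_cinv (chart_at_dom p) fg). Qed.

Lemma dact_cst p v (r : R) : dact p v (fun=> r) = 0.
Proof. exact: derive_cst. Qed.

Section Derivation.
Variables (p : M) (v : 'rV[R]_n).

Let drv f : smooth_at f p -> derivable (f \o cinv (chart_at p)) (cmap (chart_at p) p) v.
Proof. by move=> /smooth_germ_diff; exact: diff_derivable. Qed.

Lemma dactD f g : smooth_at f p -> smooth_at g p ->
  dact p v (fun q => f q + g q) = dact p v f + dact p v g.
Proof. by move=> Sf Sg; rewrite /dact -deriveD //; exact: drv. Qed.

Lemma dactB f g : smooth_at f p -> smooth_at g p ->
  dact p v (fun q => f q - g q) = dact p v f - dact p v g.
Proof. by move=> Sf Sg; rewrite /dact -deriveB //; exact: drv. Qed.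

Lemma dactM f g : smooth_at f p -> smooth_at g p ->
  dact p v (fun q => f q * g q) = f p * dact p v g + g p * dact p v f.
Proof.
move=> Sf Sg; rewrite /dact.
rewrite [LHS](@deriveM _ _ (f \o cinv (chart_at p)) (g \o cinv (chart_at p)));
  [|exact: drv..].
by rewrite /= cmapK //; exact: chart_at_dom.
Qed.

Lemma dact_sum (I : finType) (P : pred I) (F : I -> M -> R) :
  (forall i, P i -> smooth_at (F i) p) ->
  dact p v (fun q => \sum_(i | P i) F i q) = \sum_(i | P i) dact p v (F i).
Proof.
move=> H.
have {H} H : forall s : seq I, smooth_at (fun q => \sum_(i <- s | P i) F i q) p /\
    dact p v (fun q => \sum_(i <- s | P i) F i q) = \sum_(i <- s | P i) dact p v (F i).
  elim=> [|i s [IH1 IH2]].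
    have E : (fun q : M => \sum_(i <- [::] | P i) F i q) = (fun=> 0).
      by apply/funext => q; rewrite big_nil.
    by rewrite E big_nil dact_cst; split=> //; exact: smooth_at_cst.
  rewrite big_cons; case: ifPn => Pi.
    have E : (fun q : M => \sum_(j <- i :: s | P j) F j q) =
             (fun q => F i q + \sum_(j <- s | P j) F j q).
      by apply/funext => q; rewrite big_cons Pi.
    rewrite E dactD ?IH2 //; last exact: H.
    by split=> //; apply: smooth_atD => //; exact: H.
  have E : (fun q : M => \sum_(j <- i :: s | P j) F j q) =
           (fun q => \sum_(j <- s | P j) F j q).
    by apply/funext => q; rewrite big_cons (negbTE Pi).
  by rewrite E.
by have [] := H (index_enum I).
Qed.

End Derivation.

Lemma dactE p v f : smooth_at f p -> dact p v f = pairing (differential f p) v.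
Proof.
move=> /smooth_germ_diff df; rewrite /dact derive_partials // /pairing.
by apply: eq_bigr => a _; rewrite mxE mulrC.
Qed.

Lemma pairingZ (l : 'cV[R]_n) (a : R) u v :
  pairing l (a *: u + v) = a * pairing l u + pairing l v.
Proof.
rewrite /pairing mulr_sumr -big_split; apply: eq_bigr => i _ /=.
by rewrite !mxE; ring.
Qed.

Lemma pairing0 (l : 'cV[R]_n) : pairing l 0 = 0.
Proof. by have := pairingZ l (-1) 0 0; rewrite scaler0 addr0 mulN1r addNr. Qed.

Lemma tangent_coord p (v : 'rV[R]_n) a :
  v 0 a = dact p v (chart_coord (chart_at p) a).
Proof.
rewrite /dact.
have -> : 'D_v (chart_coord (chart_at p) a \o cinv (chart_at p))
    (cmap (chart_at p) p) = 'D_v (fun y : 'rV[R]_n => y 0 a) (cmap (chart_at p) p).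
  apply: near_eq_derive; apply: filterS (near_crng (chart_at_dom p)) => y cy.
  by rewrite /= /chart_coord cinvK.
by rewrite -(@derive_rV _ _ _ id) ?derive_id.
Qed.

Lemma tangent_ext p (u v : 'rV[R]_n) :
  (forall f, smooth_at f p -> dact p u f = dact p v f) -> u = v.
Proof.
move=> H; apply/rowP => a; rewrite !(tangent_coord p); apply: H.
by apply: smooth_at_coord; [exact: chart_at_atlas|exact: chart_at_dom].
Qed.

End Charts.

Section VectorFields.
Context {R : realType} {n : nat} {M : smooth_manifold R n}.
Implicit Types (c : chart R n M) (p q : M) (f g : M -> R) (X Y Z : vfield M).

(** Only the coordinates of one chart are tested; by [smooth_vact] this is
    enough. *)
Definition smooth_vat X p : Prop :=
  forall a, smooth_at (vact X (chart_coord (chart_at p) a)) p.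

Lemma smooth_vact_chart c X p f : atlas c -> cdom c p ->
  (forall a, smooth_at (vact X (chart_coord c a)) p) -> smooth_at f p ->
  smooth_at (vact X f) p.
Proof.
move=> ac cp SX Sf.
have S : smooth_at (fun q => \sum_b vact X (chart_coord c b) q *
    pd b (f \o cinv c) (cmap c q)) p.
  apply: smooth_at_sum => b _; apply: smooth_atM => //.
  apply: (@smooth_at_pull _ _ _ c p (pd b (f \o cinv c))) => //.
  by apply: smooth_germ_pd; exact/smooth_atP.
apply: smooth_at_eq S; apply: filterS (near_and (near_cdom cp) (smooth_at_near Sf)).
by move=> q [cq Sq]; rewrite /vact (dact_chart _ ac cq).
Qed.

Lemma smooth_vact X p f : smooth_vat X p -> smooth_at f p -> smooth_at (vact X f) p.
Proof.
move=> SX; apply: (@smooth_vact_chart (chart_at p)) => //.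
  exact: chart_at_atlas.
exact: chart_at_dom.
Qed.

Lemma smooth_vat_near X p : smooth_vat X p -> \forall q \near p, smooth_vat X q.
Proof.
move=> SX; have aq := chart_at_atlas p; have dq := chart_at_dom p.
have H : \forall q \near p, forall a, smooth_at (vact X (chart_coord (chart_at p) a)) q.
  by apply: near_forall => a; exact: (smooth_at_near (SX a)).
apply: filterS (near_and H (near_cdom dq)) => q [Sq cq] a.
apply: (smooth_vact_chart aq cq Sq); apply: smooth_at_coord.
  exact: chart_at_atlas.
exact: chart_at_dom.
Qed.

Lemma smooth_vfieldP (U : set M) X : open U ->
  smooth_vfield U X <-> forall p, U p -> smooth_vat X p.
Proof.
move=> oU; split=> [SX p Up a|SX V f oV VU Sf].
  have aq := chart_at_atlas p; have dq := chart_at_dom p.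
  pose V := U `&` cdom (chart_at p).
  have oV : open V by apply: openI => //; exact: cdom_open.
  have Vp : V p by split.
  suff /(SX V _ oV) H : smooth_fun V (chart_coord (chart_at p) a).
    by have /(smooth_funP _ oV) := H (@subIsetl _ _ _); apply.
  by apply/(smooth_funP _ oV) => q [Uq cq]; exact: smooth_at_coord.
apply/(smooth_funP _ oV) => p Vp; apply: smooth_vact; first exact: SX (VU _ Vp).
by have /(smooth_funP _ oV) := Sf; apply.
Qed.

Lemma smooth_vat_eq X Y p : (\forall q \near p, X q = Y q) ->
  smooth_vat X p -> smooth_vat Y p.
Proof.
move=> XY SX a; apply: smooth_at_eq (SX a).
by apply: filterS XY => q E; rewrite /vact E.
Qed.

Lemma near_coord p a : \forall q \near p, smooth_at (chart_coord (chart_at p) a) q.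
Proof.
by apply/smooth_at_near/smooth_at_coord; [exact: chart_at_atlas|exact: chart_at_dom].
Qed.

Lemma dact_lin p (a : R) u v f : smooth_at f p ->
  dact p (a *: u + v) f = a * dact p u f + dact p v f.
Proof. by move=> Sf; rewrite !dactE // pairingZ. Qed.

Lemma dact_sumv p (I : finType) (a : I -> R) (V : I -> 'rV[R]_n) f : smooth_at f p ->
  dact p (\sum_i a i *: V i) f = \sum_i a i * dact p (V i) f.
Proof.
move=> Sf; apply: (big_rec2 (fun v r => dact p v f = r)) => [|i v r _ <-].
  by rewrite dactE // pairing0.
by rewrite dact_lin.
Qed.

Lemma smooth_vat_lin (h : M -> R) X Y p : smooth_at h p ->
  smooth_vat X p -> smooth_vat Y p -> smooth_vat (fun q => h q *: X q + Y q) p.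
Proof.
move=> Sh SX SY a.
apply: (@smooth_at_eq _ _ _ (fun q => h q * vact X (chart_coord (chart_at p) a) q
   + vact Y (chart_coord (chart_at p) a) q)).
  by apply: filterS (near_coord p a) => q Sq; rewrite /vact dact_lin.
by apply: smooth_atD => //; exact: smooth_atM.
Qed.

Lemma smooth_vat0 p : smooth_vat (fun=> 0) p.
Proof.
move=> a; apply: smooth_at_eq (smooth_at_cst 0 p).
apply: filterS (near_coord p a) => q Sq; by rewrite /vact dactE // pairing0.
Qed.

Lemma smooth_vat_sum (I : finType) (h : I -> M -> R) (X : I -> vfield M) p :
  (forall i, smooth_at (h i) p) -> (forall i, smooth_vat (X i) p) ->
  smooth_vat (fun q => \sum_i h i q *: X i q) p.
Proof.
move=> Sh SX.
suff H : forall s : seq I, smooth_vat (fun q => \sum_(i <- s) h i q *: X i q) p by exact: H.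
elim=> [|i s IH].
  by apply: smooth_vat_eq (smooth_vat0 p); near=> q; rewrite big_nil.
apply: smooth_vat_eq (smooth_vat_lin (Sh i) (SX i) IH).
by near=> q; rewrite big_cons.
Unshelve. all: by end_near. Qed.

(** The field of constant components w in the chart c.  Its value at p is
    expressed in the coordinates of [chart_at p]. *)
Definition coord_field c (w : 'rV[R]_n) : vfield M := fun p =>
  \row_a 'D_w (chart_coord (chart_at p) a \o cinv c) (cmap c p).

Lemma dact_coord_field c w p f : atlas c -> cdom c p -> smooth_at f p ->
  dact p (coord_field c w p) f = 'D_w (f \o cinv c) (cmap c p).
Proof.
move=> ac cp Sf; have aq := chart_at_atlas p; have dq := chart_at_dom p.
have := @chain_rule _ _ _ (f \o cinv (chart_at p)) (fun y => cmap (chart_at p) (cinv c y))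
  (cmap c p) w.
rewrite cmapK // (dact_chart _ aq dq) // => H.
transitivity ('D_w ((f \o cinv (chart_at p)) \o
    (fun y => cmap (chart_at p) (cinv c y))) (cmap c p)).
  rewrite H; last 2 first.
  - exact: diff_transition.
  - exact: smooth_germ_diff.
  by apply: eq_bigr => b _; rewrite -tangent_coord mxE mulrC.
apply: near_eq_derive; apply: filterS (near_cinv cp (near_cdom dq)) => y cy /=.
by rewrite cmapK.
Qed.

Lemma coord_field_coord c w p b : atlas c -> cdom c p ->
  dact p (coord_field c w p) (chart_coord c b) = w 0 b.
Proof.
move=> ac cp; rewrite dact_coord_field //; last exact: smooth_at_coord.
have -> : 'D_w (chart_coord c b \o cinv c) (cmap c p) =
    'D_w (fun y : 'rV[R]_n => y 0 b) (cmap c p).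
  apply: near_eq_derive; apply: filterS (near_crng cp) => y cy.
  by rewrite /= /chart_coord cinvK.
by rewrite -(@derive_rV _ _ _ id) ?derive_id.
Qed.

Lemma smooth_coord_field c w p : atlas c -> cdom c p -> smooth_vat (coord_field c w) p.
Proof.
move=> ac cp a; apply: (smooth_vact_chart ac cp) => [b|].
  apply: smooth_at_eq (smooth_at_cst (w 0 b) p).
  by apply: filterS (near_cdom cp) => q cq; rewrite /vact coord_field_coord.
by apply: smooth_at_coord; [exact: chart_at_atlas|exact: chart_at_dom].
Qed.

Lemma tangent_decomp c p (v : 'rV[R]_n) : atlas c -> cdom c p ->
  v = \sum_b dact p v (chart_coord c b) *: coord_field c (basis_vec b) p.
Proof.
move=> ac cp; apply: (@tangent_ext _ _ _ p) => f Sf; rewrite dact_sumv //.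
rewrite (dact_chart _ ac cp Sf); apply: eq_bigr => b _.
by rewrite dact_coord_field.
Qed.

Lemma coord_field_chart_at p w : coord_field (chart_at p) w p = w.
Proof.
apply/rowP => a; rewrite (tangent_coord p).
by rewrite coord_field_coord //; [exact: chart_at_atlas|exact: chart_at_dom].
Qed.

(** The second order terms cancel by symmetry of second derivatives, so the
    commutator of two derivations is again a derivation. *)
Lemma vact_bracket X Y p f : smooth_vat X p -> smooth_vat Y p -> smooth_at f p ->
  vact (bracket X Y) f p = vact X (vact Y f) p - vact Y (vact X f) p.
Proof.
move=> SX SY Sf; set c := chart_at p.
have ac : atlas c := chart_at_atlas p; have cp : cdom c p := chart_at_dom p.
pose d b q := pd b (f \o cinv c) (cmap c q).
have Sg : smooth_germ (f \o cinv c) (cmap c p) := Sf.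
have Sd b : smooth_at (d b) p.
  by apply: (@smooth_at_pull _ _ _ c p (pd b (f \o cinv c))) => //; exact: smooth_germ_pd.
have E X' Y' : smooth_vat X' p -> smooth_vat Y' p -> vact X' (vact Y' f) p =
    \sum_b (d b p * vact X' (vact Y' (chart_coord c b)) p) +
    \sum_b \sum_a (vact Y' (chart_coord c b) p * vact X' (chart_coord c a) p *
                   pd a (pd b (f \o cinv c)) (cmap c p)).
  move=> SX' SY'.
  have -> : vact X' (vact Y' f) p = dact p (X' p) (fun q => \sum_b
      vact Y' (chart_coord c b) q * d b q).
    apply: dact_eq; apply: filterS (near_and (near_cdom cp) (smooth_at_near Sf)).
    by move=> q [cq Sq]; rewrite /vact (dact_chart _ ac cq).
  rewrite dact_sum => [|b _]; last by apply: smooth_atM.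
  have D b : dact p (X' p) (d b) =
      \sum_a vact X' (chart_coord c a) p * pd a (pd b (f \o cinv c)) (cmap c p).
    have Dd a : pd a (d b \o cinv c) (cmap c p) = pd a (pd b (f \o cinv c)) (cmap c p).
      apply: near_eq_derive; apply: filterS (near_crng cp) => y cy.
      by rewrite /d /= cinvK.
    rewrite (dact_chart (X' p) ac cp (Sd b)); apply: eq_bigr => a _.
    by rewrite Dd.
  rewrite -big_split; apply: eq_bigr => b _ /=.
  rewrite dactM //.
  rewrite D mulr_sumr [LHS]addrC.
  by congr (_ + _); apply: eq_bigr => a _; rewrite mulrA.
rewrite !E // /vact (dact_chart _ ac cp) //.
rewrite opprD addrACA -sumrB [X in _ = _ + X](_ : _ = 0) ?addr0.
  apply: eq_bigr => b _; rewrite -tangent_coord mxE -mulrBr mulrC //.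
rewrite [X in _ - X]exchange_big /= -sumrB big1 // => b _; rewrite -sumrB big1 // => a _.
by rewrite (schwarz a b Sg); ring.
Qed.

Lemma smooth_bracket X Y p : smooth_vat X p -> smooth_vat Y p ->
  smooth_vat (bracket X Y) p.
Proof.
move=> SX SY a.
have Sa := @smooth_at_coord _ _ _ (chart_at p) p a (chart_at_atlas p) (chart_at_dom p).
have S : smooth_at (fun q => vact X (vact Y (chart_coord (chart_at p) a)) q -
    vact Y (vact X (chart_coord (chart_at p) a)) q) p.
  by apply: smooth_atB; do 2?apply: smooth_vact.
apply: smooth_at_eq S.
apply: filterS (near_and (near_coord p a)
  (near_and (smooth_vat_near SX) (smooth_vat_near SY))) => q [Sq [SXq SYq]].
by rewrite vact_bracket.
Qed.

Lemma bracketC X Y p : bracket X Y p = - bracket Y X p.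
Proof. by apply/rowP => a; rewrite !mxE opprB. Qed.

End VectorFields.

(** * Orthonormal frames *)

Section Pairing.
Context {R : realType} {n : nat}.
Implicit Types (l m : 'cV[R]_n) (u v : 'rV[R]_n).

Lemma pairingDr l u v : pairing l (u + v) = pairing l u + pairing l v.
Proof. by have := pairingZ l 1 u v; rewrite scale1r mul1r. Qed.

Lemma pairingZr l (a : R) u : pairing l (a *: u) = a * pairing l u.
Proof. by have := pairingZ l a u 0; rewrite !addr0 pairing0 addr0. Qed.

Lemma pairingNr l u : pairing l (- u) = - pairing l u.
Proof. by rewrite -scaleN1r pairingZr mulN1r. Qed.

Lemma pairingBr l u v : pairing l (u - v) = pairing l u - pairing l v.
Proof. by rewrite pairingDr pairingNr. Qed.

Lemma pairing_sumr l (I : finType) (F : I -> 'rV[R]_n) :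
  pairing l (\sum_i F i) = \sum_i pairing l (F i).
Proof.
by apply: (big_morph (pairing l) (pairingDr l) (pairing0 l)).
Qed.

Lemma pairingDl l m v : pairing (l + m) v = pairing l v + pairing m v.
Proof.
rewrite /pairing -big_split; apply: eq_bigr => a _ /=.
by rewrite mxE mulrDl.
Qed.

Lemma pairingZl (a : R) l v : pairing (a *: l) v = a * pairing l v.
Proof.
by rewrite /pairing mulr_sumr; apply: eq_bigr => i _; rewrite mxE mulrA.
Qed.

Lemma pairingNl l v : pairing (- l) v = - pairing l v.
Proof. by rewrite -scaleN1r pairingZl mulN1r. Qed.

Lemma pairing0l v : pairing (0 : 'cV[R]_n) v = 0.
Proof. by rewrite /pairing big1 // => a _; rewrite mxE mul0r. Qed.

Lemma pairing_suml (I : finType) (F : I -> 'cV[R]_n) v :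
  pairing (\sum_i F i) v = \sum_i pairing (F i) v.
Proof.
by apply: (big_morph (fun l => pairing l v) (fun l m => pairingDl l m v) (pairing0l v)).
Qed.

Lemma pairing_basis l a : pairing l (basis_vec a) = l a 0.
Proof.
rewrite /pairing (bigD1 a) //= big1 ?addr0 => [|b ba].
  by rewrite /basis_vec mxE !eqxx mulr1.
by rewrite /basis_vec mxE (negbTE ba) andbF mulr0.
Qed.

Lemma pairing_ext l m : (forall v, pairing l v = pairing m v) -> l = m.
Proof. by move=> H; apply/colP => a; rewrite -!pairing_basis H. Qed.

End Pairing.

Section Metric.
Context {R : realType} {n k : nat} {M : smooth_manifold R n}.
Variable S : subriemannian M k.
Local Notation D := (distr S).
Local Notation g := (metric S).
Implicit Types (q : M) (u v w : 'rV[R]_n).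

Lemma metricDl q u v w : u \in D q -> v \in D q -> w \in D q ->
  g q (u + v) w = g q u w + g q v w.
Proof. by move=> Du Dv Dw; have := metric_lin 1 Du Dv Dw; rewrite scale1r mul1r. Qed.

Lemma metric0l q w : w \in D q -> g q 0 w = 0.
Proof.
move=> Dw; have := metric_lin (-1) (mem0v _) (mem0v _) Dw.
by rewrite scaler0 addr0 mulN1r addNr.
Qed.

Lemma metricZl q (a : R) u w : u \in D q -> w \in D q -> g q (a *: u) w = a * g q u w.
Proof.
by move=> Du Dw; have := metric_lin a Du (mem0v _) Dw; rewrite addr0 metric0l // addr0.
Qed.

Lemma metricC q u v : u \in D q -> v \in D q -> g q u v = g q v u.
Proof. by move=> Du Dv; exact: Defs.metric_sym. Qed.

Lemma metric_suml q (I : finType) (F : I -> 'rV[R]_n) w :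
  (forall i, F i \in D q) -> w \in D q ->
  g q (\sum_i F i) w = \sum_i g q (F i) w.
Proof.
move=> DF Dw.
suff H : forall s : seq I, g q (\sum_(i <- s) F i) w = \sum_(i <- s) g q (F i) w by exact: H.
elim=> [|i s IH]; first by rewrite !big_nil metric0l.
by rewrite !big_cons metricDl ?IH // memv_suml.
Qed.

Lemma metric_sumr q (I : finType) (F : I -> 'rV[R]_n) w :
  (forall i, F i \in D q) -> w \in D q ->
  g q w (\sum_i F i) = \sum_i g q w (F i).
Proof.
move=> DF Dw; rewrite metricC ?memv_suml // metric_suml //.
by apply: eq_bigr => i _; rewrite metricC.
Qed.

Lemma metricZr q (a : R) u w : u \in D q -> w \in D q -> g q w (a *: u) = a * g q w u.
Proof. by move=> Du Dw; rewrite metricC ?memvZ // metricZl // metricC. Qed.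

Lemma metricDr q u v w : u \in D q -> v \in D q -> w \in D q ->
  g q w (u + v) = g q w u + g q w v.
Proof. by move=> Du Dv Dw; rewrite metricC ?memvD // metricDl // !(metricC Dw). Qed.

Lemma metric_eq0 q v : v \in D q -> (forall w, w \in D q -> g q v w = 0) -> v = 0.
Proof.
move=> Dv H; apply/eqP; apply/negPn/negP => v0.
by have := metric_pos Dv v0; rewrite H // ltxx.
Qed.

Section Basis.
Variables (q : M) (e : 'I_k -> 'rV[R]_n).
Hypothesis oe : orthonormal_basis S q e.

Let De i : e i \in D q. Proof. by case: oe. Qed.
Let ge i j : g q (e i) (e j) = (i == j)%:R. Proof. by case: oe. Qed.

(** Orthonormal vectors are free, and the rank of D leaves no room for more. *)
Lemma onb_decomp v : v \in D q -> v = \sum_i g q (e i) v *: e i.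
Proof.
have gs (a : 'I_k -> R) j : g q (e j) (\sum_i a i *: e i) = a j.
  rewrite metric_sumr // => [|i]; last by rewrite memvZ.
  rewrite (bigD1 j) //= big1 ?addr0 => [|i ij].
    by rewrite metricZr // ge eqxx mulr1.
  by rewrite metricZr // ge eq_sym (negbTE ij) mulr0.
pose t := [tuple e i | i < k].
have tE (i : 'I_k) : t`_i = e i by rewrite -tnth_nth tnth_mktuple.
have ft : free t.
  apply/freeP => a E j; rewrite -(gs a j).
  by under eq_bigr do rewrite -tE; rewrite E metricC ?mem0v // metric0l.
have st : <<t>>%VS = D q.
  apply/eqP; rewrite eqEdim; apply/andP; split.
    by apply/span_subvP => _ /mapP [i _ ->].
  by have [-> _] := distr_smooth S; rewrite (eqP ft) size_tuple.
rewrite -st => vt; rewrite {1}(coord_span vt); apply: eq_bigr => i _; rewrite tE.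
congr (_ *: _); rewrite {2}(coord_span vt) -[LHS](gs (coord t ^~ v)).
by congr (g q _ _); apply: eq_bigr => j _; rewrite tE.
Qed.

End Basis.

(** Both sides equal the sum over i and j of g(e_j, e'_i) <l, e_j> <l, e'_i>. *)
Lemma energy_onb q e e' (l : 'cV[R]_n) :
  orthonormal_basis S q e -> orthonormal_basis S q e' ->
  \sum_i pairing l (e i) ^+ 2 = \sum_i pairing l (e' i) ^+ 2.
Proof.
move=> oe oe'; have [De ge] := oe; have [De' ge'] := oe'.
have E i : pairing l (e' i) ^+ 2 =
    \sum_j g q (e j) (e' i) * pairing l (e j) * pairing l (e' i).
  rewrite expr2 {1}(onb_decomp oe (De' i)) pairing_sumr mulr_suml.
  by apply: eq_bigr => j _; rewrite pairingZr.
under [RHS]eq_bigr do rewrite E.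
rewrite exchange_big /=; apply: eq_bigr => j _.
rewrite expr2 {2}(onb_decomp oe' (De j)) pairing_sumr mulr_sumr.
by apply: eq_bigr => i _; rewrite pairingZr (metricC (De' i)) //; ring.
Qed.

(** Gram-Schmidt, performed on a smooth frame simultaneously at all points of
    its domain. *)
Lemma local_orthonormal_frame q : exists (U : set M) (X : 'I_k -> vfield M),
  [/\ open U, U q, forall i, section_on U D (X i)
    & forall p, U p -> orthonormal_basis S p (X ^~ p)].
Proof.
have [dimD /(_ q) [U [Y [oU Uq SY DY]]]] := distr_smooth S.
exists U.
have spS (P Q : pred 'I_k) p : (forall j, P j -> Q j) ->
    (<<[seq Y j p | j <- enum P]>> <= <<[seq Y j p | j <- enum Q]>>)%VS.
  move=> PQ; apply: sub_span => v /mapP [j]; rewrite mem_enum => Pj ->.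
  by apply: map_f; rewrite mem_enum; exact: PQ.
suff H m : (m <= k)%N -> exists X : 'I_k -> vfield M,
    (forall i : 'I_k, (i < m)%N -> section_on U D (X i)) /\
    forall p, U p -> (forall i : 'I_k, (i < m)%N ->
        X i p \in <<[seq Y j p | j <- enum [pred j : 'I_k | (j < m)%N]]>>%VS) /\
      (forall i j : 'I_k, (i < m)%N -> (j < m)%N -> g p (X i p) (X j p) = (i == j)%:R).
  have [X [sX oX]] := H k (leqnn k).
  exists X; split=> // [i|p Up]; first exact: sX.
  split=> [i|i j]; first by have [_ ->] := sX i (ltn_ord i).
  by have [_ ->] := oX p Up.
elim: m => [_|m IH mk]; first by exists Y; split=> [//|p _]; split.
have [X [sX oX]] := IH (ltnW mk).
pose o : 'I_k := Ordinal mk.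
have YD i p : U p -> Y i p \in D p.
  by move=> Up; rewrite DY //; apply: memv_span; apply: map_f; rewrite mem_enum.
have sY i : section_on U D (Y i) by split=> // p; exact: YD.
(* W is the component of the m-th field orthogonal to those already built. *)
pose c (i : 'I_k) p := if (i < m)%N then g p (X i p) (Y o p) else 0.
pose W p := Y o p - \sum_i c i p *: X i p.
have XD (i : 'I_k) p : U p -> (i < m)%N -> X i p \in D p.
  by move=> Up im; have [_ ->] := sX i im.
have sumD p : U p -> \sum_i c i p *: X i p \in D p.
  move=> Up; apply: memv_suml => i _; rewrite /c; case: ifPn => im.
    by rewrite memvZ // XD.
  by rewrite scale0r mem0v.
have WD p : U p -> W p \in D p by move=> Up; rewrite memvB ?YD // sumD.
have sm_c i p : U p -> smooth_at (c i) p.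
  move=> Up; have [im|/negbTE im] := boolP (i < m)%N.
    have /(smooth_funP _ oU) H := metric_smooth oU (sX i im) (sY o).
    by apply: smooth_at_eq (H p Up); near=> p'; rewrite /c im.
  by apply: smooth_at_eq (smooth_at_cst 0 p); near=> p'; rewrite /c im.
have sW p : U p -> smooth_vat W p.
  move=> Up.
  have : smooth_vat (fun q => (-1) *: (\sum_(i < k) (if (i < m)%N then c i q else 0) *:
      (if (i < m)%N then X i q else 0)) + Y o q) p.
    apply: smooth_vat_lin; first exact: smooth_at_cst.
      apply: (@smooth_vat_sum _ _ _ _ (fun (i : 'I_k) q => if (i < m)%N then c i q else 0)
               (fun (i : 'I_k) q => if (i < m)%N then X i q else 0)) => i.
        by have [im|_] := boolP (i < m)%N; [exact: sm_c|exact: smooth_at_cst].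
      have [im|_] := boolP (i < m)%N; last exact: smooth_vat0.
      by have [/(smooth_vfieldP _ oU) H _] := sX i im; exact: H.
    by have /(smooth_vfieldP _ oU) := SY o; apply.
  apply: smooth_vat_eq; near=> p'.
  rewrite scaleN1r addrC /W; congr (_ - _); apply: eq_bigr => i _.
  by have [im|/negbTE im] := boolP (i < m)%N; rewrite /c im ?scale0r.
have Xm p (i : 'I_k) : U p -> (i < m)%N -> g p (X i p) (W p) = 0.
  move=> Up im; have [_ on] := oX p Up.
  have -> : W p = Y o p + (-1) *: \sum_i c i p *: X i p by rewrite scaleN1r.
  rewrite metricDr ?YD ?XD ?memvZ ?sumD // metricZr ?XD ?sumD //.
  rewrite metric_sumr ?XD // => [|j]; last first.
    by rewrite /c; case: ifPn => jm; rewrite ?scale0r ?mem0v // memvZ // XD.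
  rewrite (bigD1 i) //= big1 ?addr0 => [|j ji].
    by rewrite metricZr ?XD // on // eqxx mulr1 /c im mulN1r subrr.
  rewrite /c; case: ifPn => jm; last by rewrite scale0r metricC ?mem0v ?XD // metric0l ?XD.
  by rewrite metricZr ?XD // on // eq_sym (negbTE ji) mulr0.
have Wspan p : U p -> W p \in <<[seq Y j p | j <- enum [pred j : 'I_k | (j < m.+1)%N]]>>%VS.
  move=> Up; have [sp _] := oX p Up.
  apply: memvB; first by apply: memv_span; apply: map_f; rewrite mem_enum inE /= ltnSn.
  apply: memv_suml => i _; rewrite /c; case: ifPn => im; last by rewrite scale0r mem0v.
  apply: memvZ; apply: subvP (sp i im); apply: spS => j /=; exact: leqW.
(* Otherwise k - 1 of the vectors Y j p would span D p. *)
have WN0 p : U p -> W p != 0.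
  move=> Up; apply/eqP => W0; have [sp _] := oX p Up.
  have : Y o p \in <<[seq Y j p | j <- enum [pred j | j != o]]>>%VS.
    move/eqP: W0; rewrite subr_eq0 => /eqP ->.
    apply: memv_suml => i _; rewrite /c; case: ifPn => im; last by rewrite scale0r mem0v.
    apply: memvZ; apply: subvP (sp i im); apply: spS => j /= jm.
    by rewrite -val_eqE /= neq_ltn jm.
  move=> Ys; have : (D p <= <<[seq Y j p | j <- enum [pred j | j != o]]>>)%VS.
    rewrite DY //; apply/span_subvP => _ /mapP [j _ ->].
    have [->//|jo] := eqVneq j o.
    by apply: memv_span; apply: map_f; rewrite mem_enum.
  move=> /dimvS; rewrite dimD; apply/negP; rewrite -ltnNge.
  apply: leq_ltn_trans (dim_span _) _; rewrite size_map -cardE.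
  have -> : #|[pred j | j != o]| = k.-1 by rewrite (cardC1 o) card_ord.
  by rewrite ltn_predL (leq_ltn_trans _ mk).
pose N p := g p (W p) (W p).
have N0 p : U p -> 0 < N p by move=> Up; apply: metric_pos; rewrite ?WD ?WN0.
have secW : section_on U D W.
  by split; [apply/smooth_vfieldP|exact: WD].
pose E p := N p `^ (- 2^-1) *: W p.
have secE : section_on U D E.
  split=> [|p Up]; last by rewrite memvZ // WD.
  apply/(smooth_vfieldP _ oU) => p Up.
  have : smooth_vat (fun q => N q `^ (- 2^-1) *: W q + 0) p.
    apply: smooth_vat_lin; [|exact: sW|exact: smooth_vat0].
    apply: smooth_at_powR; first exact: N0.
    by have /(smooth_funP _ oU) := metric_smooth oU secW secW; apply.
  by apply: smooth_vat_eq; near=> p'; rewrite addr0.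
have EE p : U p -> g p (E p) (E p) = 1.
  move=> Up; rewrite /E metricZl ?memvZ ?WD // metricZr ?WD // mulrA -/(N p).
  have NN := N0 p Up; rewrite -powRD ?(gt_eqF NN) ?implybT //.
  have -> : - 2^-1 - 2^-1 = -1 :> R by lra.
  by rewrite (powR_inv1 (ltW NN)) mulVf ?gt_eqF.
have XE p (i : 'I_k) : U p -> (i < m)%N -> g p (X i p) (E p) = 0.
  by move=> Up im; rewrite /E metricZr ?XD ?WD // Xm // mulr0.
have im1 (i : 'I_k) : (i < m.+1)%N -> i != o -> (i < m)%N.
  by rewrite ltnS leq_eqVlt -val_eqE /= => /orP[/eqP->|//]; rewrite eqxx.
exists (fun i => if i == o then E else X i); split=> [i im|p Up].
  by case: eqVneq => [_|io]; [exact: secE|exact: sX (im1 _ im io)].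
have [sp on] := oX p Up; split=> [i im|i j im jm].
  case: eqVneq => [_|io]; first by rewrite memvZ // Wspan.
  apply: subvP (sp i (im1 _ im io)); apply: spS => j /=; exact: leqW.
case: (eqVneq i o) => [Ei|io]; case: (eqVneq j o) => [Ej|jo].
- by rewrite EE // Ei Ej eqxx.
- have jm' := im1 _ jm jo.
  by rewrite metricC ?(secE.2 _ Up) ?XD // XE // Ei eq_sym (negbTE jo).
- by rewrite XE ?im1 // Ej (negbTE io).
- by rewrite on ?im1.
Unshelve. all: by end_near. Qed.

Lemma some_onbP q : orthonormal_basis S q (some_onb S q).
Proof.
have [U [X [_ Uq _ oX]]] := local_orthonormal_frame q.
exact: (@xgetI _ _ _ (X ^~ q) (oX q Uq)).
Qed.

Lemma hamiltonianE q e (l : 'cV[R]_n) : orthonormal_basis S q e ->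
  hamiltonian S q l = 2^-1 * \sum_i pairing l (e i) ^+ 2.
Proof. by move=> oe; rewrite /hamiltonian (energy_onb l (some_onbP q) oe). Qed.

End Metric.

(** * The Hamiltonian flow *)

Section ComponentDerivatives.
Context {R : realType} {V : normedModType R} {m n : nat}.

Lemma is_derive_mxP (A : V -> 'M[R]_(m, n)) (dA : 'M[R]_(m, n)) (t v : V) :
  is_derive t v A dA <-> forall i j, is_derive t v (fun s => A s i j) (dA i j).
Proof.
split=> [[d <-] i j|H].
  by apply: DeriveDef; [exact: (derivable_mxP A t v).1 d i j|rewrite derive_mx // mxE].
have d : derivable A t v by apply/derivable_mxP => i j; case: (H i j).
apply: DeriveDef => //; rewrite derive_mx //; apply/matrixP => i j; rewrite mxE.
by case: (H i j).
Qed.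

Lemma is_derive_sumf (I : finType) (W : normedModType R) (F : I -> V -> W) (dF : I -> W) (t v : V) :
  (forall i, is_derive t v (F i) (dF i)) ->
  is_derive t v (fun s => \sum_i F i s) (\sum_i dF i).
Proof.
move=> H; rewrite (_ : (fun s => _) = \sum_i F i); last first.
  by apply/funext => s; rewrite fct_sumE.
apply: (big_rec2 (fun f df => is_derive t v f df)) => [|i f df _ Hf].
  exact: is_derive_cst.
exact: is_deriveD.
Qed.

Lemma is_derive_mulf (f g : V -> R) (df dg : R) (t v : V) :
  is_derive t v f df -> is_derive t v g dg ->
  is_derive t v (fun s => f s * g s) (df * g t + f t * dg).
Proof.
move=> Hf Hg; apply: (is_derive_eq (is_deriveM Hf Hg)).
by rewrite /GRing.scale /= addrC mulrC [df * _]mulrC mulrC.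
Qed.

Lemma is_derive_mulcf (c : R) (f : V -> R) (df : R) (t v : V) :
  is_derive t v f df -> is_derive t v (fun s => c * f s) (c * df).
Proof. by move=> Hf; apply: is_deriveZ. Qed.

Lemma half_sum_sqr (I : finType) (f : I -> V -> R) (df : I -> R) (t v : V) :
  (forall j, is_derive t v (f j) (df j)) ->
  is_derive t v (fun s => 2^-1 * \sum_j f j s ^+ 2) (\sum_j f j t * df j).
Proof.
move=> H; apply: is_derive_eq.
  apply: is_derive_mulcf; apply: is_derive_sumf => j.
  exact: is_derive_mulf (H j) (H j).
by rewrite mulr_sumr; apply: eq_bigr => j _; field.
Qed.

End ComponentDerivatives.

Section HamiltonChart.
Context {R : realType} {n k : nat} {M : smooth_manifold R n}.
Variable S : subriemannian M k.
Variables (c : chart R n M) (U : set M) (X : 'I_k -> vfield M).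
Hypotheses (ac : atlas c) (oU : open U) (sX : forall i, smooth_vfield U (X i)).
Hypothesis onX : forall p, U p -> orthonormal_basis S p (X ^~ p).

Definition field_comp (Z : vfield M) (a : 'I_n) (y : 'rV[R]_n) : R :=
  vact Z (chart_coord c a) (cinv c y).

Lemma pairing_cotangent y (p : 'cV[R]_n) (v : 'rV[R]_n) : crng c y ->
  pairing (cotangent_chart c y p) v =
  \sum_a p a 0 * dact (cinv c y) v (chart_coord c a).
Proof.
move=> cy; rewrite /cotangent_chart pairing_suml; apply: eq_bigr => a _.
by rewrite pairingZl -dactE //; apply: smooth_at_coord => //; exact: cinv_dom.
Qed.

Lemma smooth_field_comp Z a y : crng c y -> smooth_vat Z (cinv c y) -> smooth_germ (field_comp Z a) y.
Proof.
move=> cy SZ.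
have cd := cinv_dom cy.
have /(smooth_atP _ ac cd) : smooth_at (vact Z (chart_coord c a)) (cinv c y).
  by apply: smooth_vact => //; exact: smooth_at_coord.
by rewrite cinvK.
Qed.

Lemma near_domain y : crng c y -> U (cinv c y) ->
  \forall y' \near y, crng c y' /\ U (cinv c y').
Proof.
move=> cy Uy; apply: near_and.
  by apply: open_nbhs_nbhs; split => //; exact: crng_open.
have : \forall p \near cinv c y, U p by exact: open_nbhs_nbhs.
exact: (cinv_cont cy).
Qed.

(** The momentum of the j-th field of the frame; the Hamiltonian is half the sum
    of the squares of the momenta. *)
Definition momentum j y (p : 'cV[R]_n) : R := \sum_a p a 0 * field_comp (X j) a y.

Lemma hamiltonian_chartE y p : crng c y -> U (cinv c y) ->
  hamiltonian_chart S c y p = 2^-1 * \sum_j momentum j y p ^+ 2.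
Proof.
move=> cy Uy; rewrite /hamiltonian_chart (hamiltonianE _ (onX Uy)).
by congr (_ * _); apply: eq_bigr => j _; rewrite pairing_cotangent.
Qed.

Lemma derive_hamiltonian_p y p b : crng c y -> U (cinv c y) ->
  'D_(delta_mx b 0) (hamiltonian_chart S c y) p =
  \sum_j momentum j y p * field_comp (X j) b y.
Proof.
move=> cy Uy.
have -> : hamiltonian_chart S c y = (fun p => 2^-1 * \sum_j momentum j y p ^+ 2).
  by apply/funext => p'; exact: hamiltonian_chartE.
apply: derive_val; apply: half_sum_sqr => j; apply: is_derive_eq.
  apply: is_derive_sumf => a.
  apply: (@is_derive_mulf _ _ (fun p : 'cV[R]_n => p a 0) (fun=> field_comp (X j) a y)).
    exact: (is_derive_mxP id _ _ _).1 (is_derive_id _ _) a 0.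
rewrite (bigD1 b) //= big1 ?addr0 => [|a ab]; rewrite mxE.
  by rewrite !eqxx mul1r mulr0 addr0.
by rewrite (negbTE ab) mul0r mulr0 addr0.
Qed.

Lemma derive_hamiltonian_y y p b : crng c y -> U (cinv c y) ->
  'D_(basis_vec b) (hamiltonian_chart S c ^~ p) y =
  \sum_j momentum j y p * \sum_a p a 0 * pd b (field_comp (X j) a) y.
Proof.
move=> cy Uy.
have E : \forall y' \near y, 2^-1 * \sum_j momentum j y' p ^+ 2 = hamiltonian_chart S c y' p.
  by apply: filterS (near_domain cy Uy) => y' [cy' Uy']; rewrite hamiltonian_chartE.
rewrite -(near_eq_derive _ E); apply: derive_val; apply: half_sum_sqr => j.
apply: is_derive_sumf => a; apply: is_derive_mulcf.
apply/derivableP/diff_derivable/smooth_germ_diff/smooth_field_comp => //.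
by have /(smooth_vfieldP _ oU) := sX j; apply.
Qed.

End HamiltonChart.

Section FlowDerivatives.
Context {R : realType} {n k : nat} {M : smooth_manifold R n}.
Variable S : subriemannian M k.
Variables (U : set M) (X : 'I_k -> vfield M).
Hypotheses (oU : open U) (sX : forall i, smooth_vfield U (X i)).
Hypothesis onX : forall p, U p -> orthonormal_basis S p (X ^~ p).
Variables (gamma : R -> M * 'cV[R]_n) (s : R).
Hypotheses (Hg : hamilton_at S gamma s) (Us : U (gamma s).1).

Local Notation x r := (gamma r).1.
Local Notation u j := (pairing (gamma s).2 (X j (x s))).

Let SX j : smooth_vat (X j) (x s).
Proof. by have /(smooth_vfieldP _ oU) := sX j; apply. Qed.

Lemma hamilton_at_continuous : (fun r => x r) r @[r --> s] --> x s.
Proof.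
have [c [y [p [ac Hy [dy _] _]]]] := Hg.
have [cy Es] := nbhs_singleton Hy.
have ycont : {for s, continuous y} by apply/differentiable_continuous/derivable1_diffP.
rewrite Es /=.
have E : \forall r \near s, cinv c (y r) = x r.
  by apply: filterS Hy => r [_ ->].
apply: (cvg_trans (near_eq_cvg E)).
exact: (@continuous_comp _ _ _ y (cinv c) s ycont (cinv_cont cy)).
Qed.

(** Hamilton's equations in chart-free form, for functions on the base ... *)
Lemma is_derive_base phi : smooth_at phi (x s) ->
  is_derive s 1 (fun r => phi (x r)) (\sum_j u j * vact (X j) phi (x s)).
Proof.
move=> Sphi; have [c [y [p [ac Hy dy _]]]] := Hg.
have [cy Es] := nbhs_singleton Hy.
have Uy : U (cinv c (y s)) by move: Us; rewrite Es.
have cd := cinv_dom cy.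
rewrite Es /= in Sphi *.
have dF : differentiable (phi \o cinv c) (y s).
  by apply: smooth_germ_diff; have /(smooth_atP _ ac cd) := Sphi; rewrite cinvK.
have ddy : differentiable y s by apply/derivable1_diffP; case: dy.
have E : \forall r \near s, (phi \o cinv c) (y r) = phi (x r).
  by apply: filterS Hy => r [_ ->].
apply: (near_eq_is_derive E); apply: DeriveDef.
  apply/derivable1_diffP; exact: (@differentiable_comp _ _ _ _ y (phi \o cinv c)).
rewrite [LHS](@chain_rule _ _ _ (phi \o cinv c) y) //.
under [LHS]eq_bigr => b _.
  have -> : 'D_1 (fun r => y r 0 b) s = \sum_j momentum c X j (y s) (p s) * field_comp c (X j) b (y s).
    have [_ ->] := (is_derive_mxP _ _ _ _).1 dy 0 b.
    by rewrite mxE (derive_hamiltonian_p ac onX).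
  rewrite mulr_sumr; over.
rewrite exchange_big /=; apply: eq_bigr => j _.
rewrite pairing_cotangent // /vact (dact_chart _ ac cd Sphi) cinvK // mulr_sumr.
by apply: eq_bigr => b _; rewrite /momentum /field_comp /vact; ring.
Qed.

(** ... and for the fibrewise linear functions given by vector fields, whose
    Poisson brackets are the functions given by the Lie brackets. *)
Lemma is_derive_momentum Z : smooth_vat Z (x s) ->
  is_derive s 1 (fun r => pairing (gamma r).2 (Z (x r)))
    (\sum_j u j * pairing (gamma s).2 (bracket (X j) Z (x s))).
Proof.
move=> SZ; have [c [y [p [ac Hy dy dp]]]] := Hg.
have [cy Es] := nbhs_singleton Hy.
have Uy : U (cinv c (y s)) by move: Us; rewrite Es.
have cd := cinv_dom cy.
have SX' j : smooth_vat (X j) (cinv c (y s)) by have := SX j; rewrite Es.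
rewrite Es /= in SZ *.
have E : \forall r \near s, \sum_a p r a 0 * field_comp c Z a (y r) = pairing (gamma r).2 (Z (x r)).
  by apply: filterS Hy => r [cr ->] /=; rewrite pairing_cotangent.
have ddy : differentiable y s by apply/derivable1_diffP; case: dy.
apply: (near_eq_is_derive E).
pose mom j := momentum c X j (y s) (p s).
have dyb b : 'D_1 (fun r => y r 0 b) s = \sum_j mom j * field_comp c (X j) b (y s).
  have [_ ->] := (is_derive_mxP _ _ _ _).1 dy 0 b.
  by rewrite mxE (derive_hamiltonian_p ac onX).
have dpa a : is_derive s 1 (fun r => p r a 0)
    (- \sum_j mom j * \sum_b p s b 0 * pd a (field_comp c (X j) b) (y s)).
  apply: (is_derive_eq ((is_derive_mxP _ _ _ _).1 dp a 0)).
  by rewrite !mxE (derive_hamiltonian_y ac oU sX onX).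
have dZ a : is_derive s 1 (fun r => field_comp c Z a (y r))
    (\sum_j mom j * \sum_b field_comp c (X j) b (y s) * pd b (field_comp c Z a) (y s)).
  have dF : differentiable (field_comp c Z a) (y s) by apply/smooth_germ_diff/smooth_field_comp.
  apply: DeriveDef.
    apply/derivable1_diffP; exact: (@differentiable_comp _ _ _ _ y (field_comp c Z a)).
  rewrite [LHS](@chain_rule _ _ _ (field_comp c Z a) y) //.
  under eq_bigr do rewrite dyb mulr_sumr.
  rewrite exchange_big /=; apply: eq_bigr => j _; rewrite mulr_sumr.
  by apply: eq_bigr => b _; ring.
apply: is_derive_eq.
  by apply: is_derive_sumf => a; exact: is_derive_mulf (dpa a) (dZ a).
have br j : pairing (cotangent_chart c (y s) (p s)) (bracket (X j) Z (cinv c (y s))) =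
    \sum_a p s a 0 * (\sum_b field_comp c (X j) b (y s) * pd b (field_comp c Z a) (y s) -
      \sum_b field_comp c Z b (y s) * pd b (field_comp c (X j) a) (y s)).
  rewrite pairing_cotangent //; apply: eq_bigr => a _; congr (_ * _).
  have Sa : smooth_at (chart_coord c a) (cinv c (y s)) by exact: smooth_at_coord.
  have -> : dact (cinv c (y s)) (bracket (X j) Z (cinv c (y s))) (chart_coord c a) =
    vact (bracket (X j) Z) (chart_coord c a) (cinv c (y s)) by [].
  rewrite (vact_bracket (SX' j) SZ Sa) {1 3}/vact.
  rewrite (dact_chart _ ac cd (smooth_vact SZ Sa)).
  by rewrite (dact_chart _ ac cd (smooth_vact (SX' j) Sa)) cinvK.
under [RHS]eq_bigr => j _ do rewrite pairing_cotangent // br mulr_sumr.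
rewrite [RHS]exchange_big /=.
transitivity (\sum_a \sum_j (p s a 0 * (mom j * \sum_b field_comp c (X j) b (y s) * pd b (field_comp c Z a) (y s)))
   - \sum_a \sum_j (mom j * \sum_b p s b 0 * pd a (field_comp c (X j) b) (y s)) * field_comp c Z a (y s)).
  rewrite -sumrB; apply: eq_bigr => a _; 
  by rewrite /GRing.scale /= mulrN mulr_sumr [X in _ - X]mulrC mulr_suml.
transitivity (\sum_a \sum_j (p s a 0 * (mom j * \sum_b field_comp c (X j) b (y s) * pd b (field_comp c Z a) (y s)))
   - \sum_a \sum_j (mom j * (p s a 0 * \sum_b field_comp c Z b (y s) * pd b (field_comp c (X j) a) (y s)))).
  congr (_ - _); rewrite exchange_big [RHS]exchange_big /=; apply: eq_bigr => j _.
  under eq_bigr do rewrite mulr_sumr mulr_suml.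
  rewrite exchange_big /=; apply: eq_bigr => a _; rewrite !mulr_sumr.
  by apply: eq_bigr => b _; ring.
rewrite -sumrB; apply: eq_bigr => a _; rewrite -sumrB; apply: eq_bigr => j _.
rewrite -/(momentum c X j (y s) (p s)) -/(mom j).
by rewrite mulrCA -mulrBr -mulrBr.
Qed.

End FlowDerivatives.

(** * Second order expansion along Hamiltonian curves *)

Section Confinement.
Context {R : realType} {T : topologicalType}.

(** At the first exit time from the open set B the curve would be in K, since K is
    closed, hence in B. *)
Lemma confinement (x : R -> T) (K B : set T) (t : R) :
  closed K -> open B -> K `<=` B ->
  (forall s, 0 <= s <= t -> {for s, continuous x}) ->
  (forall s, 0 <= s <= t -> (forall r, 0 <= r < s -> B (x r)) ->
     (forall r, 0 <= r < s -> K (x r))) -> K (x 0) ->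
  forall s, 0 <= s <= t -> B (x s).
Proof.
move=> cK oB KB cx H K0 s0 s0t; apply: contrapT => NB.
pose A := [set s | 0 <= s <= t /\ ~ B (x s)].
have A0 : A s0 by [].
have lbA : has_lbound A by exists 0 => s [/andP[]].
have infA : has_inf A by split=> //; exists s0.
(* The first exit time from B. *)
set m := inf A.
have m0 : 0 <= m by apply: lb_le_inf; [exists s0|move=> s [/andP[]]].
have ms0 : m <= s0 by exact: ge_inf.
have mt : m <= t by case/andP: s0t => _; exact: le_trans.
have m0t : 0 <= m <= t by rewrite m0.
have Bm r : 0 <= r < m -> B (x r).
  move=> /andP[r0 rm]; apply: contrapT => NBr.
  have /(ge_inf lbA) : A r by split=> //; rewrite r0 ltW // (lt_le_trans rm).
  by rewrite leNgt rm.
have Km := H m m0t Bm.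
have {}Km : K (x m).
  have [/eqP <- //|mN0] := boolP (0 == m).
  apply: contrapT => NK.
  have : \forall r \near m, ~ K (x r).
    have : \forall y \near x m, (~` K) y.
      by apply: open_nbhs_nbhs; split => //; exact: closed_openC.
    exact: (cx m m0t).
  move=> /nbhs_ballP [e /= e0 He].
  have m1 : 0 < m by rewrite lt_neqAle mN0.
  pose r := Num.max 0 (m - e / 2).
  have r0 : 0 <= r by rewrite le_max lexx.
  have rm : r < m by rewrite gt_max m1 /= ltrBlDr ltrDl divr_gt0.
  apply: (He r); last by apply: Km; rewrite r0.
  rewrite /ball /= ger0_norm ?subr_ge0 ?ltW // ltrBlDr -ltrBlDl.
  by rewrite lt_max; apply/orP; right; lra.
have : \forall r \near m, B (x r).
  have : \forall y \near x m, B y by apply: open_nbhs_nbhs; split => //; exact: KB.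
  exact: (cx m m0t).
move=> /nbhs_ballP [e /= e0 He].
have : m + e <= m.
  apply: lb_le_inf; first by exists s0.
  move=> s As; rewrite leNgt; apply/negP => sm; apply: As.2.
  have ms : m <= s by exact: ge_inf.
  by apply: He; rewrite /ball /= distrC ger0_norm ?subr_ge0 // ltrBlDl.
by rewrite gerDl leNgt e0.
Qed.

End Confinement.

Section MeanValue.
Context {R : realType}.

Lemma mean_bound (h dh : R -> R) (t K : R) :
  (forall s, 0 <= s <= t -> is_derive s 1 h (dh s)) ->
  (forall s, 0 <= s <= t -> `|dh s| <= K) ->
  forall s, 0 <= s <= t -> `|h s - h 0| <= K * s.
Proof.
move=> H HK s /andP[s0 st].
have sub r : 0 <= r <= s -> 0 <= r <= t.
  by move=> /andP[-> rs]; rewrite (le_trans rs).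
have [||c cs E] := @MVT_segment R h dh 0 s s0.
- move=> r; rewrite in_itv /= => /andP[r0 rs]; apply: H; apply: sub.
  by rewrite !ltW.
- apply: derivable_within_continuous => r; rewrite in_itv /= => rs.
  by case: (H _ (sub r rs)).
by rewrite E subr0 normrM (ger0_norm s0) ler_wpM2r // HK // sub.
Qed.

Lemma taylor2 (h dh ddh : R -> R) (t K : R) : 0 <= t -> 0 <= K ->
  (forall s, 0 <= s <= t -> is_derive s 1 h (dh s)) ->
  (forall s, 0 <= s <= t -> is_derive s 1 dh (ddh s)) ->
  (forall s, 0 <= s <= t -> `|ddh s - ddh 0| <= K * s) ->
  `|h t - h 0 - t * dh 0 - t ^+ 2 / 2 * ddh 0| <= K * t ^+ 3.
Proof.
move=> t0 K0 H1 H2 H3.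
have tt : 0 <= t <= t by rewrite lexx t0.
have B1 s : 0 <= s <= t -> `|dh s - dh 0 - s * ddh 0| <= K * t ^+ 2.
  move=> /andP[s0 st].
  have := @mean_bound (fun s => dh s - s * ddh 0) (fun s => ddh s - ddh 0) t (K * t).
  move=> /(_ _ _ s) H; have {}H : `|(dh s - s * ddh 0) - (dh 0 - 0 * ddh 0)| <= K * t * s.
    apply: H => [r rt|r rt|]; last by rewrite s0.
      have d1 := is_deriveB (H2 r rt) (is_derive_mulf (is_derive_id r 1) (is_derive_cst (ddh 0) r 1)).
      by apply: (is_derive_eq d1); rewrite mul1r mulr0 addr0.
    rewrite (le_trans (H3 r rt)) // ler_wpM2l //; by case/andP: rt.
  have -> : dh s - dh 0 - s * ddh 0 = (dh s - s * ddh 0) - (dh 0 - 0 * ddh 0) by ring.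
  by rewrite (le_trans H) // expr2 mulrA ler_wpM2l // mulr_ge0.
have := @mean_bound (fun s => h s - s * dh 0 - s * s * (ddh 0 / 2))
  (fun s => dh s - dh 0 - s * ddh 0) t (K * t ^+ 2).
move=> /(_ _ B1 t tt) H.
have -> : h t - h 0 - t * dh 0 - t ^+ 2 / 2 * ddh 0 =
  (h t - t * dh 0 - t * t * (ddh 0 / 2)) - (h 0 - 0 * dh 0 - 0 * 0 * (ddh 0 / 2)).
  by field.
have -> : K * t ^+ 3 = K * t ^+ 2 * t by ring.
apply: H => s st.
have d0 := is_derive_id s (1 : R).
have d1 := is_derive_mulf d0 (is_derive_cst (dh 0) s 1).
have d2 := is_derive_mulf (is_derive_mulf d0 d0) (is_derive_cst (ddh 0 / 2) s 1).
apply: (is_derive_eq (is_deriveB (is_deriveB (H1 s st) d1) d2)).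
by rewrite /=; field.
Qed.

(** Only increments from time 0 enter the Taylor bound, and this class is closed
    under sums and products, with explicit constants. *)
Definition lip (t : R) (h : R -> R) (al be : R) : Prop :=
  forall s, 0 <= s <= t -> `|h s| <= al /\ `|h s - h 0| <= be * s.

Lemma lipM t h1 h2 a1 b1 a2 b2 : 0 <= t -> lip t h1 a1 b1 -> lip t h2 a2 b2 ->
  lip t (fun s => h1 s * h2 s) (a1 * a2) (b1 * a2 + a1 * b2).
Proof.
move=> t0 H1 H2 s st; have [A1 B1] := H1 s st; have [A2 B2] := H2 s st.
have [A0 _] := H1 0 (introT andP (conj (lexx 0) t0)).
split; first by rewrite normrM ler_pM.
have -> : h1 s * h2 s - h1 0 * h2 0 = (h1 s - h1 0) * h2 s + h1 0 * (h2 s - h2 0) by ring.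
rewrite (le_trans (ler_normD _ _)) // !normrM mulrDl lerD //.
  by rewrite mulrAC ler_pM.
by rewrite -mulrA ler_pM.
Qed.

Lemma lipD t h1 h2 a1 b1 a2 b2 : lip t h1 a1 b1 -> lip t h2 a2 b2 ->
  lip t (fun s => h1 s + h2 s) (a1 + a2) (b1 + b2).
Proof.
move=> H1 H2 s st; have [A1 B1] := H1 s st; have [A2 B2] := H2 s st.
split; first by rewrite (le_trans (ler_normD _ _)) // lerD.
by rewrite opprD addrACA (le_trans (ler_normD _ _)) // mulrDl lerD.
Qed.

Lemma lip_sum t m (h : 'I_m -> R -> R) al be :
  (forall i, lip t (h i) al be) -> lip t (fun s => \sum_i h i s) (m%:R * al) (m%:R * be).
Proof.
move=> H s st; split.
  rewrite (le_trans (ler_norm_sum _ _ _)) // (le_trans (ler_sum _ (fun i _ => (H i s st).1))) //.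
  by rewrite sumr_const card_ord mulr_natl.
rewrite -sumrB (le_trans (ler_norm_sum _ _ _)) // (le_trans (ler_sum _ (fun i _ => (H i s st).2))) //.
by rewrite sumr_const card_ord -mulrA mulr_natl.
Qed.

Lemma lip_derive (t : R) (h dh : R -> R) (al be : R) :
  (forall s, 0 <= s <= t -> is_derive s 1 h (dh s)) ->
  (forall s, 0 <= s <= t -> `|h s| <= al) ->
  (forall s, 0 <= s <= t -> `|dh s| <= be) -> lip t h al be.
Proof. by move=> H A B s st; split; [exact: A|exact: mean_bound H B s st]. Qed.

End MeanValue.

Section NearBound.
Context {R : realType} {n : nat} {M : smooth_manifold R n}.

Lemma near_bound (I : finType) (h : I -> M -> R) q : (forall i, smooth_at (h i) q) ->
  exists2 C, 0 < C & \forall p \near q, forall i, `|h i p| <= C.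
Proof.
move=> Sh; exists (1 + \sum_i `|h i q|); first by rewrite ltr_pwDl // sumr_ge0.
apply: near_forall => i.
have := smooth_at_cvg (Sh i) => /cvgr_norm_lt H.
have L : `|h i q| < 1 + \sum_i `|h i q|.
  by rewrite (bigD1 i) //= addrCA ltrDl ltr_pwDl // sumr_ge0.
by apply: filterS (H _ L) => p /ltW.
Qed.

End NearBound.

Lemma sqr_sum1_le1 {R : realType} (I : finType) (v : I -> R) :
  \sum_i v i ^+ 2 = 1 -> forall j, `|v j| <= 1.
Proof.
move=> E j; rewrite -[leRHS]sqrtr1 -sqrtr_sqr ler_sqrt // -E (bigD1 j) //= lerDl.
by apply: sumr_ge0 => i _; rewrite sqr_ge0.
Qed.

Section Expansion.
Context {R : realType} {n k : nat} {M : smooth_manifold R n}.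
Variable S : subriemannian M k.
Variables (q : M) (U : set M) (X : 'I_k -> vfield M) (f : M -> R).
Hypotheses (oU : open U) (Uq : U q) (sX : forall i, smooth_vfield U (X i)).
Hypothesis onX : forall p, U p -> orthonormal_basis S p (X ^~ p).
Hypothesis Sf : smooth_at f q.

Local Notation c := (chart_at q).
Local Notation cf a := (coord_field (chart_at q) (basis_vec a)).

(** First and second derivatives of f along the flow, as functions on the
    cotangent bundle. *)
Definition flow_d1 (p : M) (l : 'cV[R]_n) : R :=
  \sum_j pairing l (X j p) * vact (X j) f p.

Definition flow_d2 (p : M) (l : 'cV[R]_n) : R :=
  \sum_j ((\sum_i pairing l (X i p) * pairing l (bracket (X i) (X j) p)) * vact (X j) f p +
           pairing l (X j p) * \sum_i pairing l (X i p) * vact (X i) (vact (X j) f) p).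

Definition cov_size (l : 'cV[R]_n) : R := \sum_a `|l a 0|.

Let SX p j : U p -> smooth_vat (X j) p.
Proof. by move=> Up; have /(smooth_vfieldP _ oU) := sX j; apply. Qed.

Let ac : atlas c := chart_at_atlas q.
Let cq : cdom c q := chart_at_dom q.

(** C bounds all the functions that occur in the first three derivatives of f
    along the flow; the covectors are measured in the coordinate frame [cf]. *)
Definition good (C : R) (p : M) : Prop :=
  [/\ [/\ U p, cdom c p & smooth_at f p],
   [/\ forall j, smooth_at (vact (X j) f) p,
      forall ij, smooth_at (vact (X ij.1) (vact (X ij.2) f)) p,
      forall jb, `|vact (X jb.1) (chart_coord c jb.2) p| <= C
    & forall iab, `|vact (bracket (X iab.1) (cf iab.2.1)) (chart_coord c iab.2.2) p| <= C] &
  [/\ forall ijb, `|vact (bracket (X ijb.1) (X ijb.2.1)) (chart_coord c ijb.2.2) p| <= C,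
      forall lijb, `|vact (bracket (X lijb.1) (bracket (X lijb.2.1) (X lijb.2.2.1)))
                       (chart_coord c lijb.2.2.2) p| <= C,
      forall j, `|vact (X j) f p| <= C,
      forall ij, `|vact (X ij.1) (vact (X ij.2) f) p| <= C
    & forall lij, `|vact (X lij.1) (vact (X lij.2.1) (vact (X lij.2.2) f)) p| <= C]].

Lemma near_good : exists2 C, 1 <= C & \forall p \near q, good C p.
Proof.
have nU : \forall p \near q, U p by exact: open_nbhs_nbhs.
have Sc b : smooth_at (chart_coord c b) q by exact: smooth_at_coord.
have Sd a : smooth_vat (cf a) q by exact: smooth_coord_field.
have SXq j : smooth_vat (X j) q by exact: SX.
have SXX i j : smooth_vat (bracket (X i) (X j)) q by exact: smooth_bracket.
have S1 j : smooth_at (vact (X j) f) q by exact: smooth_vact.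
have S2 ij : smooth_at (vact (X ij.1) (vact (X ij.2) f)) q by exact: smooth_vact.
have [C1 C10 H1] := @near_bound _ _ _ _ (fun jb : 'I_k * 'I_n => vact (X jb.1) (chart_coord c jb.2)) q
  (fun jb => smooth_vact (SXq _) (Sc _)).
have [C2 C20 H2] := @near_bound _ _ _ _ (fun iab : 'I_k * ('I_n * 'I_n) =>
  vact (bracket (X iab.1) (cf iab.2.1)) (chart_coord c iab.2.2)) q
  (fun jb => smooth_vact (smooth_bracket (SXq _) (Sd _)) (Sc _)).
have [C3 C30 H3] := @near_bound _ _ _ _ (fun ijb : 'I_k * ('I_k * 'I_n) =>
  vact (bracket (X ijb.1) (X ijb.2.1)) (chart_coord c ijb.2.2)) q
  (fun jb => smooth_vact (SXX _ _) (Sc _)).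
have [C4 C40 H4] := @near_bound _ _ _ _ (fun ijb : 'I_k * ('I_k * ('I_k * 'I_n)) =>
  vact (bracket (X ijb.1) (bracket (X ijb.2.1) (X ijb.2.2.1))) (chart_coord c ijb.2.2.2)) q
  (fun jb => smooth_vact (smooth_bracket (SXq _) (SXX _ _)) (Sc _)).
have [C5 C50 H5] := near_bound S1.
have [C6 C60 H6] := near_bound S2.
have [C7 C70 H7] := @near_bound _ _ _ _ (fun lij : 'I_k * ('I_k * 'I_k) =>
  vact (X lij.1) (vact (X lij.2.1) (vact (X lij.2.2) f))) q
  (fun lij => smooth_vact (SXq _) (S2 lij.2)).
have N1 : \forall p \near q, forall j, smooth_at (vact (X j) f) p.
  by apply: near_forall => j; exact: smooth_at_near.
have N2 : \forall p \near q, forall ij, smooth_at (vact (X ij.1) (vact (X ij.2) f)) p.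
  by apply: near_forall => j; exact: smooth_at_near.
exists (1 + C1 + C2 + C3 + C4 + C5 + C6 + C7); first by lra.
have F := near_and (near_and (near_and nU (near_cdom cq)) (near_and (smooth_at_near Sf) N1))
  (near_and (near_and N2 (near_and H1 H2)) (near_and (near_and H3 H4) (near_and (near_and H5 H6) H7))).
apply: filterS F => p [[[Up cp] [Sp S1p]] [[S2p [B1 B2]] [[B3 B4] [[B5 B6] B7]]]].
split; [by split|split|split].
- exact: S1p.
- exact: S2p.
- by move=> i; apply: le_trans (B1 i) _; lra.
- by move=> i; apply: le_trans (B2 i) _; lra.
- by move=> i; apply: le_trans (B3 i) _; lra.
- by move=> i; apply: le_trans (B4 i) _; lra.
- by move=> i; apply: le_trans (B5 i) _; lra.
- by move=> i; apply: le_trans (B6 i) _; lra.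
- by move=> i; apply: le_trans (B7 i) _; lra.
Qed.

Lemma pairing_size (l : 'cV[R]_n) p Z C : cdom c p ->
  (forall b, `|vact Z (chart_coord c b) p| <= C) ->
  `|pairing l (Z p)| <= C * \sum_a `|pairing l (cf a p)|.
Proof.
move=> cp H; rewrite (tangent_decomp (Z p) ac cp) pairing_sumr.
rewrite (le_trans (ler_norm_sum _ _ _)) // mulr_sumr; apply: ler_sum => b _.
by rewrite pairingZr normrM ler_wpM2r // H.
Qed.

Lemma quad_le (m2 m1 m0 L : R) : 0 <= m1 -> 0 <= m0 -> 1 <= L ->
  m2 * L ^+ 2 + m1 * L + m0 <= (m2 + m1 + m0) * L ^+ 2.
Proof.
move=> m1p m0p L1.
have L2 : L <= L ^+ 2 by rewrite expr2 ler_peMr // (le_trans ler01).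
rewrite !mulrDl !lerD // ?ler_wpM2l // -[leLHS]mulr1 ler_wpM2l //.
exact: le_trans L1 L2.
Qed.

Section Curve.
Variables (C : R) (C1 : 1 <= C) (gamma : R -> M * 'cV[R]_n) (t : R).
Hypothesis Hg : forall s, 0 <= s <= t -> hamilton_at S gamma s.

Local Notation x s := (gamma s).1.
Local Notation mom s Z := (pairing (gamma s).2 (Z (x s))).
Local Notation u j s := (pairing (gamma s).2 (X j (x s))).

Let C0 : 0 <= C. Proof. exact: le_trans C1. Qed.

Lemma sum_antisym (v : 'I_k -> R) (b : 'I_k -> 'I_k -> R) :
  (forall i j, b i j = - b j i) -> \sum_j v j * (\sum_i v i * b i j) = 0.
Proof.
move=> bA; set T := LHS; suff : T = - T by lra.
rewrite {1}/T; under eq_bigr do rewrite mulr_sumr.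
rewrite exchange_big /= -sumrN; apply: eq_bigr => i _.
rewrite mulr_sumr -sumrN; apply: eq_bigr => j _; rewrite (bA i j); ring.
Qed.

(** The derivative of the energy is the sum of u_i u_j <l, [X_i, X_j]>, which
    vanishes by antisymmetry. *)
Lemma energy_conserved s : 0 <= s <= t -> (forall r, 0 <= r <= s -> U (x r)) ->
  \sum_j u j 0 ^+ 2 = 1 -> \sum_j u j s ^+ 2 = 1.
Proof.
move=> /andP[s0 st] HU E0.
have := @mean_bound _ (fun r => 2^-1 * \sum_j u j r ^+ 2) (fun=> 0) s 0.
move=> /(_ _ _ s); rewrite s0 lexx mul0r E0 => H.
suff : `|2^-1 * \sum_j u j s ^+ 2 - 2^-1 * 1| <= 0.
  by rewrite normr_le0 subr_eq0 => /eqP; lra.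
apply: H => // [r /andP[r0 rs]|r _]; last by rewrite normr0.
have rt : 0 <= r <= t by rewrite r0 (le_trans rs).
have Ur : U (x r) by apply: HU; rewrite r0.
apply: is_derive_eq.
  apply: half_sum_sqr => j.
  exact: (is_derive_momentum oU sX onX (Hg rt) Ur (SX j Ur)).
by apply: sum_antisym => i j; rewrite bracketC pairingNr.
Qed.

Lemma base_speed phi s : 0 <= s <= t ->
  (forall r, 0 <= r <= s -> [/\ U (x r), smooth_at phi (x r), \sum_j u j r ^+ 2 = 1
      & forall j, `|vact (X j) phi (x r)| <= C]) ->
  `|phi (x s) - phi (x 0)| <= k%:R * C * s.
Proof.
move=> /andP[s0 st] H.
have := @mean_bound _ (fun r => phi (x r)) (fun r => \sum_j u j r * vact (X j) phi (x r)) s (k%:R * C).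
apply; last by rewrite s0 lexx.
  move=> r rs; have [Ur Sr _ _] := H r rs.
  have rt : 0 <= r <= t by case/andP: rs => -> /le_trans; apply.
  exact: (is_derive_base onX (Hg rt) Ur Sr).
move=> r rs; have [Ur _ Er Br] := H r rs.
rewrite (le_trans (ler_norm_sum _ _ _)) //.
rewrite mulr_natl -[X in _ *+ X]card_ord -sumr_const ler_sum // => j _.
by rewrite normrM -[leRHS]mul1r ler_pM //; exact: (sqr_sum1_le1 Er j).
Qed.

Hypothesis Hgood : forall s, 0 <= s <= t -> good C (x s).
Hypothesis E0 : \sum_j u j 0 ^+ 2 = 1.

Let HU s : 0 <= s <= t -> U (x s). Proof. by move=> /Hgood [[]]. Qed.
Let Hc s : 0 <= s <= t -> cdom c (x s). Proof. by move=> /Hgood [[]]. Qed.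

Let energy s : 0 <= s <= t -> \sum_j u j s ^+ 2 = 1.
Proof.
move=> st; apply: energy_conserved => // r /andP[r0 rs]; apply: HU.
by rewrite r0 (le_trans rs) //; case/andP: st.
Qed.

Let u1 s j : 0 <= s <= t -> `|u j s| <= 1.
Proof. by move=> st; exact: sqr_sum1_le1 (energy st) j. Qed.

Let dmom Z s : 0 <= s <= t -> smooth_vat Z (x s) ->
  is_derive s 1 (fun r => mom r Z) (\sum_j u j s * mom s (bracket (X j) Z)).
Proof. by move=> st SZ; exact: (is_derive_momentum oU sX onX (Hg st) (HU st)). Qed.

Let size s := \sum_a `|mom s (cf a)|.

Let size0 s : 0 <= size s. Proof. exact: sumr_ge0. Qed.

Let wsum (v : 'I_k -> R) (B : R) s : 0 <= s <= t -> (forall j, `|v j| <= B) ->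
  `|\sum_j u j s * v j| <= k%:R * B.
Proof.
move=> st H; rewrite (le_trans (ler_norm_sum _ _ _)) //.
rewrite mulr_natl -[X in _ *+ X]card_ord -sumr_const ler_sum // => j _.
by rewrite normrM -[leRHS]mul1r ler_pM // u1.
Qed.

(** The components of the covector have derivatives bounded by their own size,
    so the largest size on a short interval is at most the initial one plus half
    of itself. *)
Lemma size_bound : n%:R * (k%:R * C) * t <= 2^-1 -> forall s, 0 <= s <= t ->
  size s <= 2 * size 0.
Proof.
move=> tsmall s st.
have t0 : 0 <= t by case/andP: st => /le_trans; apply.
have dcf a r : 0 <= r <= t -> is_derive r 1 (fun r => mom r (cf a))
    (\sum_j u j r * mom r (bracket (X j) (cf a))).
  by move=> rt; apply: dmom => //; apply: smooth_coord_field => //; exact: Hc.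
have dabs a r : 0 <= r <= t -> {for r, continuous (fun r => `|mom r (cf a)|)}.
  move=> rt; have [d _] := dcf a r rt.
  apply: (@continuous_comp _ _ _ (fun r => mom r (cf a)) Num.norm).
    by apply/differentiable_continuous/derivable1_diffP.
  exact: norm_continuous.
have cont : {within `[0, t], continuous size}.
  apply: continuous_in_subspaceT => r; rewrite inE /= in_itv /= => rt.
  rewrite /size.
  by apply: cvg_big => [|a _]; [exact: add_continuous|exact: dabs].
have [m mt Hm] := EVT_max t0 cont.
have {}mt : 0 <= m <= t by move: mt; rewrite in_itv.
have step a r : 0 <= r <= t -> `|mom r (cf a) - mom 0 (cf a)| <= k%:R * (C * size m) * t.
  move=> rt; apply: (@le_trans _ _ (k%:R * (C * size m) * r)); last first.
    by rewrite ler_wpM2l ?mulr_ge0 //; case/andP: rt.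
  apply: (mean_bound (dcf a) _ rt) => r' rt'; apply: wsum => // j.
    apply: (@le_trans _ _ (C * size r')).
    apply: (pairing_size _ (Hc rt')) => b; have [_ [_ _ _ H] _] := Hgood rt'.
    exact: (H (j, (a, b))).
  by rewrite ler_wpM2l // Hm // in_itv.
apply: (@le_trans _ _ (size m)); first by rewrite Hm // in_itv.
have : size m <= size 0 + n%:R * (k%:R * (C * size m) * t).
  rewrite -lerBlDl /size -sumrB mulr_natl -[X in _ *+ X]card_ord -sumr_const.
  by apply: ler_sum => a _; rewrite (le_trans _ (step a m mt)) // lerB_dist.
have -> : n%:R * (k%:R * (C * size m) * t) = (n%:R * (k%:R * C) * t) * size m by ring.
have : n%:R * (k%:R * C) * t * size m <= 2^-1 * size m by rewrite ler_wpM2r.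
by lra.
Qed.

Hypothesis tsmall : n%:R * (k%:R * C) * t <= 2^-1.
Hypothesis t0 : 0 <= t.

Local Notation L := (1 + size 0).

Let L1 : 1 <= L. Proof. by rewrite lerDl. Qed.

Let mom_bound Z s : 0 <= s <= t -> (forall b, `|vact Z (chart_coord c b) (x s)| <= C) ->
  `|mom s Z| <= 2 * C * L.
Proof.
move=> st H; rewrite (le_trans (pairing_size _ (Hc st) H)) //.
rewrite mulrAC [leRHS]mulrC ler_wpM2l // (le_trans (size_bound tsmall st)) //.
by rewrite ler_wpM2l // lerDr.
Qed.

Let SXs s j : 0 <= s <= t -> smooth_vat (X j) (x s).
Proof. by move=> st; exact: SX (HU st). Qed.

Let SXX s i j : 0 <= s <= t -> smooth_vat (bracket (X i) (X j)) (x s).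
Proof. by move=> st; apply: smooth_bracket; exact: SXs. Qed.

Let K := 2 * C.
Let K0 : 0 <= K. Proof. by rewrite mulr_ge0. Qed.

Let lip_u j : lip t (fun s => u j s) 1 (k%:R * (K * L)).
Proof.
apply: (lip_derive (fun s st => dmom st (SXs j st))) => s st; first exact: u1.
apply: wsum => // i; apply: mom_bound => // b.
by have [_ _ [H _ _ _ _]] := Hgood st; exact: (H (i, (j, b))).
Qed.

Let lip_b i j : lip t (fun s => mom s (bracket (X i) (X j))) (K * L) (k%:R * (K * L)).
Proof.
apply: (lip_derive (fun s st => dmom st (SXX i j st))) => s st.
  apply: mom_bound => // b.
  by have [_ _ [H _ _ _ _]] := Hgood st; exact: (H (i, (j, b))).
apply: wsum => // l; apply: mom_bound => // b.
by have [_ _ [_ H _ _ _]] := Hgood st; exact: (H (l, (i, (j, b)))).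
Qed.

Let dbase phi s : 0 <= s <= t -> smooth_at phi (x s) ->
  is_derive s 1 (fun r => phi (x r)) (\sum_j u j s * vact (X j) phi (x s)).
Proof. by move=> st Sphi; exact: (is_derive_base onX (Hg st) (HU st) Sphi). Qed.

Let lip_F j : lip t (fun s => vact (X j) f (x s)) C (k%:R * C).
Proof.
apply: (@lip_derive _ _ _ (fun s => \sum_i u i s * vact (X i) (vact (X j) f) (x s))) => s st.
- by apply: dbase => //; have [_ [H _ _ _] _] := Hgood st; exact: H.
- by have [_ _ [_ _ H _ _]] := Hgood st; exact: H.
- by apply: wsum => // i; have [_ _ [_ _ _ H _]] := Hgood st; exact: (H (i, j)).
Qed.

Let lip_FF i j : lip t (fun s => vact (X i) (vact (X j) f) (x s)) C (k%:R * C).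
Proof.
apply: (@lip_derive _ _ _ (fun s => \sum_l u l s * vact (X l) (vact (X i) (vact (X j) f)) (x s))) => s st.
- by apply: dbase => //; have [_ [_ H _ _] _] := Hgood st; exact: (H (i, j)).
- by have [_ _ [_ _ _ H _]] := Hgood st; exact: (H (i, j)).
- by apply: wsum => // l; have [_ _ [_ _ _ _ H]] := Hgood st; exact: (H (l, (i, j))).
Qed.

Let is_derive_d1 s : 0 <= s <= t ->
  is_derive s 1 (fun r => flow_d1 (x r) (gamma r).2) (flow_d2 (x s) (gamma s).2).
Proof.
move=> st; apply: is_derive_sumf => j; apply: is_derive_mulf.
  exact: dmom (SXs j st).
by apply: dbase => //; have [_ [H _ _ _] _] := Hgood st; exact: H.
Qed.

(** What results from combining [lip_u], [lip_b], [lip_F] and [lip_FF]; the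
    covector enters at most quadratically, whence the factor L^2 in [lip_d2]. *)
Definition expansion_const : R :=
  k%:R * (k%:R * (k%:R * K * K + k%:R * K) * C + k%:R * K * (k%:R * C) +
          (k%:R * K * (k%:R * C) + k%:R * (k%:R * K * C + k%:R * C))).

Lemma lip_d2 : exists al, lip t (fun s => flow_d2 (x s) (gamma s).2) al (expansion_const * L ^+ 2).
Proof.
have H j := lipD (lipM t0 (lip_sum (fun i => lipM t0 (lip_u i) (lip_b i j))) (lip_F j))
  (lipM t0 (lip_u j) (lip_sum (fun i => lipM t0 (lip_u i) (lip_FF i j)))).
have {}H := lip_sum H.
eexists => s st; have [H1 H2] := H s st; split; first exact: H1.
apply: (le_trans H2); rewrite ler_wpM2r //; first by case/andP: st.
rewrite /expansion_const -[in leRHS]mulrA ler_wpM2l //.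
have -> : k%:R * (k%:R * (K * L) * (K * L) + 1 * (k%:R * (K * L))) * C +
    k%:R * (1 * (K * L)) * (k%:R * C) +
    (k%:R * (K * L) * (k%:R * (1 * C)) + 1 * (k%:R * (k%:R * (K * L) * C + 1 * (k%:R * C)))) =
  (k%:R * (k%:R * K * K) * C) * L ^+ 2 +
  (k%:R * (k%:R * K) * C + k%:R * K * (k%:R * C) + k%:R * K * (k%:R * C) + k%:R * (k%:R * K * C)) * L
  + k%:R * (k%:R * C) by ring.
apply: le_trans (quad_le _ _ _ L1) _; rewrite ?addr_ge0 ?mulr_ge0 //.
by rewrite le_eqVlt; apply/orP; left; apply/eqP; ring.
Qed.

Lemma curve_expansion :
  `|f (x t) - f (x 0) - t * flow_d1 (x 0) (gamma 0).2 - t ^+ 2 / 2 * flow_d2 (x 0) (gamma 0).2|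
  <= expansion_const * L ^+ 2 * t ^+ 3.
Proof.
have [al H] := lip_d2.
apply: (@taylor2 _ (fun s => f (x s)) (fun s => flow_d1 (x s) (gamma s).2)
   (fun s => flow_d2 (x s) (gamma s).2)) => //.
- rewrite mulr_ge0 ?exprn_ge0 ?addr_ge0 //.
  by rewrite /expansion_const !(mulr_ge0, addr_ge0).
- by move=> s st; apply: dbase => //; have [[_ _ ?] _ _] := Hgood st.
- by move=> s st; have [] := H s st.
Qed.

End Curve.

(** The projection of a curve of energy 1/2 has bounded speed, so for a time t0
    independent of l it stays in a neighbourhood of q where the estimates are
    uniform.  As the bound holds for every solution curve, it applies to the one
    selected by [sr_exp]. *)
Lemma flow_expansion : exists C t0, [/\ 0 <= C, 0 < t0 & forall l a b gamma t,
  hamiltonian S q l = 2^-1 -> a < 0 < b -> hamilton_curve S a b gamma ->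
  gamma 0 = (q, l) -> 0 < t < b -> t <= t0 ->
  `|f (gamma t).1 - f q - t * flow_d1 q l - t ^+ 2 / 2 * flow_d2 q l|
    <= C * (1 + cov_size l) ^+ 2 * t ^+ 3].
Proof.
have [C C1 HC] := near_good.
have C0 : 0 < C by exact: lt_le_trans ltr01 C1.
have /nbhs_ballP [rho /= rho0 Hrho] := near_and (near_crng cq) (near_cinv cq HC).
have Hb y : `|y - cmap c q| < rho -> crng c y /\ good C (cinv c y).
  by move=> yr; apply: Hrho; rewrite -ball_normE /ball_ /= distrC.
pose B := [set p | cdom c p /\ `|cmap c p - cmap c q| < rho].
pose K := cinv c @` [set y | `|y - cmap c q| <= rho / 2].
have rho2 : rho / 2 < rho by rewrite ltr_pdivrMr // ltr_pMr // ltr1n.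
have Bgood p : B p -> good C p.
  by move=> [cp pr]; have [_] := Hb _ pr; rewrite cmapK.
have KB : K `<=` B.
  move=> _ [y yr <-]; have [cy _] := Hb y (le_lt_trans yr rho2).
  by split; [exact: cinv_dom|rewrite cinvK // (le_lt_trans yr)].
have oB : open B.
  rewrite openE => p [cp pr].
  have : \forall y \near cmap c p, `|y - cmap c q| < rho.
    have : {for cmap c p, continuous (fun y : 'rV[R]_n => `|y - cmap c q|)}.
      apply: (@continuous_comp _ _ _ (fun y : 'rV[R]_n => y - cmap c q) Num.norm).
        by apply: differentiable_continuous; apply: differentiableB.
      exact: norm_continuous.
    by move=> H; exact: (H [set r | r < rho] (lt_nbhsl pr)).
  move=> /(near_cmap cp) H.
  by apply: filterS (near_and (near_cdom cp) H) => p' [].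
have cK : closed K.
  apply: closed_chart_ball; first by rewrite divr_gt0.
  by move=> y yr; have [] := Hb y (le_lt_trans yr rho2).
pose A := k%:R * C + 1.
have A0 : 0 < A by rewrite ltr_wpDl // mulr_ge0 // ltW.
pose t0 := Num.min (rho / 2 / A) (2^-1 / (n%:R * A + 1)).
have nA0 : 0 < n%:R * A + 1 by rewrite ltr_wpDl // mulr_ge0 // ltW.
exists (expansion_const C), t0; split.
- by rewrite /expansion_const !(mulr_ge0, addr_ge0) // ltW.
- by rewrite lt_min !divr_gt0.
move=> l a b gamma t El /andP[a0 b0] Hg g0 /andP[tp tb] tt0.
have t0' : 0 <= t by exact: ltW.
have Hgt s : 0 <= s <= t -> hamilton_at S gamma s.
  by move=> /andP[s0 st]; apply: Hg; rewrite (lt_le_trans a0) //= (le_lt_trans st).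
have E0 : \sum_j pairing (gamma 0).2 (X j (gamma 0).1) ^+ 2 = 1.
  have := El; rewrite (hamiltonianE _ (onX Uq)) g0 /=; lra.
have xB : forall s, 0 <= s <= t -> B (gamma s).1.
  apply: (@confinement _ _ (fun s => (gamma s).1) K B t cK oB KB).
  - by move=> r rt; exact: hamilton_at_continuous (Hgt r rt).
  - move=> r /andP[r0 rt] HB s' /andP[s'0 s'r].
    have s't : s' <= t by rewrite ltW // (lt_le_trans s'r).
    have HBs r' : 0 <= r' <= s' -> B (gamma r').1.
      by move=> /andP[r'0 r's]; apply: HB; rewrite r'0 (le_lt_trans r's).
    have En r' : 0 <= r' <= s' -> \sum_j pairing (gamma r').2 (X j (gamma r').1) ^+ 2 = 1.
      move=> /andP[r'0 r's]; apply: (energy_conserved Hgt) => //.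
        by rewrite r'0 (le_trans r's).
      move=> r'' /andP[r''0 r''r]; have r''s : 0 <= r'' <= s' by rewrite r''0 (le_trans r''r).
      by have [[]] := Bgood _ (HBs r'' r''s).
    have [cs sr] : B (gamma s').1 by apply: HBs; rewrite s'0 lexx.
    exists (cmap c (gamma s').1); last exact: cmapK.
    rewrite /= [leLHS]/Num.Def.normr /= mx_normrE.
    apply/bigmax_leP; split; first by rewrite divr_ge0 // ltW.
    move=> [i a'] _ /=; rewrite (ord1 i) !mxE.
    have := @base_speed C gamma t Hgt (chart_coord c a') s'.
    rewrite g0 /= s'0 s't => H; apply: le_trans (H _ _) _ => //.
      move=> r' r's; have Br := HBs r' r's; have [[Ur cr _] [_ _ V _] _] := Bgood _ Br.
      split=> //; [exact: smooth_at_coord|exact: En|].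
      by move=> j; exact: (V (j, a')).
    apply: (@le_trans _ _ (A * t0)).
      apply: ler_pM => //; first by rewrite mulr_ge0 // ltW.
        by rewrite lerDl.
      exact: le_trans s't tt0.
    by rewrite mulrC -ler_pdivlMr // ge_min lexx.
  - rewrite g0 /=; exists (cmap c q); last exact: cmapK.
    by rewrite /= subrr normr0 divr_ge0 // ltW.
have tsm : n%:R * (k%:R * C) * t <= 2^-1.
  apply: (@le_trans _ _ ((n%:R * A + 1) * t0)).
    apply: ler_pM => //; first by rewrite !mulr_ge0 // ltW.
    by rewrite ler_wpDr // ler_wpM2l // lerDl.
  by rewrite mulrC -ler_pdivlMr // ge_min lexx orbT.
have := @curve_expansion C C1 gamma t Hgt (fun s st => Bgood _ (xB s st)) E0 tsm t0'.
rewrite g0 /= /cov_size.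
by under [X in (1 + X) ^+ 2]eq_bigr do rewrite coord_field_chart_at pairing_basis.
Qed.

End Expansion.

(** * Existence of Hamiltonian curves *)

Section Geometric.
Context {R : realType}.

Lemma geometric_limit (u : nat -> R) (d : R) :
  (forall n, `|u n.+1 - u n| <= d / 2 ^+ n) ->
  exists l, forall n, `|u n - l| <= 2 * d / 2 ^+ n.
Proof.
move=> H; pose a n := u n - 2 * d / 2 ^+ n; pose b n := u n + 2 * d / 2 ^+ n.
have half n : 2 * d / 2 ^+ n.+1 = d / 2 ^+ n by rewrite exprS invfM mulrACA mulfV ?mul1r.
have dbl n : 2 * d / 2 ^+ n = d / 2 ^+ n + d / 2 ^+ n by rewrite mulrDl mul1r mulrDl.
have aS n : a n <= a n.+1.
  by rewrite /a half dbl; have := H n; rewrite ler_norml => /andP[]; lra.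
have bS n : b n.+1 <= b n.
  by rewrite /b half dbl; have := H n; rewrite ler_norml => /andP[]; lra.
have aM : {homo a : i j / (i <= j)%N >-> i <= j}.
  by apply: homo_leq => // ? ? ?; exact: le_trans.
have bM i j : (i <= j)%N -> b j <= b i.
  move=> ij; rewrite -lerN2; move: i j ij.
  by apply: (@homo_leq _ (fun i => - b i) <=%R) => // [? ? ?|i]; [exact: le_trans|rewrite lerN2].
have ab n : a n <= b n.
  have := H n; rewrite /a /b => Hn; have : 0 <= d / 2 ^+ n by exact: le_trans Hn.
  by rewrite dbl; lra.
have amb i j : a i <= b j.
  by apply: (le_trans (aM _ _ (leq_maxl i j))); apply: (le_trans (ab _)); apply: bM; exact: leq_maxr.
have ub j : ubound (range a) (b j) by move=> _ [i _ <-].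
have hs : has_sup (range a) by split; [exists (a 0%N); exists 0%N|exists (b 0%N)].
exists (sup (range a)) => n.
have L1 : a n <= sup (range a) by apply: ub_le_sup; [case: hs|exists n].
have L2 : sup (range a) <= b n by apply: ge_sup; [case: hs|exact: ub].
by rewrite ler_norml; move: L1 L2; rewrite /a /b => L1 L2; apply/andP; split; lra.
Qed.

Lemma le_geometric (x y d : R) : (forall n : nat, x <= y + d / 2 ^+ n) -> x <= y.
Proof.
move=> H; apply/ler_addgt0Pr => e e0.
have [d0|d0] := leP d 0.
  by rewrite (le_trans (H 0%N)) // lerD2l expr0 divr1 (le_trans d0) // ltW.
pose n := Num.truncn (d / e).
apply: (le_trans (H n)); rewrite lerD2l ler_pdivrMr ?exprn_gt0 //.
have : d / e < n.+1%:R by rewrite truncnS_gt.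
rewrite ltr_pdivrMr // => /ltW /le_trans; apply; rewrite mulrC ler_wpM2l ?(ltW e0) //.
by rewrite -natrX ler_nat ltn_expl.
Qed.

End Geometric.

Section Primitive.
Context {R : realType}.
Notation mu := (@lebesgue_measure R).

Lemma exists_primitive (h : R -> R) (T : R) : continuous h ->
  exists G : R -> R, forall s, - T < s < T -> is_derive s 1 G (h s).
Proof.
move=> ch; exists (fun x => (\int[mu]_(t in [set` `[- T, x]]) (h t))%R).
move=> s /andP[s1 s2].
have ih : mu.-integrable [set` `[- T, T]] (EFin \o h).
  apply: continuous_compact_integrable; first exact: segment_compact.
  exact: continuous_subspaceT.
have [d E] := continuous_FTC1_closed s2 ih s1 (ch s).
exact: (DeriveDef d (etrans (esym (derive1E _ _)) E)).
Qed.

End Primitive.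

Section RowVectors.
Context {R : realType} {m : nat}.
Implicit Types v : 'rV[R]_m.

Lemma rV_norm_le v (K : R) : 0 <= K -> (forall j, `|v 0 j| <= K) -> `|v| <= K.
Proof.
move=> K0 H; rewrite [leLHS]/Num.Def.normr /= mx_normrE.
by apply/bigmax_leP; split=> // -[i j] _; rewrite (ord1 i) /=; exact: H.
Qed.

Lemma rV_norm_ge v j : `|v 0 j| <= `|v|.
Proof.
rewrite [leRHS]/Num.Def.normr /= mx_normrE.
exact: (le_bigmax _ (fun ij : 'I_1 * 'I_m => `|v ij.1 ij.2|) (0, j)).
Qed.

Lemma exists_primitive_rV (h : R -> 'rV[R]_m) (T : R) : continuous h ->
  exists G : R -> 'rV[R]_m, forall s, - T < s < T -> is_derive s 1 G (h s).
Proof.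
move=> ch.
have chj j : continuous (fun s => h s 0 j).
  move=> s; apply: (@continuous_comp _ _ _ h (fun v : 'rV[R]_m => v 0 j)); first exact: ch.
  exact: coord_continuous.
have /choice [G HG] j := exists_primitive T (chj j).
exists (fun s => \row_j G j s) => s sT; apply/is_derive_mxP => i j.
rewrite (ord1 i) (_ : (fun s => (\row_j G j s) 0 j) = G j); first exact: HG.
by apply/funext => r; rewrite mxE.
Qed.

Lemma mean_bound_rV (G g : R -> 'rV[R]_m) (T K : R) : 0 <= K ->
  (forall s, - T < s < T -> is_derive s 1 G (g s)) -> (forall s, `|g s| <= K) ->
  forall s r, - T < s < T -> - T < r < T -> `|G s - G r| <= K * `|s - r|.
Proof.
move=> K0 HG Hg s r; wlog rs : s r / r <= s.
  move=> W sT rT; have [|/ltW] := leP r s; first by move=> rs; exact: W.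
  by rewrite distrC [`|s - r|]distrC => sr; exact: W.
move=> /andP[s1 s2] /andP[r1 r2]; rewrite (ger0_norm (_ : 0 <= s - r)) ?subr_ge0 //.
apply: rV_norm_le => [|j]; first by rewrite mulr_ge0 // subr_ge0.
have inT c : r <= c <= s -> - T < c < T.
  by move=> /andP[rc cs]; rewrite (lt_le_trans r1) //= (le_lt_trans cs).
have dj c : r <= c <= s -> is_derive c 1 (fun s => G s 0 j) (g c 0 j).
  by move=> cI; apply: (is_derive_mxP _ _ _ _).1; exact: HG (inT c cI).
have [||c cI E] := @MVT_segment R (fun s => G s 0 j) (fun s => g s 0 j) r s rs.
- by move=> c; rewrite in_itv /= => /andP[rc cs]; apply: dj; rewrite !ltW.
- apply: derivable_within_continuous => c; rewrite in_itv /= => cI.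
  by case: (dj c cI).
rewrite !mxE E normrM (ger0_norm (_ : 0 <= s - r)) ?subr_ge0 // ler_wpM2r ?subr_ge0 //.
exact: le_trans (rV_norm_ge _ _) (Hg c).
Qed.

End RowVectors.

Section Picard.
Context {R : realType} {m : nat}.
Variables (F : 'rV[R]_m -> 'rV[R]_m) (z0 w : 'rV[R]_m) (r C L tau : R).
Hypotheses (r0 : 0 < r) (C0 : 0 <= C) (L0 : 0 <= L) (tau0 : 0 < tau).
Hypothesis FC : forall z, `|z - z0| <= r -> `|F z| <= C.
Hypothesis FL : forall z z', `|z - z0| <= r -> `|z' - z0| <= r -> `|F z - F z'| <= L * `|z - z'|.
Hypothesis w0 : `|w - z0| <= r / 2.
Hypotheses (tauC : C * tau <= r / 4) (tauL : L * tau <= 2^-1).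

Let clamp (s : R) := Num.max (- tau) (Num.min s tau).

Let clamp_id s : `|s| <= tau -> clamp s = s.
Proof. by rewrite ler_norml /clamp => /andP[s1 s2]; rewrite min_l // max_r. Qed.

Let clamp_le s : `|clamp s| <= tau.
Proof.
rewrite ler_norml /clamp le_max lexx /= ge_max ge_min lexx orbT andbT.
by rewrite (le_trans _ (ltW tau0)) // oppr_le0 ltW.
Qed.

Let clamp_lip s s' : `|clamp s - clamp s'| <= `|s - s'|.
Proof.
wlog ss : s s' / s' <= s.
  move=> W; have [|/ltW] := leP s' s; first exact: W.
  by rewrite (distrC (clamp s)) (distrC s); exact: W.
have t2 : - tau < tau by rewrite gtrN.
have cases x : [\/ x <= - tau /\ clamp x = - tau, - tau <= x <= tau /\ clamp x = x
    | tau <= x /\ clamp x = tau].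
  have [a1|a1] := leP x (- tau).
    by apply: Or31; split=> //; rewrite /clamp max_l // ge_min a1.
  have [a2|a2] := leP x tau.
    by apply: Or32; rewrite (ltW a1); split=> //; rewrite clamp_id // ler_norml (ltW a1).
  by apply: Or33; rewrite (ltW a2); split=> //; rewrite /clamp min_r ?max_r // ltW.
rewrite [leRHS]ger0_norm ?subr_ge0 // ler_norml.
by have [[a1 ->]|[/andP[a1 a2] ->]|[a1 ->]] := cases s;
   have [[b1 ->]|[/andP[b1 b2] ->]|[b1 ->]] := cases s'; apply/andP; split; lra.
Qed.

Let adm (z : R -> 'rV[R]_m) := continuous z /\ forall s, `|z s - z0| <= r.

Let adm_cont z : adm z -> continuous (F \o z).
Proof.
move=> [cz Dz] s; apply/cvgrPdist_le => e e0.
have L1 : 0 < L + 1 by rewrite ltr_wpDl.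
have := cz s => /cvgrPdist_le /(_ _ (divr_gt0 e0 L1)); apply: filterS => s' H.
rewrite /= (le_trans (FL (Dz _) (Dz _))) // (le_trans _ (_ : (L + 1) * (e / (L + 1)) <= e)) //.
  by rewrite ler_pM // lerDl.
by rewrite mulrC divfK ?gt_eqF.
Qed.

Let T := tau + 1.

Let clampT s : - T < clamp s < T.
Proof.
have := clamp_le s; rewrite ler_norml /T => /andP[a b].
by apply/andP; split; lra.
Qed.

Let zeroT : - T < 0 < T.
Proof. by have := clampT 0; rewrite clamp_id // normr0 ltW. Qed.

(** Picard-Lindelof, with the curves prolonged constantly outside of the time
    interval so that primitives are available on the whole line. *)
Lemma picard : exists z : R -> 'rV[R]_m, z 0 = w /\
  forall s, `|s| < tau -> `|z s - z0| <= r /\ is_derive s 1 z (F (z s)).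
Proof.
have /choice [prim Hprim] : forall h : R -> 'rV[R]_m, exists G : R -> 'rV[R]_m,
    continuous h -> forall s, - T < s < T -> is_derive s 1 G (h s).
  move=> h; have [ch|nch] := pselect (continuous h); last by exists h => /nch.
  by have [G HG] := exists_primitive_rV T ch; exists G.
pose next (z : R -> 'rV[R]_m) s := w + (prim (F \o z) (clamp s) - prim (F \o z) 0).
have dprim z : adm z -> forall s, - T < s < T -> is_derive s 1 (prim (F \o z)) (F (z s)).
  by move=> az; exact: Hprim (adm_cont az).
have next_lip z : adm z -> forall s s', `|next z s - next z s'| <= C * `|s - s'|.
  move=> az s s'; have [cz Dz] := az.
  have -> : next z s - next z s' = prim (F \o z) (clamp s) - prim (F \o z) (clamp s').
    by rewrite /next opprD addrACA subrr add0r opprB addrA subrK.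
  apply: le_trans (mean_bound_rV C0 (dprim z az) _ (clampT s) (clampT s')) _.
    by move=> s''; exact: FC.
  by rewrite ler_wpM2l.
have next_w z : adm z -> forall s, `|next z s - w| <= r / 4.
  move=> az s; rewrite /next addrC addKr.
  apply: le_trans (mean_bound_rV C0 (dprim z az) _ (clampT s) zeroT) _.
    by move=> s''; apply: FC; case: az.
  by rewrite subr0 (le_trans _ tauC) // ler_wpM2l.
have lip_cont (z : R -> 'rV[R]_m) : (forall s s', `|z s - z s'| <= C * `|s - s'|) -> continuous z.
  move=> H s; apply/cvgrPdist_le => e e0.
  have C1 : 0 < C + 1 by rewrite ltr_wpDl.
  near=> s'; rewrite (le_trans (H _ _)) // (le_trans _ (_ : (C + 1) * (e / (C + 1)) <= e)) //.
    rewrite ler_pM // ?lerDl //; near: s'.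
    by exists (e / (C + 1)) => /= [|x /ltW //]; rewrite divr_gt0.
  by rewrite mulrC divfK ?gt_eqF.
have r24 : r / 2 + r / 4 <= r.
  by rewrite [leRHS]splitr lerD2l ler_pM2l // lef_pV2 ?posrE // ler_nat.
have next_adm z : adm z -> adm (next z).
  move=> az; split; first exact: lip_cont (next_lip z az).
  move=> s; rewrite -(subrKA w) (le_trans (ler_normD _ _)) // (le_trans _ r24) //.
  by rewrite addrC lerD // next_w.
have next_contr z z' d : adm z -> adm z' -> (forall s, `|z s - z' s| <= d) ->
    forall s, `|next z s - next z' s| <= d / 2.
  move=> az az' Hd s.
  have d0 : 0 <= d by exact: le_trans (normr_ge0 _) (Hd 0).
  have -> : next z s - next z' s = (prim (F \o z) (clamp s) - prim (F \o z') (clamp s))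
      - (prim (F \o z) 0 - prim (F \o z') 0).
    by rewrite /next opprD addrACA subrr add0r opprB opprB addrACA [RHS]addrACA [- _ - _]addrC.
  have dG s' : - T < s' < T -> is_derive s' 1 (fun s => prim (F \o z) s - prim (F \o z') s)
      (F (z s') - F (z' s')).
    by move=> s'T; apply: is_deriveB; exact: dprim.
  apply: le_trans (mean_bound_rV (mulr_ge0 L0 d0) dG _ (clampT s) zeroT) _.
    move=> s'; rewrite (le_trans (FL _ _)) ?ler_wpM2l //; [by case: az|by case: az'].
  rewrite subr0 (le_trans (ler_wpM2l (mulr_ge0 L0 d0) (clamp_le s))) //.
  by rewrite mulrAC mulrC ler_wpM2l.
pose zn n := iter n next (fun=> w).
have adm0 : adm (fun=> w).
  split; first by move=> s; exact: cvg_cst.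
  by move=> s; rewrite (le_trans w0) // ler_pdivrMr // ler_peMr ?ler1n // ltW.
have adm_n n : adm (zn n) by elim: n => //= n IH; exact: next_adm.
have step n s : `|zn n.+1 s - zn n s| <= r / 4 / 2 ^+ n.
  elim: n s => [|n IH] s; first by rewrite expr0 divr1 /= next_w.
  rewrite exprS invfM mulrCA [2^-1 * _]mulrC.
  exact: (next_contr (zn n.+1) (zn n) _ (adm_n _) (adm_n _) IH).
have /choice [z Hz] : forall s, exists zs : 'rV[R]_m, forall n, `|zn n s - zs| <= r / 2 / 2 ^+ n.
  move=> s.
  have /choice [l Hl] j : exists l, forall n, `|zn n s 0 j - l| <= 2 * (r / 4) / 2 ^+ n.
    apply: geometric_limit => n; have := step n s.
    by apply: le_trans; rewrite (le_trans _ (rV_norm_ge _ j)) // !mxE.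
  exists (\row_j l j) => n; apply: rV_norm_le => [|j]; first by rewrite !divr_ge0 // ?exprn_ge0 // ltW.
  rewrite !mxE (le_trans (Hl j n)) // ler_wpM2r // ?invr_ge0 ?exprn_ge0 //; lra.
have Dz s : `|z s - z0| <= r.
  have := Hz s 0%N; rewrite expr0 divr1 distrC /= => H.
  by rewrite -(subrKA w) (le_trans (ler_normD _ _)) // [leRHS]splitr lerD.
have z_lip s s' : `|z s - z s'| <= C * `|s - s'|.
  apply: (@le_geometric _ _ _ r) => n.
  have zl : `|zn n s - zn n s'| <= C * `|s - s'|.
    case: n => [|n]; first by rewrite /= subrr normr0 mulr_ge0.
    exact: next_lip.
  have -> : z s - z s' = (zn n s - zn n s') + ((z s - zn n s) + (zn n s' - z s')).
    by rewrite addrCA !subrKA.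
  rewrite (le_trans (ler_normD _ _)) // lerD // (le_trans (ler_normD _ _)) //.
  rewrite [r in leRHS]splitr mulrDl lerD //.
  by rewrite distrC.
have az : adm z by split => //; exact: lip_cont.
have zfix s : z s = next z s.
  apply/eqP; rewrite -subr_eq0 -normr_le0; apply: (@le_geometric _ _ _ r) => n; rewrite add0r.
  rewrite -(subrKA (zn n.+1 s)) (le_trans (ler_normD _ _)) // [r in leRHS]splitr mulrDl lerD //.
    rewrite distrC (le_trans (Hz s n.+1)) // ler_wpM2l ?divr_ge0 ?(ltW r0) //.
    by rewrite lef_pV2 ?posrE ?exprn_gt0 // exprS ler_peMl ?exprn_ge0 // ler1n.
  rewrite (le_trans (next_contr _ _ _ (adm_n n) az (Hz ^~ n) s)) //.
  by rewrite ler_pdivrMr // ler_peMr ?ler1n // !divr_ge0 ?exprn_ge0 // ltW.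
exists z; split.
  by rewrite zfix /next clamp_id ?normr0 ?ltW // subrr addr0.
move=> s st; split=> //.
have sT : - T < s < T by have := clampT s; rewrite clamp_id // ltW.
have E : \forall s' \near s, w + (prim (F \o z) s' - prim (F \o z) 0) = z s'.
  have : \forall s' \near s, `|s'| < tau.
    by have := @norm_continuous _ R s; move=> /(_ [set x | x < tau]); apply; exact: lt_nbhsl.
  by apply: filterS => s' s't; rewrite zfix /next clamp_id // ltW.
apply: (near_eq_is_derive E).
have := is_deriveD (is_derive_cst w s 1) (is_deriveB (dprim z az s sT) (is_derive_cst (prim (F \o z) 0) s 1)).
by move=> H; apply: (is_derive_eq H); rewrite subr0 add0r.
Unshelve. all: by end_near. Qed.

End Picard.

Section LocallyLipschitz.
Context {R : realType} {m : nat}.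

Lemma smooth_locally_lipschitz (Fi : 'I_m -> 'rV[R]_m -> R) (z0 : 'rV[R]_m) (P : set 'rV[R]_m) :
  (forall i, smooth_germ (Fi i) z0) -> (\forall z \near z0, P z) ->
  exists r C L, [/\ 0 < r, 0 <= C, 0 <= L, forall z, `|z - z0| <= r -> P z &
    (forall z, `|z - z0| <= r -> `|\row_i Fi i z| <= C) /\
    (forall z z', `|z - z0| <= r -> `|z' - z0| <= r ->
       `|(\row_i Fi i z) - \row_i Fi i z'| <= L * `|z - z'|)].
Proof.
move=> SF nP.
have bnd (h : 'rV[R]_m -> R) : smooth_germ h z0 -> \forall z \near z0, `|h z| < `|h z0| + 1.
  by move=> /smooth_germ_cvg /cvgr_norm_lt; apply; rewrite ltrDl.
pose C := \sum_i (`|Fi i z0| + 1).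
pose B := \sum_i \sum_a (`|pd a (Fi i) z0| + 1).
have N1 : \forall z \near z0, forall i, differentiable (Fi i) z.
  by apply: near_forall => i; apply: filterS (smooth_germ_near (SF i)) => z; exact: smooth_germ_diff.
have N2 : \forall z \near z0, forall i, `|Fi i z| < `|Fi i z0| + 1.
  by apply: near_forall => i; exact: bnd.
have N3 : \forall z \near z0, forall i a, `|pd a (Fi i) z| < `|pd a (Fi i) z0| + 1.
  apply: near_forall => i; apply: near_forall => a.
  by apply: (bnd (pd a (Fi i))); exact: smooth_germ_pd.
have /nbhs_ballP [rho /= rho0 H] := near_and (near_and nP N1) (near_and N2 N3).
have Hb z : `|z - z0| <= rho / 2 -> [/\ P z, forall i, differentiable (Fi i) z,
    forall i, `|Fi i z| < `|Fi i z0| + 1 & forall i a, `|pd a (Fi i) z| < `|pd a (Fi i) z0| + 1].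
  move=> zr; have [[? ?] [? ?]] : (P z /\ (forall i, differentiable (Fi i) z)) /\
    (forall i, `|Fi i z| < `|Fi i z0| + 1) /\ (forall i a, `|pd a (Fi i) z| < `|pd a (Fi i) z0| + 1).
    apply: H; rewrite -ball_normE /ball_ /= distrC (le_lt_trans zr) //.
    by rewrite ltr_pdivrMr // ltr_pMr // ltr1n.
  by split.
have p1 (x : R) : 0 <= `|x| + 1 by rewrite addr_ge0.
have B0 : 0 <= B by apply: sumr_ge0 => i _; apply: sumr_ge0.
exists (rho / 2), C, B; split=> //; first by rewrite divr_gt0.
- exact: sumr_ge0.
- by move=> z /Hb [].
split=> [z zr|z z' zr zr'].
  have [_ _ F1 _] := Hb z zr; apply: rV_norm_le => [|i]; first exact: sumr_ge0.
  rewrite mxE (le_trans (ltW (F1 i))) // /C (bigD1 i) //= lerDl.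
  exact: sumr_ge0.
have inb s : 0 <= s <= (1 : R) -> `|z' + s *: (z - z') - z0| <= rho / 2.
  move=> /andP[s0 s1].
  have -> : z' + s *: (z - z') - z0 = s *: (z - z0) + (1 - s) *: (z' - z0).
    by apply/rowP => j; rewrite !mxE; ring.
  rewrite (le_trans (ler_normD _ _)) // !normrZ !ger0_norm ?subr_ge0 //.
  have -> : rho / 2 = s * (rho / 2) + (1 - s) * (rho / 2) by ring.
  by rewrite lerD // ler_wpM2l // subr_ge0.
apply: rV_norm_le => [|i]; first by rewrite mulr_ge0.
rewrite !mxE.
have [|c cI E] := @mvt_line _ _ (Fi i) z' (z - z') 1 ltr01.
  by move=> s /inb /Hb [].
rewrite scale1r mul1r [z' + _]addrC subrK in E.
have [_ d _ dB] := Hb _ (inb c cI).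
rewrite E derive_partials // (le_trans (ler_norm_sum _ _ _)) //.
rewrite (le_trans (_ : _ <= (\sum_a (`|pd a (Fi i) z0| + 1)) * `|z - z'|)) //.
  rewrite mulr_suml; apply: ler_sum => a _; rewrite normrM mulrC ler_pM //.
    exact: ltW (dB i a).
  exact: rV_norm_ge.
rewrite ler_wpM2r // /B [leRHS](bigD1 i) //= lerDl.
by apply: sumr_ge0 => j _; apply: sumr_ge0.
Qed.

End LocallyLipschitz.

Section FlowExistence.
Context {R : realType} {n k : nat} {M : smooth_manifold R n}.
Variable S : subriemannian M k.
Variables (q : M) (U : set M) (X : 'I_k -> vfield M).
Hypotheses (oU : open U) (Uq : U q) (sX : forall i, smooth_vfield U (X i)).
Hypothesis onX : forall p, U p -> orthonormal_basis S p (X ^~ p).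

Local Notation c := (chart_at q).

Let ac : atlas c := chart_at_atlas q.
Let cq : cdom c q := chart_at_dom q.

Let ypart (z : 'rV[R]_(n + n)) : 'rV[R]_n := lsubmx z.
Let ppart (z : 'rV[R]_(n + n)) : 'cV[R]_n := (rsubmx z)^T.

(** The components of the Hamiltonian vector field in canonical coordinates. *)
Let ydot b y (p : 'cV[R]_n) : R := \sum_j momentum c X j y p * field_comp c (X j) b y.
Let pdot a y (p : 'cV[R]_n) : R :=
  - \sum_j momentum c X j y p * \sum_b p b 0 * pd a (field_comp c (X j) b) y.

Let Fi (i : 'I_(n + n)) (z : 'rV[R]_(n + n)) : R :=
  match fintype.split i with
  | inl b => ydot b (ypart z) (ppart z)
  | inr a => pdot a (ypart z) (ppart z)
  end.

Let z0 : 'rV[R]_(n + n) := row_mx (cmap c q) 0.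

Let smooth_Fi i : smooth_germ (Fi i) z0.
Proof.
have Sy b : smooth_germ (fun z => ypart z 0 b) z0.
  apply: smooth_germ_eq (smooth_germ_coord (lshift n b) z0).
  by near=> z; rewrite /ypart mxE.
have Sp b : smooth_germ (fun z => ppart z b 0) z0.
  apply: smooth_germ_eq (smooth_germ_coord (rshift n b) z0).
  by near=> z; rewrite /ppart !mxE.
have Sc h : smooth_germ h (cmap c q) -> smooth_germ (fun z => h (ypart z)) z0.
  move=> Sh; apply: smooth_germ_comp => //.
  by rewrite /ypart /z0 row_mxKl.
have SX j b : smooth_germ (field_comp c (X j) b) (cmap c q).
  apply: (smooth_field_comp ac); first exact: cmap_rng.
  by rewrite cmapK //; have /(smooth_vfieldP _ oU) := sX j; apply.
have Sm j : smooth_germ (fun z => momentum c X j (ypart z) (ppart z)) z0.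
  by apply: smooth_germ_sum => a _; apply: smooth_germM => //; exact: Sc.
rewrite /Fi; case: (fintype.split i) => b.
  by apply: smooth_germ_sum => j _; apply: smooth_germM => //; exact: Sc.
apply: smooth_germN; apply: smooth_germ_sum => j _; apply: smooth_germM => //.
apply: smooth_germ_sum => a _; apply: smooth_germM => //.
by apply: (Sc (pd b (field_comp c (X j) a))); exact: smooth_germ_pd.
Unshelve. all: by end_near. Qed.

(** Curves exist for a time inversely proportional to the size of the initial
    covector: by homogeneity of Hamilton's equations it suffices to consider
    small covectors. *)
Lemma flow_exists : exists2 e0, 0 < e0 & forall l t, 0 < t ->
  t * (1 + cov_size l) < e0 -> exists a b gamma, [/\ a < 0 < b, a < t < b,
    hamilton_curve S a b gamma & gamma 0 = (q, l)].
Proof.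
have nz : \forall z \near z0, crng c (ypart z) /\ U (cinv c (ypart z)).
  have cy : {for z0, continuous ypart} by exact: continuous_lsubmx.
  have E0 : ypart z0 = cmap c q by rewrite /ypart /z0 row_mxKl.
  have Uy : U (cinv c (ypart z0)) by rewrite E0 cmapK.
  have ry : crng c (ypart z0) by rewrite E0; exact: cmap_rng.
  exact: (cy _ (near_domain oU ry Uy)).
have [r [C [L [r0 C0 L0 Pr [FC FL]]]]] := smooth_locally_lipschitz smooth_Fi nz.
pose tau := Num.min (r / 4 / (C + 1)) (2^-1 / (L + 1)).
have C1 : 0 < C + 1 by rewrite ltr_wpDl.
have L1 : 0 < L + 1 by rewrite ltr_wpDl.
have tau0 : 0 < tau by rewrite lt_min !divr_gt0.
have tauC : C * tau <= r / 4.
  apply: (@le_trans _ _ ((C + 1) * tau)); first by rewrite ler_wpM2r ?lerDl ?ltW.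
  by rewrite mulrC -ler_pdivlMr // ge_min lexx.
have tauL : L * tau <= 2^-1.
  apply: (@le_trans _ _ ((L + 1) * tau)); first by rewrite ler_wpM2r ?lerDl ?ltW.
  by rewrite mulrC -ler_pdivlMr // ge_min lexx orbT.
exists (tau * (r / 2)); first by rewrite mulr_gt0 ?divr_gt0.
move=> l t t0 tl.
have s1 : 0 < 1 + cov_size l by rewrite ltr_pwDl // sumr_ge0.
(* Divided by ka, the covector l has norm at most r / 2. *)
pose ka := (1 + cov_size l) / (r / 2).
have ka0 : 0 < ka by rewrite divr_gt0 // divr_gt0.
pose w : 'rV[R]_(n + n) := row_mx (cmap c q) (ka^-1 *: l^T).
have w0 : `|w - z0| <= r / 2.
  have -> : w - z0 = row_mx 0 (ka^-1 *: l^T).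
    by rewrite /w /z0 opp_row_mx add_row_mx subrr subr0.
  apply: rV_norm_le => [|j]; first by rewrite divr_ge0 // ltW.
  rewrite mxE; case: (fintype.split j) => a; first by rewrite mxE normr0 divr_ge0 // ltW.
  rewrite !mxE normrM ger0_norm ?invr_ge0 ?(ltW ka0) // ler_pdivrMl //.
  rewrite /ka divfK ?gt_eqF ?divr_gt0 // (le_trans _ (_ : cov_size l <= _)) ?lerDr //.
  by rewrite /cov_size (bigD1 a) //= lerDl sumr_ge0.
have [z [z00 Hz]] := picard r0 C0 L0 tau0 FC FL w0 tauC tauL.
(* The curve of initial covector l is that of l / ka, run ka times faster. *)
pose y s := ypart (z (ka * s)); pose p s := ka *: ppart (z (ka * s)).
pose gamma s := (cinv c (y s), cotangent_chart c (y s) (p s)).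
have tk s : - (tau / ka) < s < tau / ka -> `|ka * s| < tau.
  rewrite ltr_pdivlMr // ltrNl ltr_pdivlMr // => /andP[a b].
  by rewrite ltr_norml mulrC; apply/andP; split=> //; rewrite ltrNl -mulNr.
exists (- (tau / ka)), (tau / ka), gamma; split.
- by rewrite oppr_lt0 divr_gt0.
- rewrite (lt_trans _ t0) ?oppr_lt0 ?divr_gt0 //= ltr_pdivlMr // /ka mulrA.
  by rewrite ltr_pdivrMr // divr_gt0.
- move=> s sI; have [zr dz] := Hz _ (tk s sI).
  exists c, y, p.
  have [cy Uy] : crng c (y s) /\ U (cinv c (y s)) by exact: Pr zr.
  have dzs : is_derive s 1 (fun r => z (ka * r)) (ka *: \row_i Fi i (z (ka * s))).
    have dl : is_derive s 1 (fun r : R => ka * r) ka.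
      by have := is_derive_mulcf ka (is_derive_id s (1 : R)); rewrite mulr1.
    apply/is_derive_mxP => i j; rewrite (ord1 i) [X in is_derive _ _ _ X]mxE mulrC.
    exact: is_derive_comp1 ((is_derive_mxP _ _ _ _).1 dz 0 j) dl.
  have comp_z j : is_derive s 1 (fun r => z (ka * r) 0 j) (ka * Fi j (z (ka * s))).
    by have := (is_derive_mxP _ _ _ _).1 dzs 0 j; rewrite !mxE.
  have mom_scale j yy pp : momentum c X j yy (ka *: pp) = ka * momentum c X j yy pp.
    by rewrite /momentum mulr_sumr; apply: eq_bigr => a _; rewrite mxE mulrA.
  split=> //.
  + have : \forall r \near s, - (tau / ka) < r < tau / ka.
      move: sI => /andP[sa sb].
      have := near_and (lt_nbhsr sa) (lt_nbhsl sb).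
      by apply: filterS => r' [-> ->].
    by apply: filterS => r' /tk /Hz [/Pr [cr _] _].
  + apply/is_derive_mxP => i b; rewrite (ord1 i) mxE.
    rewrite (derive_hamiltonian_p ac onX) //.
    have -> : (fun r => y r 0 b) = (fun r => z (ka * r) 0 (lshift n b)).
      by apply/funext => r'; rewrite /y /ypart mxE.
    apply: (is_derive_eq (comp_z _)); rewrite /Fi (unsplitK (inl b)) /ydot mulr_sumr.
    by apply: eq_bigr => j _; rewrite mom_scale mulrA.
  + apply/is_derive_mxP => a i; rewrite (ord1 i) !mxE.
    rewrite (derive_hamiltonian_y ac oU sX onX) //.
    have -> : (fun r => p r a 0) = (fun r => ka * z (ka * r) 0 (rshift n a)).
      by apply/funext => r'; rewrite /p /ppart !mxE.
    apply: (is_derive_eq (is_derive_mulcf ka (comp_z _))).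
    rewrite /Fi (unsplitK (inr a)) /pdot !mulrN !mulr_sumr; congr (- _).
    apply: eq_bigr => j _; rewrite mom_scale.
    have -> : \sum_b p s b 0 * pd a (field_comp c (X j) b) (y s) =
        ka * \sum_b ppart (z (ka * s)) b 0 * pd a (field_comp c (X j) b) (y s).
      by rewrite mulr_sumr; apply: eq_bigr => b _; rewrite mxE mulrA.
    by rewrite [RHS]mulrACA -[RHS]mulrA.
rewrite /gamma /y /p mulr0 z00 /w /ypart /ppart row_mxKl row_mxKr cmapK //.
rewrite linearZ /= trmxK scalerA mulfV ?gt_eqF // scale1r; congr (_, _).
apply: pairing_ext => v; rewrite pairing_cotangent ?cmapK //; last exact: cmap_rng.
by rewrite /pairing; apply: eq_bigr => a _; rewrite -tangent_coord.
Qed.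

End FlowExistence.

(** * Integration against the measures on the cylinder *)

Section LowerIntegral.
Context d (T : measurableType d) (R : realType).
Variable mu : {measure set T -> \bar R}.
Local Open Scope ereal_scope.

Let ge0_le_integral_any (F G : T -> \bar R) : (forall x, 0 <= F x) ->
  (forall x, F x <= G x) -> \int[mu]_x F x <= \int[mu]_x G x.
Proof.
move=> F0 FG; have G0 x : 0 <= G x by exact: le_trans (FG x).
rewrite !ge0_integralE //; apply: le_ereal_sup => _ [h hF <-]; exists h => //= x.
by have := hF x; rewrite !patch_setT => /le_trans; apply.
Qed.

(** The integral is a difference of suprema over simple functions, hence
    monotone on functions that are not supposed measurable. *)
Lemma le_integral_any (F G : T -> \bar R) : (forall x, F x <= G x) ->
  \int[mu]_x F x <= \int[mu]_x G x.
Proof.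
move=> FG; rewrite integralE [leRHS]integralE; apply: leeB.
  apply: ge0_le_integral_any => x; first exact: funepos_ge0.
  by rewrite !funeposE ge_max !le_max FG lexx orbT.
apply: ge0_le_integral_any => x; first exact: funeneg_ge0.
by rewrite !funenegE ge_max !le_max leeN2 FG lexx orbT.
Qed.

Variable E : set T.
Hypotheses (mE : measurable E) (E0 : mu (~` E) = 0).

Let ae_eq_E (F G : T -> \bar R) : (forall x, E x -> F x = G x) -> ae_eq mu setT F G.
Proof.
move=> FG; exists (~` E); split=> //; first exact: measurableC.
by move=> x /= H Ex; apply: H => _; exact: FG.
Qed.

Let mE_bool : measurable_fun setT (fun x => x \in E).
Proof.
apply: (@measurable_fun_bool _ _ _ _ true); rewrite setTI.
by rewrite (_ : _ @^-1` _ = E) //; apply/seteqP; split=> x; [exact: set_mem|exact: mem_set].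
Qed.

(** Outside of the null set, F is compared with the constants +oo and -oo. *)
Lemma integral_sandwich (F L U : T -> R) : mu.-integrable setT (EFin \o L) ->
  mu.-integrable setT (EFin \o U) -> (forall x, E x -> (L x <= F x <= U x)%R) ->
  exists2 r : R, \int[mu]_x (F x)%:E = r%:E &
    (\int[mu]_x L x <= r <= \int[mu]_x U x)%R.
Proof.
move=> iL iU FLU.
have [mL _] := integrableP _ _ _ iL; have [mU _] := integrableP _ _ _ iU.
have fL : \int[mu]_x (L x)%:E \is a fin_num by exact: integrable_fin_num iL.
have fU : \int[mu]_x (U x)%:E \is a fin_num by exact: integrable_fin_num iU.
have HU : \int[mu]_x (F x)%:E <= \int[mu]_x (U x)%:E.
  rewrite [leRHS](@ae_eq_integral _ _ _ mu setT (fun x => if x \in E then (U x)%:E else +oo)) //.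
  - apply: le_integral_any => x; case: ifPn => [|_]; last exact: leey.
    by rewrite inE lee_fin => /FLU /andP[].
  - exact: measurable_fun_ifT.
  - by apply: ae_eq_E => x Ex; rewrite mem_set.
have HL : \int[mu]_x (L x)%:E <= \int[mu]_x (F x)%:E.
  rewrite (@ae_eq_integral _ _ _ mu setT (fun x => if x \in E then (L x)%:E else -oo)) //.
  - apply: le_integral_any => x; case: ifPn => [|_]; last exact: leNye.
    by rewrite inE lee_fin => /FLU /andP[].
  - exact: measurable_fun_ifT.
  - by apply: ae_eq_E => x Ex; rewrite mem_set.
have fF : \int[mu]_x (F x)%:E \is a fin_num.
  rewrite fin_numE; apply/andP; split; apply/eqP => H; move: HL HU; rewrite H.
    by rewrite leeNy_eq => /eqP H'; move: fL; rewrite H'.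
  by move=> _; rewrite leye_eq => /eqP H'; move: fU; rewrite H'.
exists (fine (\int[mu]_x (F x)%:E)); first by rewrite fineK.
by rewrite -!lee_fin fineK // !fineK // HL HU.
Qed.

Lemma ae_bounded_integrable (f : T -> R) (C : R) : mu setT < +oo ->
  measurable_fun setT f -> (forall x, E x -> (`|f x| <= C)%R) ->
  mu.-integrable setT (EFin \o f).
Proof.
move=> mfin mf fC; apply/integrableP; split; first exact/measurable_EFinP.
rewrite (@ae_eq_integral _ _ _ mu setT (fun x => if x \in E then `|f x|%:E else 0)) //.
- apply: (@le_lt_trans _ _ (\int[mu]_x (Num.max C 0)%:E)).
    apply: le_integral_any => x; case: ifPn => [|_].
      by rewrite inE lee_fin le_max => /fC ->.
    by rewrite lee_fin le_max lexx orbT.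
  rewrite integral_cst // lte_mul_pinfty // lee_fin le_max lexx orbT //.
- by apply: measurableT_comp => //; exact: measurableT_comp.
- apply: measurable_fun_ifT => //.
  by apply: measurableT_comp => //; exact: measurableT_comp.
- by apply: ae_eq_E => x Ex; rewrite mem_set.
Qed.

End LowerIntegral.

Section SecondOrderLimit.
Context d (T : measurableType d) (R : realType).
Variable mu : {measure set T -> \bar R}.

Lemma tail_small (N : T -> R) (e : R) : mu.-integrable setT (EFin \o N) ->
  (forall x, 0 <= N x) -> 0 < e ->
  exists m : nat, mu.-integrable setT (EFin \o (fun x => if m%:R <= N x then N x else 0)) /\
    (\int[mu]_x (if m%:R <= N x then N x else 0))%R <= e.
Proof.
move=> iN N0 e0; have [mN _] := integrableP _ _ _ iN.
have {}mN : measurable_fun setT N by exact/measurable_EFinP.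
pose f_ (m : nat) x := (if m%:R <= N x then N x else 0)%:E.
have mf m : measurable_fun setT (f_ m).
  apply/measurable_EFinP; apply: measurable_fun_ifT => //; exact: measurable_fun_ler.

have bf m x : (`|f_ m x| <= (N x)%:E)%E.
  rewrite /f_ abse_EFin lee_fin.
  by case: ifP => _; rewrite ?normr0 // ger0_norm.
have cf : {ae mu, forall x, setT x -> f_ ^~ x @ \oo --> 0%E}.
  apply: aeW => x _; apply: cvg_near_cst.
  near=> m; rewrite /f_ leNgt (_ : N x < m%:R) //.
  near: m; exists (Num.truncn (N x)).+1 => // m /= Hm.
  by apply: (lt_le_trans (truncnS_gt _)); rewrite ler_nat.
have [_ _] := @dominated_convergence _ _ _ mu setT measurableT f_ (fun=> 0%E)
    (EFin \o N) mf (@measurable_cst _ _ _ _ _ _) cf iN (aeW _ (fun x m _ => bf m x)).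
rewrite integral0 => /fine_cvgP [_ /cvgrPdist_le /(_ _ e0) [m _ Hm]].
exists m; split.
  apply: (le_integrable measurableT (mf m) _ iN) => x _ /=.
  by rewrite (le_trans (bf m x)) // lee_fin ler_norm.
have := Hm m (leqnn m); rewrite /= sub0r normrN => H.
by rewrite (le_trans (ler_norm _)).
Unshelve. all: by end_near. Qed.

Variable E : set T.
Hypotheses (mE : measurable E) (E0 : mu (~` E) = 0%E).

(** The second alternative only occurs where N >= c / t^2, and by integrability
    the integral of N over this set tends to 0: its contribution to the error is
    o(t^2), while that of the first one is O(t^3). *)
Lemma second_order_limit (A Q N : T -> R) (F : R -> T -> R) (C c tau kap : R) :
  mu.-integrable setT (EFin \o A) -> mu.-integrable setT (EFin \o Q) ->
  mu.-integrable setT (EFin \o N) -> (forall x, 0 <= N x) ->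
  0 <= C -> 0 < c -> 0 < tau -> 0 <= kap ->
  (forall (t : R) x, 0 < t < tau -> E x ->
     `|F t x - t * A x - t ^+ 2 / 2 * Q x| <= C * t ^+ 3 * N x \/
     c <= t ^+ 2 * N x /\ `|F t x - t * A x - t ^+ 2 / 2 * Q x| <= C * t ^+ 2 * N x) ->
  (\int[mu]_x A x)%R = 0 ->
  (fun t => ((2 * kap / t ^+ 2)%:E * \int[mu]_x (F t x)%:E)%E) @ 0^'+ -->
    (kap * (\int[mu]_x Q x)%R)%:E.
Proof.
move=> iA iQ iN N0 C0 c0 tau0 kap0 H IA.
set IQ := (\int[mu]_x Q x)%R; set IN := (\int[mu]_x N x)%R.
have IN0 : 0 <= IN by apply: Rintegral_ge0.
have key e : 0 < e -> \forall t \near 0^'+, exists2 r, (\int[mu]_x (F t x)%:E)%E = r%:E &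
    `|kap * IQ - 2 * kap / t ^+ 2 * r| <= 2 * kap * C * (t * IN + e).
  move=> e0; have [m [iT IT]] := tail_small iN N0 e0.
  set Tl := (fun x => if m%:R <= N x then N x else 0) in iT IT.
  have Tl0 x : 0 <= Tl x by rewrite /Tl; case: ifP.
  near=> t.
  have tp : 0 < t by [].
  have tt : t < tau by near: t; exact: nbhs_right_lt.
  have t1 : t < 1 by near: t; exact: nbhs_right_lt.
  have mt : m%:R * t ^+ 2 <= c.
    have tc : t < c / (m%:R + 1) by near: t; apply: nbhs_right_lt; rewrite divr_gt0 // ltr_wpDl.
    have m1 : 0 < m%:R + 1 :> R by rewrite ltr_wpDl.
    apply: (@le_trans _ _ ((m%:R + 1) * t)).
      by rewrite ler_pM ?exprn_ge0 ?(ltW tp) ?lerDl // expr2 ler_piMl ?ltW.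
    by rewrite mulrC -ler_pdivlMr // ltW.
  pose err x := C * t ^+ 3 * N x + C * t ^+ 2 * Tl x.
  pose mid x := t * A x + t ^+ 2 / 2 * Q x.
  have ie : mu.-integrable setT (EFin \o err).
    have := integrableD measurableT (integrableZl measurableT (C * t ^+ 3) iN)
      (integrableZl measurableT (C * t ^+ 2) iT).
    by apply: eq_integrable => // x _; rewrite /= /err EFinD !EFinM.
  have im : mu.-integrable setT (EFin \o mid).
    have := integrableD measurableT (integrableZl measurableT t iA)
      (integrableZl measurableT (t ^+ 2 / 2) iQ).
    by apply: eq_integrable => // x _; rewrite /= /mid EFinD !EFinM.
  have iU : mu.-integrable setT (EFin \o (fun x => mid x + err x)).
    by have := integrableD measurableT im ie; apply: eq_integrable.
  have iL : mu.-integrable setT (EFin \o (fun x => mid x - err x)).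
    by have := integrableB measurableT im ie; apply: eq_integrable.
  have B x : E x -> mid x - err x <= F t x <= mid x + err x.
    move=> Ex; suff : `|F t x - mid x| <= err x.
      rewrite ler_norml => /andP[b1 b2]; apply/andP; split.
        by move: b1; lra.
      by move: b2; lra.
    have -> : F t x - mid x = F t x - t * A x - t ^+ 2 / 2 * Q x by rewrite /mid opprD addrA.
    have tt' : 0 < t < tau by rewrite tp.
    have [h1|[h1 h2]] := H t x tt' Ex.
      apply: (le_trans h1); rewrite lerDl !mulr_ge0 // ?exprn_ge0 ?ltW //.
    apply: (le_trans h2); rewrite /err /Tl (_ : m%:R <= N x).
      by rewrite lerDr !mulr_ge0 // ?exprn_ge0 ?ltW.
    by rewrite -(ler_pM2r (exprn_gt0 2 tp)) (le_trans mt) // mulrC.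
  have [r Er /andP[r1 r2]] := integral_sandwich mE E0 iL iU B.
  exists r => //.
  have Im : (\int[mu]_x mid x)%R = t ^+ 2 / 2 * IQ.
    rewrite /mid RintegralD //; last 2 first.
    - by have := integrableZl measurableT t iA; apply: eq_integrable.
    - by have := integrableZl measurableT (t ^+ 2 / 2) iQ; apply: eq_integrable.
    by rewrite !RintegralZl // IA mulr0 add0r.
  have Ie : (\int[mu]_x err x)%R <= C * t ^+ 3 * IN + C * t ^+ 2 * e.
    rewrite /err RintegralD //; last 2 first.
    - by have := integrableZl measurableT (C * t ^+ 3) iN; apply: eq_integrable.
    - by have := integrableZl measurableT (C * t ^+ 2) iT; apply: eq_integrable.
    by rewrite !RintegralZl // lerD2l ler_wpM2l // mulr_ge0 // exprn_ge0 // ltW.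
  rewrite RintegralB // Im in r1; rewrite RintegralD // Im in r2.
  have -> : kap * IQ - 2 * kap / t ^+ 2 * r = (2 * kap / t ^+ 2) * (t ^+ 2 / 2 * IQ - r).
    by field; rewrite gt_eqF.
  rewrite normrM ger0_norm; last by rewrite divr_ge0 ?mulr_ge0 ?exprn_ge0 // ltW.
  have : `|t ^+ 2 / 2 * IQ - r| <= C * t ^+ 3 * IN + C * t ^+ 2 * e.
    by rewrite ler_norml; apply/andP; split; move: r1 r2 Ie; clear; lra.
  move=> /(ler_wpM2l (_ : 0 <= 2 * kap / t ^+ 2)) /le_trans; apply.
    by rewrite divr_ge0 ?mulr_ge0 ?exprn_ge0 // ltW.
  by rewrite le_eqVlt; apply/orP; left; apply/eqP; field; rewrite gt_eqF.
apply/fine_cvgP; split.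
  by apply: filterS (key 1 ltr01) => t [r -> _].
apply/cvgrPdist_le => e e0.
pose K := 2 * kap * C + 1.
have K0 : 0 < K by rewrite ltr_wpDl // !mulr_ge0.
have e1 : 0 < e / 2 / K by rewrite !divr_gt0.
near=> t.
have [r Er Hr] : exists2 r, (\int[mu]_x (F t x)%:E)%E = r%:E &
    `|kap * IQ - 2 * kap / t ^+ 2 * r| <= 2 * kap * C * (t * IN + e / 2 / K).
  by near: t; exact: key.
have tp : 0 < t by [].
rewrite /= Er /= (le_trans Hr) //.
have tb : t < e / 2 / (K * (IN + 1)).
  by near: t; apply: nbhs_right_lt; rewrite !divr_gt0 // mulr_gt0 // ltr_wpDl.
apply: (@le_trans _ _ (K * (t * (IN + 1) + e / 2 / K))).
  apply: ler_pM.
  - by rewrite !mulr_ge0.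
  - by rewrite addr_ge0 ?(ltW e1) // mulr_ge0 ?(ltW tp).
  - by rewrite lerDl.
  - by rewrite lerD2r ler_wpM2l ?(ltW tp) // lerDl.
rewrite mulrDr [X in _ + X]mulrC divfK ?gt_eqF //.
rewrite [leRHS]splitr lerD2r mulrCA mulrA -ler_pdivlMr //; last by rewrite ltr_wpDl.
by move: tb; rewrite invfM mulrA mulrAC ltr_pdivlMr // mulrC => /ltW.
Unshelve. all: by end_near. Qed.

End SecondOrderLimit.

(** * Means of functions on probability spaces *)

Section Mean.
Context d (T : measurableType d) (R : realType).
Variable mu : probability T R.
Implicit Types (f g : T -> R).

(** Integrability and value travel together, so that the moments of finite sums
    are computed without side conditions. *)
Definition has_mean f (r : R) := mu.-integrable setT (EFin \o f) /\
  (\int[mu]_x f x)%R = r.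

Lemma has_mean_measurable f r : has_mean f r -> measurable_fun setT f.
Proof. by move=> [/integrableP[/measurable_EFinP]]. Qed.

Lemma has_mean_eq f g r : (forall x, f x = g x) -> has_mean f r -> has_mean g r.
Proof. by move=> /funext ->. Qed.

Lemma has_mean_cst (r : R) : has_mean (fun=> r) r.
Proof.
split; last by rewrite Rintegral_cst // [X in fine X](probability_setT mu) /= mulr1.
apply/integrableP; split; first exact: measurable_cst.
by rewrite integral_cst //= [X in (_ * X)%E](probability_setT mu) mule1 ltry.
Qed.

Lemma has_mean_scale (a : R) f r : has_mean f r -> has_mean (fun x => a * f x) (a * r).
Proof.
move=> [i <-]; split; last by rewrite RintegralZl.
by have := integrableZl measurableT a i; apply: eq_integrable.
Qed.

Lemma has_meanD f g (r s : R) : has_mean f r -> has_mean g s ->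
  has_mean (fun x => f x + g x) (r + s).
Proof.
move=> [i <-] [j <-]; split; last by rewrite RintegralD.
by have := integrableD measurableT i j; apply: eq_integrable.
Qed.

Lemma has_mean_sum (I : finType) (f : I -> T -> R) (r : I -> R) :
  (forall i, has_mean (f i) (r i)) -> has_mean (fun x => \sum_i f i x) (\sum_i r i).
Proof.
move=> H; rewrite (_ : (fun _ => _) = (fun x => (\sum_i f i) x)); last first.
  by apply/funext => x; rewrite fct_sumE.
elim/big_rec2: _ => [|i g s _ IH]; first exact: has_mean_cst.
by apply: has_mean_eq (has_meanD (H i) IH).
Qed.

Lemma has_mean_unique f (r s : R) : has_mean f r -> has_mean f s -> r = s.
Proof. by move=> [_ <-] [_ <-]. Qed.

Variable E : set T.
Hypotheses (mE : measurable E) (E1 : mu E = 1%E).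

Lemma full_setC : mu (~` E) = 0%E.
Proof. by rewrite probability_setC // E1 subee. Qed.

Lemma bounded_has_mean f (C : R) : measurable_fun setT f ->
  (forall x, E x -> `|f x| <= C) -> exists r, has_mean f r.
Proof.
move=> mf fC; exists (\int[mu]_x f x)%R; split=> //.
apply: (ae_bounded_integrable mE full_setC _ mf fC).
by rewrite [X in (X < _)%E](probability_setT mu) ltry.
Qed.

Lemma has_mean_ae f g r : measurable_fun setT g -> (forall x, E x -> f x = g x) ->
  has_mean f r -> has_mean g r.
Proof.
move=> mg fg [i <-].
have ae : ae_eq mu setT (EFin \o f) (EFin \o g).
  exists (~` E); split; [exact: measurableC|exact: full_setC|].
  by move=> x /= H Ex; apply: H => _; rewrite fg.
have mf := measurable_int _ i.
have mg' : measurable_fun setT (EFin \o g) by exact/measurable_EFinP.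
split; last by rewrite /Rintegral (ae_eq_integral (EFin \o g) (EFin \o f) measurableT mf mg' ae).
apply/integrableP; split=> //.
rewrite -(ae_eq_integral (abse \o (EFin \o g)) (abse \o (EFin \o f)) measurableT).
- by case/integrableP: i.
- exact: measurableT_comp.
- exact: measurableT_comp.
- exact: ae_eq_abse.
Qed.

(** Both means are integrals of the identity against the distribution of f. *)
Lemma has_mean_invariant (phi : T -> T) f (r s : R) :
  measurable_fun setT f ->
  (forall B, measurable B -> mu [set x | B (phi x)] = mu B) ->
  has_mean f r -> has_mean (f \o phi) s -> r = s.
Proof.
move=> mf inv Hf Hg; have mg := has_mean_measurable Hg.
case: Hf => i <-; case: Hg => j <-; rewrite /Rintegral; congr fine.
pose F : {mfun T >-> R} := HB.pack f (isMeasurableFun.Build _ _ _ _ _ mf).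
pose G : {mfun T >-> R} := HB.pack (f \o phi) (isMeasurableFun.Build _ _ _ _ _ mg).
have mE' : measurable_fun [set: R] (@EFin R) by exact: EFin_measurable.
transitivity (\int[pushforward mu F]_y y%:E)%E.
  by rewrite (integral_pushforward mf mE' i measurableT).
transitivity (\int[pushforward mu G]_y y%:E)%E; last first.
  by rewrite (integral_pushforward mg mE' j measurableT).
apply: eq_measure_integral => B mB _.
apply/esym/inv.
by have := mf measurableT B mB; rewrite setTI.
Qed.

End Mean.

Section ProductMean.
Context d1 d2 (T1 : measurableType d1) (T2 : measurableType d2) (R : realType).
Variables (m1 : probability T1 R) (m2 : probability T2 R).

Lemma has_mean_prod (f : T1 -> R) (g : T2 -> R) (r s : R) :
  has_mean m1 f r -> has_mean m2 g s ->
  has_mean (m1 \x m2)%E (fun z => f z.1 * g z.2) (r * s).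
Proof.
move=> Hf Hg; have mf := has_mean_measurable Hf; have mg := has_mean_measurable Hg.
case: Hf => i <-; case: Hg => j <-.
have mfg : measurable_fun setT (fun z : T1 * T2 => f z.1 * g z.2).
  by apply: measurable_funM; apply: measurableT_comp.
have mfg' : measurable_fun setT (EFin \o (fun z : T1 * T2 => f z.1 * g z.2)).
  exact/measurable_EFinP.
have ifg : (m1 \x m2)%E.-integrable setT (EFin \o (fun z : T1 * T2 => f z.1 * g z.2)).
  apply/(integrable12ltyP m1 m2 mfg').
  have [_ fi] := integrableP _ _ _ i; have [_ gi] := integrableP _ _ _ j.
  rewrite (eq_integral (fun x => `|(f x)%:E| * \int[m2]_y `|(g y)%:E|)%E) => [|x _].
    rewrite ge0_integralZr //.
    - apply: lte_mul_pinfty; [exact: integral_ge0| |exact: gi].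
      by rewrite ge0_fin_numE; [exact: fi|exact: integral_ge0].
    - by apply: measurableT_comp => //; exact/measurable_EFinP.
    - exact: integral_ge0.
  rewrite -ge0_integralZl //.
    by apply: eq_integral => y _; rewrite -abseM.
  by apply: measurableT_comp => //; exact/measurable_EFinP.
split=> //; rewrite /Rintegral -integral12_prod_meas1 //.
rewrite /fubini_F [X in fine X = _](eq_integral (fun x => (f x)%:E * \int[m2]_y (g y)%:E)%E) => [|x _].
  have fg : (\int[m2]_y (g y)%:E)%E \is a fin_num by exact: integrable_fin_num j.
  have ff : (\int[m1]_y (f y)%:E)%E \is a fin_num by exact: integrable_fin_num i.
  by rewrite -(fineK fg) integralZr // fineM.
by rewrite -integralZl //.
Qed.

Lemma has_mean_fst (f : T1 -> R) (r : R) : has_mean m1 f r ->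
  has_mean (m1 \x m2)%E (fun z => f z.1) r.
Proof.
move=> H; have := has_mean_prod H (has_mean_cst m2 1); rewrite mulr1.
by apply: has_mean_eq => z; rewrite mulr1.
Qed.

Lemma has_mean_snd (g : T2 -> R) (s : R) : has_mean m2 g s ->
  has_mean (m1 \x m2)%E (fun z => g z.2) s.
Proof.
move=> H; have := has_mean_prod (has_mean_cst m1 1) H; rewrite mul1r.
by apply: has_mean_eq => z; rewrite mul1r.
Qed.

End ProductMean.

Section BorelCov.
Context {R : realType} {n : nat}.
Local Notation cov := (borel_cov R n).

Lemma measurable_coord (a : 'I_n) :
  measurable_fun setT (fun l : cov => (l : 'cV[R]_n) a 0).
Proof.
apply: (measurability (@RGenOpens.G R)).
  exact: RGenOpens.measurableE.
 move=> _ [_ [x [y ->]] <-].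
rewrite setTI; apply: sub_sigma_algebra.
apply: open_comp; last exact: interval_open.
by move=> l _; exact: coord_continuous.
Qed.

Lemma measurable_pairing (v : 'rV[R]_n) :
  measurable_fun setT (fun l : cov => pairing l v).
Proof.
apply: measurable_sum => a; apply: measurable_funM; first exact: measurable_coord.
exact: measurable_cst.
Qed.

(** The annihilator is the zero set of the sum of the squares of the values on a
    basis of V. *)
Lemma measurable_annihilator (V : {vspace 'rV[R]_n}) :
  measurable (annihilator V : set cov).
Proof.
pose s (l : cov) := \sum_(i < \dim V) pairing l (vbasis V)`_i ^+ 2.
have ms : measurable_fun setT s.
  by apply: measurable_sum => i; apply: measurable_funX; exact: measurable_pairing.
rewrite (_ : annihilator V = setT `&` s @^-1` [set 0]); first exact: ms.
rewrite setTI; apply/seteqP; split=> l /= H.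
  rewrite /s big1 // => i _; rewrite H ?expr0n //.
  by rewrite (vbasis_mem (mem_nth _ _)) // size_tuple.
move=> v /coord_vbasis ->; rewrite pairing_sumr big1 // => i _.
rewrite pairingZr; have /eqP := H; rewrite psumr_eq0 => [|j _]; last exact: sqr_ge0.
by move/allP/(_ i (mem_index_enum i)); rewrite sqrf_eq0 => /eqP ->; rewrite mulr0.
Qed.

End BorelCov.

(** * Moments of the uniform measure on the sphere *)

Section Fibre.
Context {R : realType} {n k : nat} {M : smooth_manifold R n}.
Variables (S : subriemannian M k) (q : M).
Variables (e : 'I_k -> 'rV[R]_n) (al : 'cV[R]_n) (x0 : 'rV[R]_n) (V : {vspace 'rV[R]_n}).
Local Notation D := (distr S).
Local Notation g := (metric S q).
Local Notation cov := (borel_cov R n).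
Hypothesis oe : orthonormal_basis S q e.
Hypothesis Dal : forall v, v \in D q <-> pairing al v = 0.
Hypothesis al1 : pairing al x0 = 1.
Hypothesis VE : V = <[x0]>%VS.

Let De i : e i \in D q. Proof. exact: oe.1. Qed.

Lemma annihilator_line (l : 'cV[R]_n) : annihilator V l <-> pairing l x0 = 0.
Proof.
rewrite VE; split=> [H|H v /vlineP[a ->]]; first exact/H/memv_line.
by rewrite pairingZr H mulr0.
Qed.

Lemma projection_distr v : v - pairing al v *: x0 \in D q.
Proof. by apply/Dal; rewrite pairingBr pairingZr al1 mulr1 subrr. Qed.

(** The covectors dual to the basis e of D that vanish on x0. *)
Definition dual_covector (m : 'I_k) : 'cV[R]_n :=
  \col_a g (e m) (basis_vec a - al a 0 *: x0).

Lemma pairing_dual m v :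
  pairing (dual_covector m) v = g (e m) (v - pairing al v *: x0).
Proof.
have -> : v - pairing al v *: x0 = \sum_a v 0 a *: (basis_vec a - al a 0 *: x0).
  rewrite (eq_bigr (fun a => v 0 a *: basis_vec a - (al a 0 * v 0 a) *: x0)).
    by rewrite sumrB -scaler_suml -row_sum_delta.
  by move=> a _; rewrite scalerBr scalerA mulrC.
have Db a : basis_vec a - al a 0 *: x0 \in D q.
  by rewrite -(pairing_basis al); exact: projection_distr.
rewrite metric_sumr // => [|a]; last by rewrite memvZ.
by apply: eq_bigr => a _; rewrite mxE metricZr // mulrC.
Qed.

Lemma pairing_dual_basis m i : pairing (dual_covector m) (e i) = (m == i)%:R.
Proof.
rewrite pairing_dual; have /Dal -> := De i.
by rewrite scale0r subr0 oe.2.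
Qed.

Lemma pairing_dual_x0 m : pairing (dual_covector m) x0 = 0.
Proof.
by rewrite pairing_dual al1 scale1r subrr metricC ?metric0l ?mem0v.
Qed.

Lemma covector_decomp l v : pairing l x0 = 0 ->
  pairing l v = \sum_m pairing (dual_covector m) v * pairing l (e m).
Proof.
move=> l0; have -> : pairing l v = pairing l (v - pairing al v *: x0).
  by rewrite pairingBr pairingZr l0 mulr0 subr0.
rewrite (onb_decomp oe (projection_distr v)) pairing_sumr.
by apply: eq_bigr => m _; rewrite pairingZr pairing_dual.
Qed.

Lemma vertical_decomp l v : annihilator (D q) l ->
  pairing l v = pairing al v * pairing l x0.
Proof.
move=> H; have := H _ (projection_distr v).
by rewrite pairingBr pairingZr => /eqP; rewrite subr_eq0 => /eqP.
Qed.

(** The reflection of the fibre of the annihilator of x0 in the hyperplane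
    orthogonal to the covector of components a, for s = 2 / |a|^2. *)
Definition householder (s : R) (a : 'I_k -> R) : 'M[R]_n :=
  1%:M - s *: ((\sum_i a i *: dual_covector i) *m (\sum_i a i *: e i)).

Lemma householderE s a l v : pairing (householder s a *m l) v =
  pairing l v - s * (\sum_i a i * pairing l (e i)) *
    (\sum_i a i * pairing (dual_covector i) v).
Proof.
set w := \sum_i a i *: e i; set nu := \sum_i a i *: dual_covector i.
have wl : w *m l = (pairing l w)%:M.
  apply/rowP => i; rewrite [i]ord1 !mxE eqxx mulr1n.
  by apply: eq_bigr => b _; rewrite mulrC.
rewrite /householder mulmxBl mul1mx -scalemxAl -mulmxA wl mul_mx_scalar scalerA.
rewrite pairingDl pairingNl pairingZl pairing_sumr pairing_suml.
congr (_ - s * _ * _); apply: eq_bigr => i _; first by rewrite pairingZr.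
by rewrite pairingZl.
Qed.

Lemma householder_basis s a l m : pairing (householder s a *m l) (e m) =
  pairing l (e m) - s * (\sum_i a i * pairing l (e i)) * a m.
Proof.
rewrite householderE (bigD1 m _ (F := fun i => _ * pairing (dual_covector i) _)) //=.
rewrite pairing_dual_basis eqxx mulr1 [X in a m + X]big1 ?addr0 // => i im.
by rewrite pairing_dual_basis (negPf im) mulr0.
Qed.

Lemma householder_isometry s a l : s * (\sum_i a i ^+ 2) = 2 ->
  annihilator V l -> annihilator V (householder s a *m l) /\
    hamiltonian S q (householder s a *m l) = hamiltonian S q l.
Proof.
move=> sa /annihilator_line l0; split.
  apply/annihilator_line; rewrite householderE l0 [X in _ * X]big1.
    by rewrite mulr0 subr0.
  by move=> i _; rewrite pairing_dual_x0 mulr0.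
rewrite !(hamiltonianE _ oe); congr (_ * _).
set b := \sum_i a i * pairing l (e i).
rewrite (eq_bigr (fun m => pairing l (e m) ^+ 2 - 2 * s * b * (a m * pairing l (e m)) +
    (s * b) ^+ 2 * a m ^+ 2)); last by move=> m _; rewrite householder_basis -/b; ring.
rewrite big_split sumrB -!mulr_sumr /= -/b.
rewrite (_ : (s * b) ^+ 2 * _ = s * b ^+ 2 * (s * (\sum_i a i ^+ 2))); last by ring.
by rewrite sa; ring.
Qed.

Section Moments.
Variable mu : probability cov R.
Hypothesis unif : mu (unit_cylinder S q `&` annihilator V) = 1%E /\
  forall A : 'M[R]_n,
    (forall l, annihilator V l -> annihilator V (A *m l) /\
       hamiltonian S q (A *m l) = hamiltonian S q l) ->
    forall B : set cov, measurable B -> mu [set l | B (A *m l)] = mu B.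

Definition sphere : set cov := unit_cylinder S q `&` annihilator V.

Lemma sphere_norm l : unit_cylinder S q l -> \sum_i pairing l (e i) ^+ 2 = 1.
Proof.
by rewrite /unit_cylinder /= (hamiltonianE _ oe) mulrA divff ?mul1r.
Qed.

Lemma measurable_sphere : measurable sphere.
Proof.
apply: measurableI; last exact: measurable_annihilator.
pose s (l : cov) := \sum_i pairing l (e i) ^+ 2.
have ms : measurable_fun setT s.
  by apply: measurable_sum => i; apply: measurable_funX; exact: measurable_pairing.
rewrite (_ : unit_cylinder S q = setT `&` s @^-1` [set 1]); first exact: ms.
rewrite setTI; apply/seteqP; split=> l /= H; first exact: sphere_norm.
by rewrite /unit_cylinder /= (hamiltonianE _ oe) mulrA divff ?mul1r.
Qed.

Lemma sphere_bound l i : unit_cylinder S q l -> `|pairing l (e i)| <= 1.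
Proof.
by move=> /sphere_norm H; exact: (sqr_sum1_le1 H i).
Qed.

Local Notation mom := (has_mean mu).

Let mean_mul i j : exists r, mom (fun l => pairing l (e i) * pairing l (e j)) r.
Proof.
apply: (@bounded_has_mean _ _ _ _ _ measurable_sphere unif.1 _ 1) => [|l [Hl _]].
  by apply: measurable_funM; exact: measurable_pairing.
by rewrite normrM mulr_ile1 // sphere_bound.
Qed.

Let invariant s a (f : cov -> R) (r t : R) : s * (\sum_i a i ^+ 2) = 2 ->
  mom f r -> mom (fun l => f (householder s a *m l)) t -> r = t.
Proof.
move=> sa Hf Hg; apply: (has_mean_invariant (has_mean_measurable Hf) _ Hf Hg).
by apply: unif.2 => l; exact: householder_isometry.
Qed.

Let delta_sqr (i : 'I_k) : 2 * (\sum_m (i == m)%:R ^+ 2) = 2 :> R.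
Proof.
rewrite (bigD1 i) //= eqxx expr1n big1 ?addr0 ?mulr1 // => m mi.
by rewrite eq_sym (negPf mi) expr0n.
Qed.

Let delta_sum (i : 'I_k) l : \sum_m (i == m)%:R * pairing l (e m) = pairing l (e i).
Proof.
rewrite (bigD1 i) //= eqxx mul1r big1 ?addr0 // => m mi.
by rewrite eq_sym (negPf mi) mul0r.
Qed.

Let opp_fixed (x : R) : x = -1 * x -> x = 0.
Proof. by move=> H; lra. Qed.

(** The reflection that changes the sign of the i-th component preserves mu. *)
Lemma sphere_mean i : mom (fun l => pairing l (e i)) 0.
Proof.
have [r Hr] : exists r, mom (fun l => pairing l (e i)) r.
  apply: (@bounded_has_mean _ _ _ _ _ measurable_sphere unif.1 _ 1) => [|l [Hl _]].
    exact: measurable_pairing.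
  exact: sphere_bound.
suff <- : r = 0 by [].
apply/opp_fixed/(invariant (delta_sqr i) Hr).
apply: has_mean_eq (has_mean_scale (-1) Hr) => l.
by rewrite householder_basis delta_sum eqxx /= mulr1n; ring.
Qed.

Lemma sphere_mean_offdiag i j : i != j ->
  mom (fun l => pairing l (e i) * pairing l (e j)) 0.
Proof.
move=> ij; have [r Hr] := mean_mul i j; suff <- : r = 0 by [].
apply/opp_fixed/(invariant (delta_sqr i) Hr).
apply: has_mean_eq (has_mean_scale (-1) Hr) => l.
by rewrite !householder_basis !delta_sum eqxx (negPf ij) /= mulr0n mulr1n; ring.
Qed.

(** Exchanging two components preserves mu, so the second moments are equal;
    their sum is 1 on the sphere. *)
Lemma sphere_mean_diag i : mom (fun l => pairing l (e i) * pairing l (e i)) k%:R^-1.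
Proof.
have [r Hr] := mean_mul i i.
have Hj j : mom (fun l => pairing l (e j) * pairing l (e j)) r.
  have [<-//|ij] := eqVneq i j; have [t Ht] := mean_mul j j.
  suff -> : r = t by [].
  pose a m : R := (i == m)%:R - (j == m)%:R.
  have sa : 1 * (\sum_m a m ^+ 2) = 2.
    rewrite mul1r (bigD1 i) //= (bigD1 j) ?(eq_sym j) //= /a !eqxx (eq_sym j) (negPf ij).
    rewrite big1 ?addr0 => [|m /andP[mi mj]]; first by rewrite /= mulr0n mulr1n; ring.
    by rewrite ![_ == m]eq_sym (negPf mi) (negPf mj) subrr expr0n.
  apply: (invariant sa Hr); apply: has_mean_eq Ht => l.
  have -> : pairing (householder 1 a *m l) (e i) = pairing l (e j); last by [].
  rewrite householder_basis /a.
  under eq_bigr do rewrite mulrBl.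
  by rewrite sumrB !delta_sum eqxx (eq_sym j) (negPf ij) /= mulr0n mulr1n; ring.
have Hs := has_mean_sum Hj.
have H1 : mom (fun l => \sum_i pairing l (e i) * pairing l (e i)) 1.
  apply: (has_mean_ae measurable_sphere unif.1 _ _ (has_mean_cst mu 1)).
    exact: has_mean_measurable Hs.
  by move=> l [/sphere_norm <- _]; apply: eq_bigr => m _; rewrite expr2.
have := has_mean_unique Hs H1; rewrite sumr_const card_ord -[r *+ k]mulr_natr => rk.
suff <- : r = k%:R^-1 by [].
have k0 : k%:R != 0 :> R by apply/eqP => k0; move: rk; rewrite k0 mulr0 => /eqP; rewrite eq_sym oner_eq0.
by apply: (mulIf k0); rewrite rk mulVf.
Qed.

End Moments.
End Fibre.

(** * The microscopic Laplacian in an orthonormal frame *)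

Section MicroLimit.
Context {R : realType} {n k : nat} {M : smooth_manifold R n}.
Variables (S : subriemannian M k) (q : M).
Local Notation D := (distr S).
Local Notation g := (metric S).
Local Notation cov := (borel_cov R n).

(** The value at q of the operator
    sum_i X_i^2 + sum_(i, j) c_(ij)^i X_j, where c_(ij)^i is the component of
    [X_i, X_j] along X_i in the splitting of the tangent space by x0. *)
Definition frame_laplacian (X : 'I_k -> vfield M) (al : 'cV[R]_n) (x0 : 'rV[R]_n)
    (f : M -> R) : R :=
  \sum_i vact (X i) (vact (X i) f) q +
  \sum_i \sum_j g q (X i q) (bracket (X i) (X j) q -
     pairing al (bracket (X i) (X j) q) *: x0) * vact (X j) f q.

Variables (U : set M) (X : 'I_k -> vfield M) (f : M -> R).
Hypotheses (oU : open U) (Uq : U q).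
Hypothesis sX : forall i, smooth_vfield U (X i).
Hypothesis onX : forall p, U p -> orthonormal_basis S p (X ^~ p).
Hypothesis Sf : smooth_at f q.

Variables (al : 'cV[R]_n) (x0 : 'rV[R]_n) (V : {vspace 'rV[R]_n}).
Hypothesis Dal : forall v, v \in D q <-> pairing al v = 0.
Hypothesis al1 : pairing al x0 = 1.
Hypothesis VE : V = <[x0]>%VS.
Variables muS muV : probability cov R.
Hypothesis unif : muS (unit_cylinder S q `&` annihilator V) = 1%E /\
  forall A : 'M[R]_n,
    (forall l, annihilator V l -> annihilator V (A *m l) /\
       hamiltonian S q (A *m l) = hamiltonian S q l) ->
    forall B : set cov, measurable B -> muS [set l | B (A *m l)] = muS B.
Hypothesis vert : vertical_measure S q muV.

Let e i := X i q.
Let oe : orthonormal_basis S q e. Proof. exact: onX. Qed.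
Let De i : e i \in D q. Proof. exact: oe.1. Qed.
Let Z i j := bracket (X i) (X j) q.
Let th := dual_covector S q e al x0.
Let u i (z : cov * cov) : R := pairing z.1 (e i).
Let w (z : cov * cov) : R := pairing z.2 x0.
Let a i m : R := \sum_j pairing (th m) (Z i j) * vact (X j) f q +
  vact (X i) (vact (X m) f) q.
Let b i : R := \sum_j pairing al (Z i j) * vact (X j) f q.
Let A z : R := \sum_j vact (X j) f q * u j z.
Let Q z : R := \sum_i \sum_m a i m * (u i z * u m z) + \sum_i b i * (u i z * w z).
Let E : set (cov * cov) := sphere S q V `*` annihilator (D q).
Local Notation mom := (has_mean (muS \x muV)%E).

Let vertical_moments : exists r s, has_mean muV (fun l => pairing l x0) r /\
  has_mean muV (fun l => pairing l x0 ^+ 2) s.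
Proof.
have mw : measurable_fun setT (fun l : cov => pairing l x0) by exact: measurable_pairing.
have mw2 : measurable_fun setT (EFin \o (fun l : cov => pairing l x0 ^+ 2)).
  by apply/measurable_EFinP; exact: measurable_funX.
have [_ /(_ x0) iw2] := vert.
have i2 : muV.-integrable setT (EFin \o (fun l : cov => pairing l x0 ^+ 2)).
  apply/integrableP; split=> //; move: iw2; congr (_ < _)%E; apply: eq_integral => l _.
  by rewrite /= ger0_norm // sqr_ge0.
exists (\int[muV]_l pairing l x0)%R, (\int[muV]_l pairing l x0 ^+ 2)%R; split=> //.
split=> //; have i1 := (has_meanD (has_mean_cst muV 1) (conj i2 erefl)).1.
apply: (le_integrable measurableT _ _ i1); first exact/measurable_EFinP.
move=> l _ /=; rewrite lee_fin; set y := pairing l x0.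
rewrite [leRHS]ger0_norm ?addr_ge0 ?sqr_ge0 //.
have := sqr_ge0 (`|y| - 1); have := normr_ge0 y; rewrite sqrrB real_normK ?num_real //.
by set v := `|y|; lra.
Qed.

Let meanA : mom A 0.
Proof.
have -> : 0 = \sum_j vact (X j) f q * 0 by rewrite big1 // => j _; rewrite mulr0.
apply: has_mean_sum => j; apply: has_mean_scale.
exact: has_mean_fst (sphere_mean oe Dal al1 VE unif j).
Qed.

Let meanQ : mom Q (\sum_i a i i * k%:R^-1).
Proof.
have [r [s [Hr _]]] := vertical_moments.
have -> : \sum_i a i i * k%:R^-1 = \sum_i \sum_m a i m * (if i == m then k%:R^-1 else 0)
    + \sum_i b i * (0 * r).
  rewrite [X in _ + X]big1 ?addr0 => [|i _]; last by rewrite mul0r mulr0.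
  apply: eq_bigr => i _; rewrite (bigD1 i) //= eqxx big1 ?addr0 // => m mi.
  by rewrite eq_sym (negPf mi) mulr0.
apply: has_meanD; apply: has_mean_sum => i.
  apply: has_mean_sum => m; apply: has_mean_scale.
  apply: (@has_mean_fst _ _ _ _ _ muS muV (fun l => pairing l (e i) * pairing l (e m))).
  case: eqVneq => [<-|im]; first exact: (sphere_mean_diag oe Dal al1 VE unif).
  exact: (sphere_mean_offdiag oe Dal al1 VE unif).
apply: has_mean_scale; have Hi := sphere_mean oe Dal al1 VE unif i.
exact: has_mean_prod Hi Hr.
Qed.

Let E_pairing z v : E z -> pairing (z.1 + z.2) v =
  \sum_m pairing (th m) v * u m z + pairing al v * w z.
Proof.
move=> [[_ /(annihilator_line VE) h1] h2]; rewrite pairingDl.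
by rewrite (covector_decomp oe Dal al1 _ h1) (vertical_decomp Dal al1 _ h2).
Qed.

Let E_basis z i : E z -> pairing (z.1 + z.2) (e i) = u i z.
Proof. by move=> [_ h2]; rewrite pairingDl [X in _ + X]h2 ?addr0. Qed.

Let E_d1 z : E z -> flow_d1 X f q (z.1 + z.2) = A z.
Proof. by move=> Ez; apply: eq_bigr => j _; rewrite E_basis // mulrC. Qed.

Let E_d2 z : E z -> flow_d2 X f q (z.1 + z.2) = Q z.
Proof.
move=> Ez; rewrite /flow_d2 /Q.
rewrite (eq_bigr (fun j => \sum_i (\sum_m (pairing (th m) (Z i j) * vact (X j) f q)
    * (u i z * u m z) + (pairing al (Z i j) * vact (X j) f q) * (u i z * w z)
    + vact (X i) (vact (X j) f) q * (u i z * u j z)))); last first.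
  move=> j _; rewrite mulr_suml mulr_sumr -big_split /=; apply: eq_bigr => i _.
  rewrite !E_basis // E_pairing // -/(Z i j) mulrDr mulrDl; congr (_ + _ + _).
  - by rewrite mulr_sumr mulr_suml; apply: eq_bigr => m _; ring.
  - by ring.
  - by ring.
rewrite exchange_big -big_split; apply: eq_bigr => i _ /=.
rewrite !big_split /= -addrA addrCA addrC; congr (_ + _); last first.
  by rewrite /b mulr_suml.
rewrite exchange_big -big_split; apply: eq_bigr => m _ /=.
by rewrite /a mulrDl mulr_suml.
Qed.

(** On the cylinder the horizontal part of a covector is bounded and its
    vertical part is a multiple of al, of which w is the coefficient: N dominates
    the squared size of the covector. *)
Let B : R := \sum_c \sum_m `|pairing (th m) (basis_vec c)|.
Let K : R := 2 * (1 + B) ^+ 2 + 2 * cov_size al ^+ 2.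
Let N z : R := K * (1 + w z ^+ 2).

Let B0 : 0 <= B. Proof. by apply: sumr_ge0 => c _; apply: sumr_ge0. Qed.
Let al0 : 0 <= cov_size al. Proof. exact: sumr_ge0. Qed.

Let K1 : 1 <= K.
Proof. by rewrite /K; have := sqr_ge0 (cov_size al); have := B0; nra. Qed.

Let N1 z : 1 + w z ^+ 2 <= N z.
Proof. by rewrite ler_peMl // addr_ge0 // sqr_ge0. Qed.

Let E_u z i : E z -> `|u i z| <= 1.
Proof. by move=> [[h _] _]; exact: (sphere_bound oe i h). Qed.

Let E_N z : E z -> (1 + cov_size (z.1 + z.2)) ^+ 2 <= N z.
Proof.
move=> Ez; have H : cov_size (z.1 + z.2) <= B + `|w z| * cov_size al.
  rewrite /cov_size mulr_sumr -big_split; apply: ler_sum => c _ /=.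
  rewrite -pairing_basis E_pairing //; apply: (le_trans (ler_normD _ _)).
  rewrite normrM (mulrC `|w z|) (pairing_basis al) lerD2r.
  apply: (le_trans (ler_norm_sum _ _ _)); apply: ler_sum => m _.
  by rewrite normrM ler_piMr // E_u.
have c0 : 0 <= cov_size (z.1 + z.2) by exact: sumr_ge0.
have -> : N z = K * (1 + `|w z| ^+ 2) by rewrite real_normK ?num_real.
move: H c0 B0 al0 (normr_ge0 (w z)); rewrite /K.
move: (cov_size _) (cov_size _) `|w z| B => t s v r H s0 r0 t0 v0.
have vt : 0 <= v * t by exact: mulr_ge0.
have : (1 + s) ^+ 2 <= (1 + r + v * t) ^+ 2 by rewrite ler_sqr ?nnegrE; lra.
move=> /le_trans; apply.
have := sqr_ge0 (1 + r - v * t); have := sqr_ge0 ((1 + r) * v); have := sqr_ge0 t.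
by nra.
Qed.

Let mE : measurable E.
Proof.
apply: measurableX; last exact: measurable_annihilator.
exact: measurable_sphere oe.
Qed.

Let E1 : (muS \x muV)%E E = 1%E.
Proof.
rewrite [LHS](product_measure1E muS muV _ _); last 2 first.
- exact: measurable_sphere oe.
- exact: measurable_annihilator.
by rewrite [X in (X * _)%E]unif.1 [X in (_ * X)%E]vert.1 mule1.
Qed.

(** On the cylinder the coefficients of order one and two of f along the flow
    are A and Q.  The mean of A is 0, and in Q only the squares of the components
    u_i survive, with mean 1/k.  Where no solution is defined up to time t, the
    covector has size at least e0 / t, and [sr_exp] takes the value q. *)
Lemma micro_limit :
  (fun t : R => ((2 * k%:R / t ^+ 2)%:E *
     cylinder_integral muS muV (fun l => f (sr_exp S q t l) - f q)%R)%E)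
    @ 0^'+ --> (frame_laplacian X al x0 f)%:E.
Proof.
have -> : frame_laplacian X al x0 f = k%:R * (\int[(muS \x muV)%E]_z Q z)%R.
  rewrite meanQ.2 mulr_sumr /frame_laplacian -big_split; apply: eq_bigr => i _ /=.
  have k0 : k%:R != 0 :> R by rewrite pnatr_eq0 -lt0n (leq_trans _ (ltn_ord i)).
  rewrite mulrCA divff // mulr1 /a addrC; congr (_ + _); apply: eq_bigr => j _.
  by rewrite pairing_dual.
have [C1 [t1 [C10 t10 H1]]] := flow_expansion oU Uq sX onX Sf.
have [e0 e00 H2] := flow_exists oU Uq sX onX.
pose Fa := \sum_j `|vact (X j) f q|.
pose Qa := \sum_i \sum_m `|a i m| + \sum_i `|b i|.
have Fa0 : 0 <= Fa by exact: sumr_ge0.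
have Qa0 : 0 <= Qa by rewrite addr_ge0 // sumr_ge0 // => i _; exact: sumr_ge0.
have [r [s [_ Hs]]] := vertical_moments.
have meanN : mom N (K * (1 + s)).
  apply: has_mean_scale; apply: has_meanD; first exact: has_mean_cst.
  exact: (@has_mean_snd _ _ _ _ _ muS muV (fun l => pairing l x0 ^+ 2)).
apply: (@second_order_limit _ _ _ (muS \x muV)%E E mE (full_setC mE E1) A Q N
  (fun t z => f (sr_exp S q t (z.1 + z.2)) - f q) (C1 + Fa / e0 + Qa) (e0 ^+ 2) t1).
- exact: meanA.1.
- exact: meanQ.1.
- exact: meanN.1.
- by move=> z; apply: le_trans (N1 z); rewrite addr_ge0 // sqr_ge0.
- by rewrite addr_ge0 ?Qa0 // addr_ge0 // divr_ge0 // ltW.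
- by rewrite exprn_gt0.
- exact: t10.
- exact: ler0n.
- move=> t z /andP[t0 tt1] Ez; set l := z.1 + z.2.
  have N0 : 0 <= N z by apply: le_trans (N1 z); rewrite addr_ge0 // sqr_ge0.
  have cs0 : 0 <= cov_size l by exact: sumr_ge0.
  have hl : hamiltonian S q l = 2^-1.
    rewrite (hamiltonianE _ oe) (eq_bigr (fun i => pairing z.1 (e i) ^+ 2)).
      by rewrite (sphere_norm oe Ez.1.1) mulr1.
    by move=> i _; rewrite E_basis.
  (* Either some solution reaches time t, or sr_exp takes its default value. *)
  have [[p Hp]|no] := pselect (exists p, [set p | exists a b gamma, [/\ a < 0 < b, a < t < b,
    hamilton_curve S a b gamma, gamma 0 = (q, l) & p = (gamma t).1]] p).
    left; have [a' [b' [gam [h1 h2 h3 h4 h5]]]] := xgetPex q (ex_intro _ p Hp).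
    rewrite /sr_exp [xget _ _]h5.
    have /andP[_ tb] := h2.
    have := H1 l a' b' gam t hl h1 h3 h4; rewrite t0 tb (ltW tt1) => /(_ isT isT).
    rewrite E_d1 // E_d2 // => /le_trans; apply.
    rewrite mulrAC; apply: ler_pM => //.
    - by rewrite mulr_ge0 // exprn_ge0 // ltW.
    - by rewrite sqr_ge0.
    - by rewrite ler_wpM2r ?exprn_ge0 ?(ltW t0) // -addrA lerDl addr_ge0 // divr_ge0 // ltW.
    - exact: E_N.
  right; have te : e0 <= t * (1 + cov_size l).
    rewrite leNgt; apply/negP => /(H2 l t t0) [a' [b' [gam [h1 h2 h3 h4]]]].
    by apply: no; exists (gam t).1, a', b', gam.
  split.
    rewrite (le_trans (_ : _ <= (t * (1 + cov_size l)) ^+ 2)) //.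
      by rewrite ler_sqr ?nnegrE ?(ltW e00) // mulr_ge0 ?(ltW t0) // addr_ge0.
    by rewrite exprMn ler_wpM2l ?sqr_ge0 // E_N.
  have -> : sr_exp S q t l = q.
    by rewrite /sr_exp xgetPN // => p Hp; apply: no; exists p.
  rewrite subrr sub0r -opprD normrN; apply: (le_trans (ler_normD _ _)).
  have A1 : `|A z| <= Fa.
    apply: (le_trans (ler_norm_sum _ _ _)); apply: ler_sum => j _.
    by rewrite normrM ler_piMr // E_u.
  have Q1 : `|Q z| <= Qa * N z.
    have w1 : `|w z| <= N z.
      apply: le_trans (N1 z); have := sqr_ge0 (`|w z| - 1).
      have := normr_ge0 (w z); rewrite sqrrB real_normK ?num_real //.
      by move: `|w z| => v; lra.
    have N11 : 1 <= N z by apply: le_trans (N1 z); rewrite lerDl sqr_ge0.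
    apply: (le_trans (ler_normD _ _)); rewrite mulrDl; apply: lerD.
      apply: (le_trans (ler_norm_sum _ _ _)); rewrite mulr_suml; apply: ler_sum => i _.
      apply: (le_trans (ler_norm_sum _ _ _)); rewrite mulr_suml; apply: ler_sum => m _.
      rewrite normrM ler_wpM2l // normrM (le_trans _ N11) // mulr_ile1 // E_u //.
    apply: (le_trans (ler_norm_sum _ _ _)); rewrite mulr_suml; apply: ler_sum => i _.
    rewrite normrM ler_wpM2l // normrM (le_trans _ w1) // ler_piMl // E_u //.
  have cN : 1 + cov_size l <= N z.
    apply: le_trans (E_N Ez).
    have h : 1 <= 1 + cov_size l by rewrite lerDl.
    by rewrite expr2; apply: ler_peMr => //; exact: le_trans ler01 h.
  have tA : t * Fa <= Fa / e0 * t ^+ 2 * N z.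
    apply: (@le_trans _ _ (Fa / e0 * t * (t * (1 + cov_size l)))).
      rewrite (_ : t * Fa = Fa / e0 * t * e0); last by field; rewrite gt_eqF.
      by rewrite ler_wpM2l // mulr_ge0 ?(ltW t0) // divr_ge0 // ltW.
    have Ft : 0 <= Fa / e0 * t ^+ 2 by rewrite mulr_ge0 ?sqr_ge0 // divr_ge0 // ltW.
    have -> : Fa / e0 * t * (t * (1 + cov_size l)) = Fa / e0 * t ^+ 2 * (1 + cov_size l) by ring.
    exact: ler_wpM2l.
  have tQ : t ^+ 2 / 2 * (Qa * N z) <= Qa * t ^+ 2 * N z.
    rewrite (_ : Qa * t ^+ 2 * N z = t ^+ 2 * (Qa * N z)); last by ring.
    have QN : 0 <= Qa * N z by exact: mulr_ge0.
    apply: ler_wpM2r => //; have := sqr_ge0 t; move: (t ^+ 2) => t2; lra.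
  have t2 : 0 <= t ^+ 2 / 2 by rewrite divr_ge0 ?sqr_ge0.
  rewrite (normrM t) (normrM (t ^+ 2 / 2)) (ger0_norm (ltW t0)) (ger0_norm t2).
  have C2 : 0 <= C1 * t ^+ 2 * N z by apply: mulr_ge0 => //; rewrite mulr_ge0 // sqr_ge0.
  have tA' : t * `|A z| <= t * Fa by rewrite ler_wpM2l // ltW.
  have tQ' : t ^+ 2 / 2 * `|Q z| <= t ^+ 2 / 2 * (Qa * N z).
    exact: ler_wpM2l.
  rewrite (_ : _ * N z = C1 * t ^+ 2 * N z + (Fa / e0 * t ^+ 2 * N z + Qa * t ^+ 2 * N z));
    last by ring.
  apply: (le_trans (lerD (le_trans tA' tA) (le_trans tQ' tQ))).
  by rewrite lerDr.
- exact: meanA.2.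
Qed.

End MicroLimit.

(** * Functions with a prescribed differential *)

Section BumpCoordinate.
Context {R : realType} {n : nat} {M : smooth_manifold R n}.

(** A bump times an affine function of the coordinates of a chart, extended by 0.
    The extension is smooth because K, which contains the support, is closed. *)
Lemma bump_coordinate (q : M) (a : 'I_n) : exists f : M -> R,
  smooth_fun setT f /\ exists2 b : R, b != 0 & forall v, dact q v f = b * v 0 a.
Proof.
pose c := chart_at q; have ac : atlas c := chart_at_atlas q.
have dc : cdom c q := chart_at_dom q; set y0 := cmap c q.
have [r r0 rc] : exists2 r : R, 0 < r & forall y, `|y - y0| <= r -> crng c y.
  have /nbhs_ballP[r /= r0 br] := near_crng dc.
  exists (r / 2); first by rewrite divr_gt0.
  move=> y yr; apply: br; rewrite -ball_normE /= distrC (le_lt_trans yr) //.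
  by rewrite ltr_pdivrMr // ltr_pMr // ltr1n.
pose B : set 'rV[R]_n := [set y | `|y - y0| <= r].
pose K := cinv c @` B.
have cK : closed K by exact: closed_chart_ball.
pose h (y : 'rV[R]_n) : R := bump_ball y0 r y * (y 0 a - y0 0 a).
pose f p : R := if `[< K p >] then h (cmap c p) else 0.
have hf p : cdom c p -> h (cmap c p) = f p.
  move=> cp; rewrite /f; case: asboolP => // nK.
  rewrite /h bump_ball_support ?mul0r // leNgt; apply/negP => lt.
  by apply: nK; exists (cmap c p); [exact: ltW|rewrite cmapK].
have sh y : smooth_germ h y.
  apply: smooth_germM; first exact: smooth_bump_ball.
  by apply: smooth_germB; [exact: smooth_germ_coord|exact: smooth_germ_cst].
exists f; split.
  apply/smooth_funP; first exact: openT.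
  move=> p _; have [cp|ncp] := pselect (cdom c p).
    apply: (smooth_at_eq _ (smooth_at_pull ac cp (sh _))).
    by apply: filterS (near_cdom cp) => z; exact: hf.
  apply: (smooth_at_eq _ (smooth_at_cst 0 p)).
  have nK : (~` K) p by move=> [y By Ep]; apply: ncp; rewrite -Ep; apply: cinv_dom; exact: rc.
  have : nbhs p (~` K) by apply: open_nbhs_nbhs; split=> //; exact: closed_openC.
  by apply: filterS => z nKz; rewrite /f asboolF.
exists (bump_ball y0 r y0); first by rewrite gt_eqF // bump_ball_center.
move=> v; rewrite (@dact_eq _ _ _ q v f
    (fun p => bump_ball y0 r (cmap c p) * (chart_coord c a p - y0 0 a))); last first.
  by apply: filterS (near_cdom dc) => z /hf <-.
have Sb : smooth_at (fun p => bump_ball y0 r (cmap c p)) q.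
  exact: (smooth_at_pull ac dc (smooth_bump_ball _ _ _)).
have Sc : smooth_at (chart_coord c a) q by exact: smooth_at_coord.
rewrite dactM // ?dactB //; last first.
- by apply: smooth_atB => //; exact: smooth_at_cst.
- exact: smooth_at_cst.
by rewrite dact_cst subr0 -tangent_coord /chart_coord subrr mul0r addr0.
Qed.

Lemma tangent_eq0 (q : M) (v : 'rV[R]_n) :
  (forall f, smooth_fun setT f -> dact q v f = 0) -> v = 0.
Proof.
move=> H; apply/rowP => a; have [f [sf [b b0 fv]]] := bump_coordinate q a.
by have /eqP := H f sf; rewrite fv mulf_eq0 (negPf b0) mxE => /eqP.
Qed.

End BumpCoordinate.

(** * Uniqueness of the macroscopic Laplacian *)

Section MacroUnique.
Context {R : realType} {n k : nat} {M : smooth_manifold R n}.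
Variable S : subriemannian M k.

(** Vectors on which w does not vanish extend to coordinate fields. *)
Lemma is_div_unique (w : nform M) X d1 d2 : volume_form w ->
  is_div w X d1 -> is_div w X d2 -> d1 =1 d2.
Proof.
move=> [_ _ w0 _] H1 H2 q; have [Y wY] := w0 q.
pose Z i := coord_field (chart_at q) (Y i).
have oc := cdom_open (chart_at q); have qc : cdom (chart_at q) q := chart_at_dom q.
have sZ i : smooth_vfield (cdom (chart_at q)) (Z i).
  apply/smooth_vfieldP => // p cp; apply: smooth_coord_field => //.
  exact: chart_at_atlas.
have := H2 _ _ oc sZ _ qc; rewrite (H1 _ _ oc sZ _ qc) /nform_eval.
rewrite (_ : (fun i => Z i q) = Y); first exact: mulIf.
by apply/funext => i; exact: coord_field_chart_at.
Qed.

Lemma is_grad_unique f G1 G2 : is_grad S f G1 -> is_grad S f G2 -> G1 = G2.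
Proof.
move=> [[_ D1] H1] [[_ D2] H2]; apply/funext => q.
have {}D1 := D1 q I; have {}D2 := D2 q I.
have DN : - G2 q \in distr S q by rewrite memvN.
apply/eqP; rewrite -subr_eq0; apply/eqP; apply: (@metric_eq0 _ _ _ _ S q).
  by rewrite memvD.
move=> v Dv; rewrite metricDl // -scaleN1r metricZl // H1 // H2 //; ring.
Qed.

Lemma macro_unique (w : nform M) f psi1 psi2 : volume_form w ->
  is_macro_laplacian S w f psi1 -> is_macro_laplacian S w f psi2 -> psi1 =1 psi2.
Proof.
move=> vw [G1 [g1 d1]] [G2 [g2 d2]].
by rewrite (is_grad_unique g1 g2) in d1; exact: is_div_unique vw d1 d2.
Qed.

End MacroUnique.

(** * Complements and their normalized generators *)

Section Complements.
Context {R : realType} {n k : nat} {M : smooth_manifold R n}.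
Variables (S : subriemannian M k) (eta : oneform M) (J : M -> 'End('rV[R]_n)).
Local Notation D := (distr S).
Local Notation g := (metric S).
Hypothesis nk : (n - k)%N = 1%N.
Hypothesis seta : smooth_oneform eta.
Hypothesis Deta : forall q v, v \in D q <-> pairing (eta q) v = 0.
Hypothesis endoJ : is_endo S eta J.

Let span_ord1 m (Y : 'I_m -> 'rV[R]_n) (i0 : 'I_m) : m = 1%N ->
  <<[seq Y i | i : 'I_m]>>%VS = <[Y i0]>%VS.
Proof.
move=> m1; move: Y i0; rewrite m1 => Y i0.
by rewrite (ord1 i0) /image_mem enum_ordSl enum_ord0 /= span_seq1.
Qed.

Lemma complement_line c X0 : is_complement S c -> is_generator eta c X0 ->
  forall q, c q = <[X0 q]>%VS.
Proof.
move=> [[dimc _] _ _] [[_ cX] X1] q; apply/eqP; rewrite eq_sym eqEdim.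
rewrite -memvE (cX q I) dimc nk dim_vline (_ : X0 q != 0) //.
by apply/eqP => X00; have := X1 q; rewrite X00 pairing0 => /eqP; rewrite eq_sym oner_eq0.
Qed.

(** The arbitrary choice of a vector of c q is cancelled by the normalization:
    locally, X0 is a smooth frame of c divided by its value under eta. *)
Lemma generator_exists c : is_complement S c -> exists X0, is_generator eta c X0.
Proof.
move=> [[dimc frame] _ cD].
have cn0 q v : v \in c q -> v != 0 -> pairing (eta q) v != 0.
  move=> cv v0; apply/eqP => /Deta Dv; case/eqP: v0; apply/eqP.
  by rewrite -memv0 -(cD q) memv_cap Dv cv.
pose X0 : vfield M := fun q => (pairing (eta q) (vpick (c q)))^-1 *: vpick (c q).
have v0 q : vpick (c q) != 0 by rewrite vpick0 -dimv_eq0 dimc nk.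
have X01 q : pairing (eta q) (X0 q) = 1.
  by rewrite pairingZr mulVf // cn0 // memv_pick.
exists X0; split=> //; split; last by move=> q _; rewrite memvZ // memv_pick.
apply/smooth_vfieldP; first exact: openT.
move=> q _; have [U [Y [oU Uq sY cY]]] := frame q.
have i0 : 'I_(n - k) by rewrite nk; exact: ord0.
have cE p : U p -> c p = <[Y i0 p]>%VS.
  by move=> Up; rewrite (cY p Up) (span_ord1 _ i0).
have X0E p : U p -> X0 p = (pairing (eta p) (Y i0 p))^-1 *: Y i0 p + 0.
  move=> Up; have cY0 : Y i0 p \in c p by rewrite cE // memv_line.
  have /vlineP[a ea] : vpick (c p) \in <[Y i0 p]>%VS by rewrite -cE // memv_pick.
  have a0 : a != 0 by apply/eqP => a0; have := v0 p; rewrite ea a0 scale0r eqxx.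
  rewrite /X0 ea pairingZr addr0 scalerA invfM mulrAC mulVf // mul1r //.
have Y1 p : U p -> pairing (eta p) (Y i0 p) != 0.
  move=> Up; apply: cn0; first by rewrite cE // memv_line.
  by apply/eqP => Y0; have := dimc p; rewrite nk cE // Y0 dim_vline eqxx.
apply: (@smooth_vat_eq _ _ _ (fun p => (pairing (eta p) (Y i0 p))^-1 *: Y i0 p + 0)).
  have : nbhs q U by apply: open_nbhs_nbhs.
  by apply: filterS => p /X0E ->.
have sYq i : smooth_vat (Y i) q by have /(smooth_vfieldP _ oU) := sY i; apply.
apply: (@smooth_vat_lin _ _ _ (fun p => (pairing (eta p) (Y i0 p))^-1) (Y i0) (fun=> 0)).
- apply: smooth_atV; first exact: Y1.
  by have /(smooth_funP _ oU) := seta oU (sY i0); apply.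
- exact: sYq.
- exact: smooth_vat0.
Qed.

Lemma complement_of_generator X0 : smooth_vfield setT X0 ->
  (forall q, pairing (eta q) (X0 q) = 1) ->
  is_complement S (fun q => <[X0 q]>%VS) /\
  is_generator eta (fun q => <[X0 q]>%VS) X0.
Proof.
move=> sX X1; split; last by split=> //; split=> // q _; exact: memv_line.
have X00 q : X0 q != 0.
  by apply/eqP => X00; have := X1 q; rewrite X00 pairing0 => /eqP; rewrite eq_sym oner_eq0.
split.
- rewrite nk; split=> [q|q]; first by rewrite dim_vline X00.
  exists setT, (fun=> X0); split=> //; first exact: openT.
  by move=> p _; rewrite /image_mem enum_ordSl enum_ord0 /= span_seq1.
- move=> q; apply/eqP; rewrite eqEsubv subvf /=; apply/subvP => v _.
  rewrite -(subrK (pairing (eta q) v *: X0 q) v) memv_add ?memvZ ?memv_line //.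
  by apply/Deta; rewrite pairingBr pairingZr X1 mulr1 subrr.
- move=> q; apply/eqP; rewrite -subv0; apply/subvP => v; rewrite memv_cap.
  case/andP => /Deta Dv /vlineP[a va]; move: Dv; rewrite va pairingZr X1 mulr1 => ->.
  by rewrite scale0r mem0v.
Qed.

Section Variation.
Variables (q : M) (U : set M) (X : 'I_k -> vfield M) (f : M -> R).
Hypotheses (oU : open U) (Uq : U q).
Hypothesis sX : forall i, section_on U D (X i).
Hypothesis onX : forall p, U p -> orthonormal_basis S p (X ^~ p).
Hypothesis Sf : smooth_at f q.

Let oe : orthonormal_basis S q (X ^~ q). Proof. exact: onX. Qed.

Lemma endo_distr v : v \in D q -> J q v \in D q.
Proof. by move=> Dv; apply: (subvP (endoJ.1 q)); exact: memv_img. Qed.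

(** The fields of the frame are annihilated by eta, so that only the bracket
    contributes to d eta. *)
Lemma endo_frame i j :
  g q (X i q) (J q (X j q)) = - pairing (eta q) (bracket (X i) (X j) q).
Proof.
rewrite (endoJ.2 U _ _ oU (sX i) (sX j) q Uq) /ext_d.
have H l l' : vact (X l) (form_eval eta (X l')) q = 0.
  rewrite /vact (@dact_eq _ _ _ q _ _ (fun=> 0)) ?dact_cst //.
  have : nbhs q U by apply: open_nbhs_nbhs.
  by apply: filterS => p Up; apply/Deta; exact: (sX l').2.
by rewrite !H subrr sub0r.
Qed.

(** Replacing x0 by x0 + xi changes the component of [X_i, X_j] along X_i by
    - eta([X_i, X_j]) g(X_i, xi), and eta([X_i, X_j]) = g(X_j, J X_i). *)
Lemma laplacian_variation x0 xi : pairing (eta q) x0 = 1 -> xi \in D q ->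
  frame_laplacian S q X (eta q) (x0 + xi) f =
  frame_laplacian S q X (eta q) x0 f - dact q (J q xi) f.
Proof.
move=> x01 Dxi; rewrite /frame_laplacian -addrA; congr (_ + _).
have De i : X i q \in D q by exact: oe.1.
set b := fun i j => bracket (X i) (X j) q.
have -> : dact q (J q xi) f =
    \sum_i \sum_j (pairing (eta q) (b i j) * g q (X i q) xi) * vact (X j) f q.
  rewrite {1}(onb_decomp oe (endo_distr Dxi)) dact_sumv // exchange_big.
  apply: eq_bigr => j _; rewrite -mulr_suml; congr (_ * _).
  rewrite {1}(onb_decomp oe Dxi) linear_sum metric_sumr // => [|i]; last first.
    by rewrite linearZ memvZ // endo_distr.
  apply: eq_bigr => i _; rewrite linearZ metricZr ?endo_distr //.
  by rewrite endo_frame bracketC pairingNr opprK mulrC.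
rewrite -sumrB; apply: eq_bigr => i _; rewrite -sumrB; apply: eq_bigr => j _.
rewrite -mulrBl; congr (_ * _); rewrite -/(b i j) scalerDr opprD addrA.
have Dx : b i j - pairing (eta q) (b i j) *: x0 \in D q.
  by apply/Deta; rewrite pairingBr pairingZr x01 mulr1 subrr.
have Dy : - (pairing (eta q) (b i j) *: xi) \in D q by rewrite memvN memvZ.
by rewrite (metricDr Dx Dy (De i)); congr (_ + _); rewrite -scaleNr metricZr // mulNr.
Qed.

End Variation.

(** * The equation between the two Laplacians *)

Variables (muS muV : subbundle M -> M -> probability (borel_cov R n) R) (omega : nform M).
Hypothesis adm : forall c, is_complement S c -> admissible_measures S c (muS c) (muV c).
Hypothesis vol : volume_form omega.

Lemma micro_value c X0 q U (X : 'I_k -> vfield M) f :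
  is_complement S c -> is_generator eta c X0 ->
  open U -> U q -> (forall i, section_on U D (X i)) ->
  (forall p, U p -> orthonormal_basis S p (X ^~ p)) -> smooth_at f q ->
  (fun t : R => ((2 * k%:R / t ^+ 2)%:E *
     cylinder_integral (muS c q) (muV c q) (fun l => f (sr_exp S q t l) - f q)%R)%E)
    @ 0^'+ --> (frame_laplacian S q X (eta q) (X0 q) f)%:E.
Proof.
move=> Cc gX oU Uq sX onX Sf; have [A1 A2 _] := adm Cc.
apply: (micro_limit oU Uq (fun i => (sX i).1) onX Sf (Deta q) (gX.2 q)
  (complement_line Cc gX q) (A1 q) (A2 q)).
Qed.

(** Translating the generator by xi changes the microscopic Laplacian by the
    derivative along - J xi = 0. *)
Lemma agree_shift c X0 xi : is_complement S c -> is_generator eta c X0 ->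
  laplacians_agree S omega (muS c) (muV c) -> is_section (ker_endo S J) xi ->
  exists c1, (is_complement S c1 /\ laplacians_agree S omega (muS c1) (muV c1)) /\
    is_generator eta c1 (X0 \+ xi).
Proof.
move=> Cc gX agree [sxi kxi].
have Dxi q : xi q \in D q by have := kxi q I; rewrite memv_cap => /andP[].
have Jxi q : J q (xi q) = 0.
  by have := kxi q I; rewrite memv_cap memv_ker => /andP[_ /eqP].
have sX1 : smooth_vfield setT (X0 \+ xi).
  apply/smooth_vfieldP => [|q _]; first exact: openT.
  have /(smooth_vfieldP _ openT)/(_ q I) s0 := gX.1.1.
  have /(smooth_vfieldP _ openT)/(_ q I) s1 := sxi.
  apply: smooth_vat_eq (smooth_vat_lin (smooth_at_cst 1 q) s0 s1).
  by near=> p; rewrite scale1r.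
have X11 q : pairing (eta q) ((X0 \+ xi) q) = 1.
  by rewrite pairingDr gX.2; have /Deta -> := Dxi q; rewrite addr0.
have [C1 g1] := complement_of_generator sX1 X11.
exists (fun q => <[(X0 \+ xi) q]>%VS); split; [split; first exact: C1|exact: g1].
move=> f sf.
have [psi [mac mic]] := agree f sf; exists psi; split; [exact: mac|move=> q].
have Sf : smooth_at f q by have /(smooth_funP _ openT) := sf; apply.
have [U [X [oU Uq sX onX]]] := local_orthonormal_frame S q.
have l0 := micro_value Cc gX oU Uq sX onX Sf.
have l1 := micro_value C1 g1 oU Uq sX onX Sf.
have [E] : (psi q)%:E = (frame_laplacian S q X (eta q) (X0 q) f)%:E.
  exact: (cvg_unique (@ereal_hausdorff R) (mic q) l0).
rewrite E; move: l1; rewrite (laplacian_variation oU Uq sX onX Sf (gX.2 q) (Dxi q)).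
by rewrite Jxi /dact derive0 subr0.
Unshelve. all: by end_near. Qed.

(** Both microscopic Laplacians are equal to the macroscopic one, so that the
    derivative of every smooth function along J (X1 - X0) vanishes. *)
Lemma agree_difference c0 c1 X0 X1 :
  is_complement S c0 -> is_generator eta c0 X0 ->
  laplacians_agree S omega (muS c0) (muV c0) ->
  is_complement S c1 -> is_generator eta c1 X1 ->
  laplacians_agree S omega (muS c1) (muV c1) ->
  is_section (ker_endo S J) (X1 \- X0).
Proof.
move=> C0 g0 agree0 C1 g1 agree1.
have Dxi q : X1 q - X0 q \in D q by apply/Deta; rewrite pairingBr g1.2 g0.2 subrr.
split.
  apply/smooth_vfieldP => [|q _]; first exact: openT.
  have /(smooth_vfieldP _ openT)/(_ q I) s0 := g0.1.1.
  have /(smooth_vfieldP _ openT)/(_ q I) s1 := g1.1.1.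
  apply: smooth_vat_eq (smooth_vat_lin (smooth_at_cst (-1) q) s0 s1).
  by near=> p; rewrite scaleN1r addrC.
move=> q _; rewrite memv_cap Dxi memv_ker /=; apply/eqP; apply: (@tangent_eq0 _ _ _ q) => f sf.
have Sf : smooth_at f q by have /(smooth_funP _ openT) := sf; apply.
have [psi0 [mac0 mic0]] := agree0 f sf; have [psi1 [mac1 mic1]] := agree1 f sf.
have [U [X [oU Uq sX onX]]] := local_orthonormal_frame S q.
have [E0] : (psi0 q)%:E = (frame_laplacian S q X (eta q) (X0 q) f)%:E.
  exact: (cvg_unique (@ereal_hausdorff R) (mic0 q) (micro_value C0 g0 oU Uq sX onX Sf)).
have [E1] : (psi1 q)%:E = (frame_laplacian S q X (eta q) (X1 q) f)%:E.
  exact: (cvg_unique (@ereal_hausdorff R) (mic1 q) (micro_value C1 g1 oU Uq sX onX Sf)).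
have := macro_unique vol mac0 mac1 q; rewrite E0 E1.
have E : X1 q = X0 q + (X1 q - X0 q) by rewrite addrC subrK.
rewrite [in RHS]E.
rewrite (laplacian_variation oU Uq sX onX Sf (g0.2 q) (Dxi q)) => /eqP.
by rewrite -subr_eq0 opprB addrC subrK => /eqP.
Unshelve. all: by end_near. Qed.

End Complements.

Theorem theorem12 (R : realType) (d : nat)
    (M : smooth_manifold R (2 * d + 2)) (S : subriemannian M (2 * d + 1))
    (eta : oneform M) (J : M -> 'End('rV[R]_(2 * d + 2)))
    (omega : nform M)
    (muS muV : subbundle M -> M -> probability (borel_cov R (2 * d + 2)) R) :
  quasi_contact S eta J ->
  volume_form omega ->
  (forall c, is_complement S c -> admissible_measures S c (muS c) (muV c)) ->
  let complements :=
    [set c | is_complement S c /\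
             laplacians_agree S omega (muS c) (muV c)] in
  let generators :=
    [set X0 | exists2 c, complements c & is_generator eta c X0] in
  complements = set0 \/
  (generators !=set0 /\
   forall X0, generators X0 ->
     generators = [set X0 \+ xi | xi in is_section (ker_endo S J)]).
Proof.
move=> [_ [seta Deta] endoJ _ _] vol adm complements generators.
have nk : (2 * d + 2 - (2 * d + 1))%N = 1%N by rewrite addnS subSnn.
have [[c [Cc agree]]|no] := pselect (exists c, complements c); [right|left]; last first.
  by apply/seteqP; split=> // c Cc; apply: no; exists c.
split.
  have [X0 g0] := generator_exists nk seta Deta Cc.
  by exists X0, c.
move=> X0 [c0 [C0 agree0] g0]; apply/seteqP; split=> [X1 [c1 [C1 agree1] g1]|_ [xi kxi <-]].
  exists (X1 \- X0).
    exact: (agree_difference nk Deta endoJ adm vol C0 g0 agree0 C1 g1 agree1).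
  by apply/funext => q; rewrite /= addrC subrK.
have [c1 [Cc1 g1]] := agree_shift nk Deta endoJ adm C0 g0 agree0 kxi.
by exists c1.
Qed.
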